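(* In the setting of the context (Neimark--Sacker bifurcation of an autonomous system), assume there is no strong resonance, i.e. $\omega^\star\notin\{\frac13,\frac14\}$. Then the system $$\boldsymbol G(\boldsymbol z(\theta,\phi),\lambda,\eta,\theta;\varepsilon)-\eta\boldsymbol e_n-\left[(1+\varepsilon\eta)\frac{\partial}{\partial\theta}+\omega\frac{\partial}{\partial\phi}\right]\boldsymbol z(\theta,\phi)=\boldsymbol 0,\qquad\boldsymbol\gamma_1(\boldsymbol z)-\widehat{\boldsymbol e}_1=\boldsymbol 0,\qquad\gamma_2(\boldsymbol z)=0$$ can be expanded in powers of $\varepsilon$ and an asymptotic solution $\lambda^E(\varepsilon),\omega^E(\varepsilon),\eta^E(\varepsilon),\boldsymbol z^E(\theta,\phi;\varepsilon)$ constructed up to and including the $\varepsilon^2$ terms (i.e. satisfying the system up to a remainder $O(\varepsilon^3)$), of the form $$\lambda^E(\varepsilon)=\lambda^\star+\varepsilon^2\lambda_2^E,\quad\omega^E(\varepsilon)=\omega^\star+\varepsilon^2\omega_2^E,\quad\eta^E(\varepsilon)=\varepsilon\eta_2^E,\quad\boldsymbol z^E(\theta,\phi;\varepsilon)=\boldsymbol a^\star(\phi)+\varepsilon\boldsymbol z_2^E(\theta,\phi)+\varepsilon^2\boldsymbol z_3^E(\theta,\phi),$$ where $\boldsymbol z_2^E$ only depends on the Fourier $\phi$-modes $0$ and $2$ and $\boldsymbol z_3^E$ only depends on the Fourier $\phi$-modes $1$ and $3$. The amplitude and phase conditions force $$\langle\langle\boldsymbol z_3^E(\theta,\phi),\boldsymbol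 a^\star(\phi)\rangle\rangle=0=\langle\langle\boldsymbol z_3^E(\theta,\phi),\dot{\boldsymbol a}^\star(\phi)\rangle\rangle\quad\text{and}\quad\langle\langle\boldsymbol z_2^E(\theta,\phi),\boldsymbol e_n\rangle\rangle=0.$$ In terms of Fourier $\phi$-modes, $$\boldsymbol z^E(\theta,\phi;\varepsilon)=\boldsymbol a^\star(\phi)+\boldsymbol a_0^E(\theta;\varepsilon)+\sum_{m=1}^3\left\{\boldsymbol a_m^E(\theta;\varepsilon)\cos m\phi+\boldsymbol b_m^E(\theta;\varepsilon)\sin m\phi\right\},$$ where $\boldsymbol a_0^E,\boldsymbol a_2^E,\boldsymbol b_2^E$ are $\varepsilon$-terms (i.e. $\varepsilon$ times a function of $\theta$) and $\boldsymbol a_1^E,\boldsymbol b_1^E,\boldsymbol a_3^E,\boldsymbol b_3^E$ are $\varepsilon^2$-terms. Again, the amplitude and phase conditions force $$\langle\boldsymbol a_1^E(\theta;\varepsilon),\boldsymbol e_1\rangle+\langle\boldsymbol b_1^E(\theta;\varepsilon),\boldsymbol e_2\rangle=0,\quad\langle\boldsymbol a_1^E(\theta;\varepsilon),\boldsymbol e_2\rangle-\langle\boldsymbol b_1^E(\theta;\varepsilon),\boldsymbol e_1\rangle=0\quad\text{and}\quad\langle\boldsymbol a_0^E(\theta;\varepsilon),\boldsymbol e_n\rangle=0.$$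
   Context: Setting (autonomous Neimark--Sacker bifurcation). $\mathbb S^1=\mathbb R/2\pi\mathbb Z$; $\boldsymbol F:\mathbb R^n\times\mathbb R\to\mathbb R^n$ is smooth; the system is $\frac{d\boldsymbol x}{dt}=\boldsymbol F(\boldsymbol x,\lambda)$; $\mathsf J(\boldsymbol x,\lambda)$ is the Jacobian matrix of $\boldsymbol F$ with respect to $\boldsymbol x$. Assume: (1) At $\lambda=\lambda^\star$ the system has a periodic orbit of period $2\pi T^\star$; rescaled to $\boldsymbol v^\star:\mathbb S^1\to\mathbb R^n$ it satisfies $T^\star\boldsymbol F(\boldsymbol v^\star(\theta),\lambda^\star)-\frac{d}{d\theta}\boldsymbol v^\star(\theta)=\boldsymbol 0$. (2) There are $\mathsf E^\star\in\mathbb R^{n\times n}$ and $\mathsf P^\star:\mathbb S^1\to\mathbb R^{n\times n}$ with $\mathsf P^\star(\theta)$ non-singular for all $\theta$ (so all Floquet vectors are taken $2\pi$-periodic) such that $T^\star\mathsf J(\boldsymbol v^\star(\theta),\lambda^\star)\mathsf P^\star(\theta)-\dot{\mathsf P}^\star(\theta)=\mathsf P^\star(\theta)\mathsf E^\star$, $\mathsf E^\star=\mathrm{diag}(\widehat{\mathsf E}^\star,\widetilde{\mathsf E}^\star,0)$, $\widehat{\mathsf E}^\star=\begin{pmatrix}0&-\omega^\star\\ \omega^\star&0\end{pmatrix}$, $\omega^\star>0$, and $\widetilde{\mathsf E}^\star\in\mathbb R^{(n-3)\times(n-3)}$ with no eigenvalues on the imaginary axis. The imaginary parts of the eigenvalues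 of $\mathsf E^\star$ (Floquet exponents) are taken in $(-\frac12,\frac12)$, so that $0<\omega^\star<\frac12$. Consequently, for $\lambda$ near $\lambda^\star$ there are smooth continuations $T^\star(\lambda)$, $\boldsymbol v^\star(\theta;\lambda)$, $\mathsf P(\theta;\lambda)$ (non-singular, $2\pi$-periodic in $\theta$), $\mathsf E(\lambda)$ with $T^\star(\lambda)\boldsymbol F(\boldsymbol v^\star(\theta;\lambda),\lambda)=\frac{d}{d\theta}\boldsymbol v^\star(\theta;\lambda)$, $T^\star(\lambda)\mathsf J(\boldsymbol v^\star(\theta;\lambda),\lambda)\mathsf P(\theta;\lambda)-\dot{\mathsf P}(\theta;\lambda)=\mathsf P(\theta;\lambda)\mathsf E(\lambda)$ (here $\dot{\mathsf P}=\partial\mathsf P/\partial\theta$), $\mathsf E(\lambda)=\mathrm{diag}(\widehat{\mathsf E}(\lambda),\widetilde{\mathsf E}(\lambda),0)$, $\widehat{\mathsf E}(\lambda)=\begin{pmatrix}\alpha_R(\lambda)&-\alpha_I(\lambda)\\ \alpha_I(\lambda)&\alpha_R(\lambda)\end{pmatrix}$. The last column of $\mathsf P(\theta;\lambda)$ is $\frac{d}{d\theta}\boldsymbol v^\star(\theta;\lambda)$. (3) Transversality: $\dot\alpha_R(\lambda^\star)\ne0$ (dot on $\alpha_R$ denotes $d/d\lambda$). Notation. $\boldsymbol a^\star(\phi)=(\cos\phi,\sin\phi,0,\dots,0)^T$, $\dot{\boldsymbol a}^\star(\phi)=(-\sin\phi,\cos\phi,0,\dots,0)^T\in\mathbb R^n$;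 $\boldsymbol e_j$ is the $j$-th unit vector of $\mathbb R^n$; $\widehat{\boldsymbol e}_1=(1,0)^T$. $\langle\boldsymbol w_1,\boldsymbol w_2\rangle=\frac1{2\pi}\int_0^{2\pi}\boldsymbol w_1(\theta)\cdot\boldsymbol w_2(\theta)\,d\theta$; $\langle\langle\boldsymbol w_1,\boldsymbol w_2\rangle\rangle=\frac1{(2\pi)^2}\int_0^{2\pi}\int_0^{2\pi}\boldsymbol w_1(\theta,\phi)\cdot\boldsymbol w_2(\theta,\phi)\,d\theta\,d\phi$. For $\boldsymbol z:\mathbb S^1\times\mathbb S^1\to\mathbb R^n$, $\boldsymbol\gamma_1(\boldsymbol z)=(\langle\langle\boldsymbol z,\boldsymbol a^\star(\phi)\rangle\rangle,\langle\langle\boldsymbol z,\dot{\boldsymbol a}^\star(\phi)\rangle\rangle)^T$ and $\gamma_2(\boldsymbol z)=\langle\langle\boldsymbol z,\boldsymbol e_n\rangle\rangle$ (the equations $\boldsymbol\gamma_1(\boldsymbol z)=\widehat{\boldsymbol e}_1$, $\gamma_2(\boldsymbol z)=0$ are the amplitude and phase conditions), and for $\lambda,\eta\in\mathbb R$ $$\boldsymbol G(\boldsymbol z,\lambda,\eta,\theta;\varepsilon)=\tfrac1\varepsilon\mathsf P(\theta;\lambda)^{-1}\Big\{T^\star(\lambda)\boldsymbol F\big(\boldsymbol v^\star(\theta;\lambda)+\varepsilon\mathsf P(\theta;\lambda)\boldsymbol z,\lambda\big)-T^\star(\lambda)\boldsymbol F\big(\boldsymbol v^\star(\theta;\lambda),\lambda\big)-\varepsilon[1+\varepsilon\eta]\dot{\mathsf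 P}(\theta;\lambda)\boldsymbol z\Big\},$$ with expansion $\boldsymbol G=\mathsf E(\lambda)\boldsymbol z+\varepsilon\eta\boldsymbol G_1(\boldsymbol z;\lambda,\theta)+\sum_{p\ge2}\varepsilon^{p-1}\boldsymbol G_p(\boldsymbol z;\lambda,\theta)$, $\boldsymbol G_p$ homogeneous of degree $p$ in $\boldsymbol z$. Fourier $\phi$-modes of $\boldsymbol z$ are the modes $\cos m\phi,\sin m\phi$ with $\theta$-dependent coefficients. *)

(* Defs.v *)
From HB Require Import structures.
From mathcomp Require Import all_boot all_order all_algebra.
From mathcomp Require Import all_classical all_reals all_analysis.
From mathcomp Require Import complex.

Set Implicit Arguments.
Unset Strict Implicit.
Unset Printing Implicit Defensive.

Import Order.TTheory GRing.Theory Num.Theory.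
Import numFieldNormedType.Exports.

Local Open Scope classical_set_scope.
Local Open Scope ring_scope.

(* For an open set A of a finite-dimensional space this is the usual C^k:
   all iterated directional derivatives up to order k exist and are
   continuous on A. *)
Fixpoint C_k (R : realType) (V W : normedModType R) (k : nat) (A : set V)
    (f : V -> W) : Prop :=
  match k with
  | 0%N => forall x, A x -> {for x, continuous f}
  | k'.+1 => (forall x v, A x -> derivable f x v) /\
             (forall v, C_k k' A (fun x => 'D_v f x))
  end.

Definition smooth_on (R : realType) (V W : normedModType R) (A : set V)
    (f : V -> W) : Prop := forall k, C_k k A f.

(* The phase-space dimension n >= 3 is written 2 + (m + 1) with m = n - 3, in
   accordance with the block decomposition of the Floquet matrix. *)
Notation ns_dim m := (2 + (m + 1))%N.

(* Functions on the circle R / 2 pi Z and on the torus are represented by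
   2 pi-periodic functions of real variables. *)
Definition periodic (R : realType) (T : Type) (f : R -> T) : Prop :=
  forall t, f (t + 2 * pi) = f t.

Definition smooth_circle (R : realType) (W : normedModType R) (f : R -> W)
    : Prop := periodic f /\ smooth_on setT f.

Definition smooth_torus (R : realType) (W : normedModType R) (f : R -> R -> W)
    : Prop :=
  [/\ forall phi, periodic (f ^~ phi),
      forall theta, periodic (f theta) &
      smooth_on setT (fun p : R * R => f p.1 p.2)].

Section UnitVectors.
Context (R : realType) (m : nat).

Definition e_1 : 'cV[R]_(ns_dim m) := delta_mx (lshift (m + 1) ord0) 0.
Definition e_2 : 'cV[R]_(ns_dim m) := delta_mx (lshift (m + 1) ord_max) 0.
Definition e_n : 'cV[R]_(ns_dim m) := delta_mx (rshift 2 (rshift m ord0)) 0.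

Definition a_star (phi : R) : 'cV[R]_(ns_dim m) :=
  cos phi *: e_1 + sin phi *: e_2.
Definition a_star_dot (phi : R) : 'cV[R]_(ns_dim m) :=
  - sin phi *: e_1 + cos phi *: e_2.

Definition hat_e_1 : 'cV[R]_2 := delta_mx ord0 0.
End UnitVectors.
Arguments e_1 {R m}.
Arguments e_2 {R m}.
Arguments e_n {R m}.
Arguments a_star {R m} phi.
Arguments a_star_dot {R m} phi.
Arguments hat_e_1 {R}.

Definition dot (R : realType) (n : nat) (u v : 'cV[R]_n) : R :=
  \sum_i u i 0 * v i 0.

Definition inner1 (R : realType) (n : nat) (w1 w2 : R -> 'cV[R]_n) : R :=
  (2 * pi)^-1 *
  \int[lebesgue_measure]_(theta in `[0, 2 * pi]) dot (w1 theta) (w2 theta).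

Definition inner2 (R : realType) (n : nat) (w1 w2 : R -> R -> 'cV[R]_n) : R :=
  ((2 * pi) ^+ 2)^-1 *
  \int[lebesgue_measure]_(phi in `[0, 2 * pi])
    \int[lebesgue_measure]_(theta in `[0, 2 * pi])
      dot (w1 theta phi) (w2 theta phi).

Definition gamma_1 (R : realType) (m : nat) (z : R -> R -> 'cV[R]_(ns_dim m))
    : 'cV[R]_2 :=
  \col_i (if i == ord0 then inner2 z (fun _ phi => a_star phi)
          else inner2 z (fun _ phi => a_star_dot phi)).

Definition gamma_2 (R : realType) (m : nat) (z : R -> R -> 'cV[R]_(ns_dim m))
    : R := inner2 z (fun _ _ => e_n).

Definition rot_block (R : realType) (a b : R) : 'M[R]_2 :=
  \matrix_(i, j) (if i == j then a else if (i < j)%N then - b else b).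

Definition floquet_block (R : realType) (m : nat) (Ehat : 'M[R]_2)
    (Etilde : 'M[R]_m) : 'M[R]_(ns_dim m) :=
  block_mx Ehat 0 0 (block_mx Etilde 0 0 0).

Definition Jac (R : realType) (m : nat)
    (F : 'cV[R]_(ns_dim m) -> R -> 'cV[R]_(ns_dim m))
    (x : 'cV[R]_(ns_dim m)) (lam : R) : 'M[R]_(ns_dim m) :=
  \matrix_(i, j) ('D_(delta_mx j 0) (F ^~ lam) x) i 0.

Definition complex_eigenvalue (R : realType) (n : nat) (A : 'M[R]_n) (a : R[i])
    : bool := eigenvalue (map_mx (real_complex R) A) a.

(* [_star] marks the data at the bifurcation value; the other functions are
   the continuations, meaningful for |lam - lam_star| < rad only. *)
Record ns_data (R : realType) (m : nat) := NSData {
  F : 'cV[R]_(ns_dim m) -> R -> 'cV[R]_(ns_dim m);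
  lam_star : R;
  T_star : R;
  v_star : R -> 'cV[R]_(ns_dim m);
  P_star : R -> 'M[R]_(ns_dim m);
  om_star : R;
  Etilde_star : 'M[R]_m;
  rad : R;
  T : R -> R;
  v : R -> R -> 'cV[R]_(ns_dim m);
  P : R -> R -> 'M[R]_(ns_dim m);
  alpha_R : R -> R;
  alpha_I : R -> R;
  Etilde : R -> 'M[R]_m
}.

Definition E_star (R : realType) (m : nat) (S : ns_data R m)
    : 'M[R]_(ns_dim m) :=
  floquet_block (rot_block 0 (om_star S)) (Etilde_star S).

Definition E (R : realType) (m : nat) (S : ns_data R m) (lam : R)
    : 'M[R]_(ns_dim m) :=
  floquet_block (rot_block (alpha_R S lam) (alpha_I S lam)) (Etilde S lam).

Definition v_dot (R : realType) (m : nat) (S : ns_data R m) (theta lam : R)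
    : 'cV[R]_(ns_dim m) := derive1 (fun t => v S t lam) theta.

Definition P_dot (R : realType) (m : nat) (S : ns_data R m) (theta lam : R)
    : 'M[R]_(ns_dim m) := derive1 (fun t => P S t lam) theta.

Record ns_orbit (R : realType) (m : nat) (S : ns_data R m) : Prop := {
  F_smooth : smooth_on setT (fun p : 'cV[R]_(ns_dim m) * R => F S p.1 p.2);
  T_star_gt0 : 0 < T_star S;
  v_star_circle : smooth_circle (v_star S);
  v_star_eq : forall theta,
    T_star S *: F S (v_star S theta) (lam_star S)
      - derive1 (v_star S) theta = 0
}.

Record ns_floquet (R : realType) (m : nat) (S : ns_data R m) : Prop := {
  P_star_circle : smooth_circle (P_star S);
  P_star_unit : forall theta, P_star S theta \in unitmx;
  P_star_eq : forall theta,
    T_star S *: (Jac (F S) (v_star S theta) (lam_star S) *m P_star S theta)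
      - derive1 (P_star S) theta = P_star S theta *m E_star S;
  om_star_bounds : 0 < om_star S < 2^-1;
  Etilde_star_hyperbolic : forall a : R[i],
    complex.Re a = 0 -> ~~ complex_eigenvalue (Etilde_star S) a;
  floquet_exponents : forall a : R[i],
    complex_eigenvalue (E_star S) a -> `|complex.Im a| < 2^-1
}.

Record ns_continuation (R : realType) (m : nat) (S : ns_data R m) : Prop := {
  rad_gt0 : 0 < rad S;
  T_smooth : smooth_on [set lam | `|lam - lam_star S| < rad S] (T S);
  v_smooth : smooth_on [set p : R * R | `|p.2 - lam_star S| < rad S]
    (fun p => v S p.1 p.2);
  P_smooth : smooth_on [set p : R * R | `|p.2 - lam_star S| < rad S]
    (fun p => P S p.1 p.2);
  E_smooth : smooth_on [set lam | `|lam - lam_star S| < rad S] (E S);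
  T_at_star : T S (lam_star S) = T_star S;
  v_at_star : forall theta, v S theta (lam_star S) = v_star S theta;
  P_at_star : forall theta, P S theta (lam_star S) = P_star S theta;
  E_at_star : E S (lam_star S) = E_star S;
  v_periodic : forall lam, `|lam - lam_star S| < rad S ->
    periodic (v S ^~ lam);
  P_periodic : forall lam, `|lam - lam_star S| < rad S ->
    periodic (P S ^~ lam);
  P_unit : forall theta lam, `|lam - lam_star S| < rad S ->
    P S theta lam \in unitmx;
  v_eq : forall theta lam, `|lam - lam_star S| < rad S ->
    T S lam *: F S (v S theta lam) lam = v_dot S theta lam;
  P_eq : forall theta lam, `|lam - lam_star S| < rad S ->
    T S lam *: (Jac (F S) (v S theta lam) lam *m P S theta lam)
      - P_dot S theta lam = P S theta lam *m E S lam;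
  P_last_col : forall theta lam, `|lam - lam_star S| < rad S ->
    P S theta lam *m e_n = v_dot S theta lam
}.

Record neimark_sacker (R : realType) (m : nat) (S : ns_data R m) : Prop := {
  NS_orbit : ns_orbit S;
  NS_floquet : ns_floquet S;
  NS_continuation : ns_continuation S;
  NS_transversality : derive1 (alpha_R S) (lam_star S) != 0
}.

Definition G (R : realType) (m : nat) (S : ns_data R m)
    (z : 'cV[R]_(ns_dim m)) (lam eta theta eps : R) : 'cV[R]_(ns_dim m) :=
  eps^-1 *: (invmx (P S theta lam) *m
    (T S lam *: F S (v S theta lam + eps *: (P S theta lam *m z)) lam
     - T S lam *: F S (v S theta lam) lam
     - (eps * (1 + eps * eta)) *: (P_dot S theta lam *m z))).

(* Since F is only smooth, the power series is an asymptotic one, locally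
   uniform in z, eta and lam, and uniform in theta. *)
Definition G_expansion (R : realType) (m : nat) (S : ns_data R m) : Prop :=
  exists Gp : nat -> 'cV[R]_(ns_dim m) -> R -> R -> 'cV[R]_(ns_dim m),
    (forall (p : nat) (c : R) z lam theta,
       `|lam - lam_star S| < rad S ->
       Gp p (c *: z) lam theta = c ^+ p *: Gp p z lam theta) /\
    forall (N : nat) (B : R), exists C d : R, 0 < d /\
      forall z lam eta theta eps,
        `|z| <= B -> `|eta| <= B -> `|lam - lam_star S| < d ->
        0 < `|eps| < d ->
        `|G S z lam eta theta eps
          - (E S lam *m z + (eps * eta) *: Gp 1%N z lam theta
             + \sum_(2 <= p < N.+1) eps ^+ p.-1 *: Gp p z lam theta)|
          <= C * `|eps| ^+ N.

Definition residual (R : realType) (m : nat) (S : ns_data R m)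
    (z : R -> R -> 'cV[R]_(ns_dim m)) (lam om eta eps theta phi : R)
    : 'cV[R]_(ns_dim m) :=
  G S (z theta phi) lam eta theta eps - eta *: e_n
  - ((1 + eps * eta) *: derive1 (fun t => z t phi) theta
     + om *: derive1 (z theta) phi).

Definition only_modes (R : realType) (m : nat) (ms : seq nat)
    (z : R -> R -> 'cV[R]_(ns_dim m)) : Prop :=
  exists a b : nat -> R -> 'cV[R]_(ns_dim m),
    (forall k, smooth_circle (a k) /\ smooth_circle (b k)) /\
    forall theta phi, z theta phi =
      \sum_(k <- ms) (cos (k%:R * phi) *: a k theta
                      + sin (k%:R * phi) *: b k theta).

Definition z_E (R : realType) (m : nat) (z2 z3 : R -> R -> 'cV[R]_(ns_dim m))
    (eps theta phi : R) : 'cV[R]_(ns_dim m) :=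
  a_star phi + eps *: z2 theta phi + eps ^+ 2 *: z3 theta phi.

Definition ansatz_form (R : realType) (m : nat)
    (z2 z3 : R -> R -> 'cV[R]_(ns_dim m)) : Prop :=
  [/\ smooth_torus z2, smooth_torus z3,
      only_modes [:: 0; 2]%N z2 & only_modes [:: 1; 3]%N z3].

Definition asymptotic_equation (R : realType) (m : nat) (S : ns_data R m)
    (lam2 om2 eta2 : R) (z2 z3 : R -> R -> 'cV[R]_(ns_dim m)) : Prop :=
  exists C : R, \forall eps \near 0^', forall theta phi,
    `|residual S (z_E z2 z3 eps) (lam_star S + eps ^+ 2 * lam2)
        (om_star S + eps ^+ 2 * om2) (eps * eta2) eps theta phi|
      <= C * `|eps| ^+ 3.

Definition amplitude_phase_conditions (R : realType) (m : nat)
    (z2 z3 : R -> R -> 'cV[R]_(ns_dim m)) : Prop :=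
  exists C : R, \forall eps \near 0^',
    `|gamma_1 (z_E z2 z3 eps) - hat_e_1| <= C * `|eps| ^+ 3 /\
    `|gamma_2 (z_E z2 z3 eps)| <= C * `|eps| ^+ 3.

Definition eps_term (R : realType) (m : nat) (k : nat)
    (f : R -> R -> 'cV[R]_(ns_dim m)) : Prop :=
  exists c : R -> 'cV[R]_(ns_dim m), smooth_circle c /\
    forall theta eps, f theta eps = eps ^+ k *: c theta.

Definition fourier_form (R : realType) (m : nat)
    (z2 z3 : R -> R -> 'cV[R]_(ns_dim m))
    (aE bE : nat -> R -> R -> 'cV[R]_(ns_dim m)) : Prop :=
  [/\ forall eps theta phi,
        z_E z2 z3 eps theta phi = a_star phi + aE 0%N theta eps
          + \sum_(1 <= k < 4) (cos (k%:R * phi) *: aE k theta eps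
                               + sin (k%:R * phi) *: bE k theta eps),
      [/\ eps_term 1 (aE 0%N), eps_term 1 (aE 2%N) & eps_term 1 (bE 2%N)] &
      [/\ eps_term 2 (aE 1%N), eps_term 2 (bE 1%N),
          eps_term 2 (aE 3%N) & eps_term 2 (bE 3%N)]].

(* Main.v *)
Require Import Defs.
From HB Require Import structures.
From mathcomp Require Import all_boot all_order all_algebra.
From mathcomp Require Import all_classical all_reals all_analysis.
From mathcomp Require Import complex.
From mathcomp Require Import ring lra.

Set Implicit Arguments.
Unset Strict Implicit.
Unset Printing Implicit Defensive.

Import Order.TTheory GRing.Theory Num.Theory.
Import numFieldNormedType.Exports.

Local Open Scope classical_set_scope.
Local Open Scope ring_scope.

(** Order by order in [eps] the system is a linear equation
    [E z - dz/dtheta - om dz/dphi = rhs] on the torus, with finitely many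
    [phi]-modes.  Mode by mode it is a periodic ODE [y' = (E - i k om) y + g]
    in [theta], which is solvable whenever no eigenvalue of [E - i k om] lies in
    [i Z]; the non-resonance conditions (with [0 < om < 1/2]) exclude this for
    the modes [0, 2, 3] of the rotation block, and hyperbolicity for the tilde
    block.  What remains resonant is a zero eigenvalue, hit by the mean value
    only: in mode 0 of the last component it is absorbed by [eta_2], and in
    mode 1 of the rotation block by [om_2] and, thanks to transversality,
    [lam_2].  The kernel left free there is fixed by the phase and amplitude
    conditions.  Uniformity in [theta] of all remainders comes from periodicity
    and compactness. *)

(** * Smooth functions on normed spaces *)

(** The strong resonances come from a count of modes. Quadratic terms in the first harmonic [a_star]
    give modes 0 and 2, and one further factor gives modes 1 and 3. Mode [k] meets the rotation
    block at the frequencies [(k - 1) om] and [(k + 1) om], so modes 2 and 3 produce [om], [3 om],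
    [2 om] and [4 om]; with [0 < om < 1/2] an integer arises only if [3 om = 1] or [4 om = 1]. As
    mode 1 is absent at order [eps], nothing there asks for an [eps]-term in [lam] or [om]. Since
    [G_p] carries [eps^(p-1)], expansion through [p = 3] leaves an error [O(eps^3)]; with
    [lam = l + eps^2 lam2], only the first [lam]-derivative of [E] enters to this order. [C_k]
    speaks of directional derivatives only. The chain rule and the Taylor bounds are therefore
    derived for real-valued functions from the mean value theorem in one variable, and vectors are
    treated entry by entry. *)

Lemma cvg_sum (R : realType) (T : Type) (F : set_system T) (FF : Filter F)
    (J : Type) (r : seq J) (f : J -> T -> R) (l : J -> R) :
  (forall j, f j x @[x --> F] --> l j) ->
  \sum_(j <- r) f j x @[x --> F] --> \sum_(j <- r) l j.
Proof.
move=> fl; elim: r => [|j r IH].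
  by under eq_fun do rewrite big_nil; rewrite big_nil; exact: cvg_cst.
under eq_fun do rewrite big_cons; rewrite big_cons.
exact: cvgD.
Qed.

Section MeanValue.
Context (R : realType) (V : normedModType R).

Lemma is_derive_line (f : V -> R) (x w : V) (s : R) :
  derivable f (s *: w + x) w ->
  is_derive s (1 : R) (fun t : R => f (t *: w + x)) ('D_w f (s *: w + x)).
Proof.
have E : (fun h : R => h^-1 *: (((fun t : R => f (t *: w + x)) \o shift s)
            (h *: (1 : R)) - f (s *: w + x)))
         = (fun h : R => h^-1 *: ((f \o shift (s *: w + x)) (h *: w)
            - f (s *: w + x))).
  by apply/funext => h /=; rewrite [h *: 1]mulr1 scalerDl addrA.
move=> df; apply: DeriveDef; first by rewrite /derivable E; exact: df.
by rewrite /derive E.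
Qed.

Lemma MVT_segment_itv (g dg : R -> R) (a b : R) : a <= b ->
  (forall t : R, a <= t <= b -> is_derive t (1 : R) g (dg t)) ->
  exists2 t : R, a <= t <= b & g b - g a = dg t * (b - a).
Proof.
move=> ab dgP.
have D x : x \in `]a, b[%R -> is_derive x (1 : R) g (dg x).
  by rewrite in_itv /= => /andP[ax xb]; apply: dgP; rewrite !ltW.
have C : {within `[a, b], continuous g}.
  apply: derivable_within_continuous => x; rewrite in_itv /= => xab.
  by have Dx := dgP _ xab; apply: ex_derive.
have [t tab E] := MVT_segment ab D C.
by exists t => //; move: tab; rewrite in_itv.
Qed.

Lemma MVT_abs (g dg : R -> R) (k : R) :
  (forall t : R, `|t| <= `|k| -> is_derive t (1 : R) g (dg t)) ->
  exists2 t : R, `|t| <= `|k| & g k - g 0 = k * dg t.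
Proof.
move=> dgP.
have [k0|k0] := leP 0 k.
  have [t /andP[t0 tk] E] : exists2 t : R, 0 <= t <= k & g k - g 0 = dg t * (k - 0).
    apply: MVT_segment_itv => // t /andP[t0 tk].
    by apply: dgP; rewrite !ger0_norm.
  by exists t; [rewrite !ger0_norm|rewrite E subr0 mulrC].
have [t /andP[t0 tk] E] : exists2 t : R, k <= t <= 0 & g 0 - g k = dg t * (0 - k).
  apply: MVT_segment_itv; first exact: ltW.
  by move=> t /andP[t0 tk]; apply: dgP; rewrite !ler0_norm ?lerN2 // ltW.
by exists t; [rewrite !ler0_norm ?lerN2 // ltW|lra].
Qed.

Lemma directional_MVT (f : V -> R) (x w : V) (k : R) :
  (forall t : R, `|t| <= `|k| -> derivable f (t *: w + x) w) ->
  exists2 t : R, `|t| <= `|k| & f (k *: w + x) - f x = k * 'D_w f (t *: w + x).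
Proof.
move=> df; have [t tk E] := @MVT_abs (fun t : R => f (t *: w + x))
  (fun t => 'D_w f (t *: w + x)) k (fun t tk => is_derive_line (df t tk)).
by exists t => //; move: E => /=; rewrite scale0r add0r.
Qed.

End MeanValue.

Section Basis.
Context (R : realType) (V : normedModType R) (I : finType).
Variables (b : I -> V) (c : I -> V -> R).
Hypothesis c_scalar : forall i, scalar (c i).
Hypothesis c_cont : forall i, continuous (c i).
Hypothesis bcE : forall x, x = \sum_i c i x *: b i.

(** Derivability is asked at every point because the mean value theorem is applied along a staircase
    near [x]; continuity is asked at [x], where the intermediate points accumulate. *)
Definition partials (f : V -> R) (x : V) :=
  forall i, (forall y, derivable f y (b i)) /\
            {for x, continuous (fun y => 'D_(b i) f y)}.

(** Staircase argument: the coordinates are added one at a time and the mean value theorem is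
    applied on each leg, [xi i] being its intermediate point. The bound is the total length of the
    legs, so all intermediate points tend to [x] with the increment. *)
Lemma increment_partials_seq (f : V -> R) (x : V) (s : seq I) (k : I -> R) :
  uniq s -> (forall i y, derivable f y (b i)) ->
  exists xi : I -> V,
    f (\sum_(i <- s) k i *: b i + x) - f x
      = \sum_(i <- s) k i * 'D_(b i) f (xi i) /\
    forall i, `|xi i - x| <= \sum_(i <- s) `|k i| * `|b i|.
Proof.
move=> + df; elim: s => [_|i s IH /= /andP[is_ us]].
  exists (fun=> x); split; first by rewrite !big_nil add0r subrr.
  by move=> i; rewrite big_nil subrr normr0.
have [xi [E le_xi]] := IH us.
have [t tk Et] := @directional_MVT R V f (\sum_(i <- s) k i *: b i + x) (b i)
  (k i) (fun t _ => df i _).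
exists (fun j => if j == i then t *: b i + (\sum_(i <- s) k i *: b i + x) else xi j).
split.
  rewrite !big_cons eqxx -Et -addrA -[LHS](subrKA (f (\sum_(i <- s) k i *: b i + x))).
  rewrite E; congr (_ + _); apply: eq_big_seq => j js.
  by rewrite (negPf (memPn is_ _ js)).
move=> j; rewrite big_cons; case: eqP => _.
  rewrite addrA addrK; apply: le_trans (ler_normD _ _) _; apply: lerD.
    by rewrite normrZ ler_wpM2r.
  apply: le_trans (ler_norm_sum _ _ _) _.
  by apply: ler_sum => l _; rewrite normrZ.
by apply: le_trans (le_xi j) _; rewrite lerDr mulr_ge0.
Qed.

Lemma increment_partials (f : V -> R) (x w : V) :
  (forall i y, derivable f y (b i)) ->
  exists xi : I -> V,
    f (w + x) - f x = \sum_i c i w * 'D_(b i) f (xi i) /\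
    forall i, `|xi i - x| <= \sum_i `|c i w| * `|b i|.
Proof.
move=> df.
have [xi xiP] := @increment_partials_seq f x (index_enum I) (c ^~ w)
  (index_enum_uniq _) df.
by exists xi; rewrite [X in X + x]bcE.
Qed.

Lemma coord0 i : c i 0 = 0.
Proof.
by have := c_scalar i 1 0 0; rewrite scaler0 addr0 mul1r => E; lra.
Qed.

Lemma coordZ i k x : c i (k *: x) = k * c i x.
Proof. by have := c_scalar i k x 0; rewrite addr0 coord0 addr0. Qed.

(* Only the convergence of the difference quotient of [g] is used, so no
   differentiability in the sense of Frechet is involved. *)
Lemma is_derive_comp_partials (U : normedModType R) (f : V -> R) (g : U -> V)
    (p v : U) :
  partials f (g p) -> derivable g p v ->
  is_derive p v (f \o g) (\sum_i c i ('D_v g p) * 'D_(b i) f (g p)).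
Proof.
move=> pf dg.
have df i y : derivable f y (b i) by exact: (pf i).1.
pose w (h : R) := g (h *: v + p) - g p.
have [xi xiP] := choice (fun w => increment_partials (g p) w df).
have cw i : (fun h : R => c i (h^-1 *: w h)) @ 0^' --> c i ('D_v g p).
  apply: (@cvg_comp _ _ _ (fun h : R => h^-1 *: w h) (c i) _ _ _ dg).
  exact: c_cont.
have w0 : w h @[h --> (0:R)^'] --> (0 : V).
  have : {for 0, continuous (fun h : R => g (h *: v + p))}.
    exact/differentiable_continuous/derivable1_diffP/(derivable1P _ _ _).1.
  move=> /continuous_withinNx; rewrite scale0r add0r => gc.
  by rewrite -(subrr (g p)); apply: cvgB => //; exact: cvg_cst.
have xi0 i : xi (w h) i @[h --> (0:R)^'] --> g p.
  apply/subr_cvg0/norm_cvg0P.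
  have b0 : \sum_i `|c i (w h)| * `|b i| @[h --> (0:R)^'] --> (0 : R).
    rewrite [X in _ --> X](_ : _ = \sum_(i : I) (0 : R)); last by rewrite big1.
    apply: cvg_sum => j.
    rewrite [X in _ --> X](_ : _ = `|c j 0| * `|b j|); last by rewrite coord0 normr0 mul0r.
    apply: cvgMr_tmp; apply: cvg_norm.
    by apply: (@cvg_comp _ _ _ w (c j) _ _ _ w0); exact: c_cont.
  apply: (@squeeze_cvgr _ _ _ _ (fun=> 0) (fun h => \sum_i `|c i (w h)| * `|b i|)) => //.
    by apply: nearW => h; rewrite normr_ge0 (proj2 (xiP _)).
  exact: cvg_cst.
have E h : h^-1 *: ((f \o g \o shift p) (h *: v) - (f \o g) p)
    = \sum_i c i (h^-1 *: w h) * 'D_(b i) f (xi (w h) i).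
  rewrite /= -[g (h *: v + p)](subrK (g p)) (proj1 (xiP _)).
  rewrite -/(w h) scaler_sumr; apply: eq_bigr => i _.
  by rewrite coordZ -mulrA.
have L : h^-1 *: ((f \o g \o shift p) (h *: v) - (f \o g) p) @[h --> (0:R)^']
    --> \sum_i c i ('D_v g p) * 'D_(b i) f (g p).
  under eq_fun do rewrite E.
  apply: cvg_sum => i; apply: cvgM; first exact: cw.
  by apply: (@cvg_comp _ _ _ (fun h => xi (w h) i) (fun y => 'D_(b i) f y) _ _ _ (xi0 i)); exact: (pf i).2.
apply: DeriveDef; first by apply/cvg_ex; eexists; exact: L.
exact: cvg_lim L.
Qed.

Lemma derive_partials (f : V -> R) (x w : V) : partials f x ->
  'D_w f x = \sum_i c i w * 'D_(b i) f x.
Proof.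
move=> pf.
have dg : is_derive x w (id : V -> V) w by exact: is_derive_id.
have := @is_derive_comp_partials V f id x w pf (@ex_derive _ _ _ _ _ _ _ dg).
by move=> /@derive_val ->; rewrite derive_val.
Qed.

End Basis.

(* Continuity is required at every level, which makes the class closed under
   products level by level; on smooth functions nothing is lost. *)
Fixpoint Ck (R : realType) (V : normedModType R) (k : nat) (A : set V)
    (f : V -> R) : Prop :=
  (forall x, A x -> {for x, continuous f}) /\
  match k with
  | 0%N => True
  | k'.+1 => (forall x v, A x -> derivable f x v) /\
             (forall v, Ck k' A (fun x => 'D_v f x))
  end.

Definition sm (R : realType) (V : normedModType R) (A : set V) (f : V -> R) :=
  forall k, Ck k A f.

Section Smooth.
Context (R : realType) (V : normedModType R).
Implicit Types (A : set V) (f g : V -> R).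

Lemma CkS k A f : Ck k.+1 A f -> Ck k A f.
Proof.
elim: k f => [|k IH] f [cf]; first by [].
move=> [df Df]; split => //; split => // v; exact/IH/Df.
Qed.

Lemma sm_cont A f : sm A f -> forall x, A x -> {for x, continuous f}.
Proof. by move=> /(_ 0%N) []. Qed.

Lemma sm_derivable A f : sm A f -> forall x v, A x -> derivable f x v.
Proof. by move=> /(_ 1%N) [_ []]. Qed.

Lemma sm_derive A f : sm A f -> forall v, sm A (fun x => 'D_v f x).
Proof. by move=> sf v k; have [_ [_]] := sf k.+1; exact. Qed.

Lemma smooth_onP A f : smooth_on A f <-> sm A f.
Proof.
split => [|sf k].
  move=> sf k; elim: k f sf => [|k IH] f sf; first by split => //; exact: (sf 0%N).
  split; first exact: (sf 0%N).
  split; first by have [] := sf 1%N.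
  by move=> v; apply: IH => j; have [_] := sf j.+1; exact.
elim: k f {sf}(sf k) => [|k IH] f [cf] //= [df Df].
by split => // v; exact/IH/Df.
Qed.

Lemma derive_ext A f g x v : open A -> A x -> (forall y, A y -> f y = g y) ->
  'D_v f x = 'D_v g x.
Proof.
move=> oA Ax fg; apply: near_eq_derive.
by apply: (filterS _ (open_nbhs_nbhs (conj oA Ax))) => y Ay; rewrite fg.
Qed.

Lemma derivable_ext A f g x v : open A -> A x -> (forall y, A y -> f y = g y) ->
  derivable f x v -> derivable g x v.
Proof.
move=> oA Ax fg; apply: near_eq_derivable.
by apply: (filterS _ (open_nbhs_nbhs (conj oA Ax))) => y Ay; rewrite fg.
Qed.

Lemma continuous_ext A f g x : open A -> A x -> (forall y, A y -> f y = g y) ->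
  {for x, continuous f} -> {for x, continuous g}.
Proof.
move=> oA Ax fg cf; rewrite /prop_for /continuous_at -(fg x Ax).
apply: cvg_trans cf; apply: near_eq_cvg.
by apply: (filterS _ (open_nbhs_nbhs (conj oA Ax))) => y Ay; rewrite fg.
Qed.

Lemma Ck_ext k A f g : open A -> (forall x, A x -> f x = g x) ->
  Ck k A f -> Ck k A g.
Proof.
move=> oA; elim: k f g => [|k IH] f g fg [cf].
  by move=> _; split => // x Ax; apply: (continuous_ext oA Ax fg); exact: cf.
move=> [df Df]; split; first by move=> x Ax; apply: (continuous_ext oA Ax fg); exact: cf.
split => [x v Ax|v].
  by apply: (derivable_ext oA Ax fg); exact: df.
by apply: IH (Df v) => x Ax; apply: derive_ext fg.
Qed.

Lemma sm_ext A f g : open A -> (forall x, A x -> f x = g x) -> sm A f -> sm A g.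
Proof. by move=> oA fg sf k; apply: Ck_ext (sf k). Qed.

Lemma sm_sub A B f : A `<=` B -> sm B f -> sm A f.
Proof.
move=> AB sf k; elim: k f {sf}(sf k) => [|k IH] f [cf].
  by split => // x /AB /cf.
by move=> [df Df]; split => [x /AB /cf//|]; split => [x v /AB /df//|v]; exact/IH/Df.
Qed.

Lemma sm_cst A (a : R) : sm A (fun=> a).
Proof.
move=> k; elim: k a => [|k IH] a; first by split => // x _; exact: cvg_cst.
split; first by move=> x _; exact: cvg_cst.
split => [x v _|v]; first exact: derivable_cst.
have -> : (fun x => 'D_v (fun=> a) x) = fun _ : V => 0 :> R.
  by apply/funext => x; exact: derive_cst.
exact: IH.
Qed.

Lemma CkD k A f g : open A -> Ck k A f -> Ck k A g -> Ck k A (fun x => f x + g x).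
Proof.
move=> oA; elim: k f g => [|k IH] f g [cf +] [cg].
  by move=> _ _; split => // x Ax; apply: cvgD; [exact: cf|exact: cg].
move=> [df Df] [dg Dg]; split.
  by move=> x Ax; apply: cvgD; [exact: cf|exact: cg].
split => [x v Ax|v]; first by apply: derivableD; [exact: df|exact: dg].
apply: (Ck_ext oA _ (IH _ _ (Df v) (Dg v))) => x Ax.
by rewrite -deriveD //; [exact: df|exact: dg].
Qed.

Lemma smD A f g : open A -> sm A f -> sm A g -> sm A (fun x => f x + g x).
Proof. by move=> oA sf sg k; apply: CkD. Qed.

Lemma CkM k A f g : open A -> Ck k A f -> Ck k A g -> Ck k A (fun x => f x * g x).
Proof.
move=> oA; elim: k f g => [|k IH] f g Cf Cg.
  move: Cf Cg => [cf _] [cg _].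
  by split => // x Ax; apply: cvgM; [exact: cf|exact: cg].
have [cf [df Df]] := Cf; have [cg [dg Dg]] := Cg.
split; first by move=> x Ax; apply: cvgM; [exact: cf|exact: cg].
split => [x v Ax|v]; first by apply: derivableM; [exact: df|exact: dg].
have := CkD oA (IH _ _ (CkS Cf) (Dg v)) (IH _ _ (CkS Cg) (Df v)).
apply: Ck_ext => // x Ax.
by rewrite -[RHS]/('D_v (f * g) x) deriveM //; [exact: df|exact: dg].
Qed.

Lemma smM A f g : open A -> sm A f -> sm A g -> sm A (fun x => f x * g x).
Proof. by move=> oA sf sg k; apply: CkM. Qed.

Lemma smZ A (a : R) f : open A -> sm A f -> sm A (fun x => a * f x).
Proof. by move=> oA sf; apply: smM => //; exact: sm_cst. Qed.

Lemma smN A f : open A -> sm A f -> sm A (fun x => - f x).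
Proof.
move=> oA sf; apply: (sm_ext oA _ (smZ (-1) oA sf)) => x _; exact: mulN1r.
Qed.

Lemma smB A f g : open A -> sm A f -> sm A g -> sm A (fun x => f x - g x).
Proof. by move=> oA sf sg; apply: smD => //; exact: smN. Qed.

Lemma sm_sum A (J : Type) (r : seq J) (P : pred J) (f : J -> V -> R) : open A ->
  (forall j, sm A (f j)) -> sm A (fun x => \sum_(j <- r | P j) f j x).
Proof.
move=> oA sf; elim: r => [|j r IH].
  by under eq_fun do rewrite big_nil; exact: sm_cst.
under eq_fun do rewrite big_cons.
by case: (P j) => //; apply: smD.
Qed.

Lemma sm_prod A (J : Type) (r : seq J) (P : pred J) (f : J -> V -> R) : open A ->
  (forall j, sm A (f j)) -> sm A (fun x => \prod_(j <- r | P j) f j x).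
Proof.
move=> oA sf; elim: r => [|j r IH].
  by under eq_fun do rewrite big_nil; exact: sm_cst.
under eq_fun do rewrite big_cons.
by case: (P j) => //; apply: smM.
Qed.

(** The derivative [- f' / f^2] is a product of smooth functions and of the reciprocal itself, so
    the regularity of the reciprocal climbs one order at a time. *)
Lemma smV A f : open A -> (forall x, A x -> f x != 0) -> sm A f ->
  sm A (fun x => (f x)^-1).
Proof.
move=> oA f0 sf k; elim: k => [|k IH].
  by split => // x Ax; apply: cvgV; [exact: f0|exact: (sm_cont sf)].
split; first by move=> x Ax; apply: cvgV; [exact: f0|exact: (sm_cont sf)].
split => [x v Ax|v].
  by apply: derivableV; [exact: f0|exact: (sm_derivable sf)].
have := CkM oA (CkM oA IH IH) (smN oA (sm_derive sf v) k).
apply: Ck_ext => // x Ax.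
rewrite deriveV; [|exact: f0|exact: (sm_derivable sf)].
rewrite -[RHS]/(_ * _) mulrN mulNr; congr (- (_ * _)).
by rewrite expr2 invfM.
Qed.

End Smooth.

Section Composition.
Context (R : realType) (V : normedModType R) (I : finType).
Variables (b : I -> V) (c : I -> V -> R).
Hypothesis c_scalar : forall i, scalar (c i).
Hypothesis c_cont : forall i, continuous (c i).
Hypothesis bcE : forall x, x = \sum_i c i x *: b i.

Lemma sm_partials (f : V -> R) x : sm setT f -> partials b f x.
Proof.
move=> sf i; split => [y|]; first exact: (sm_derivable sf).
by apply: (sm_cont (sm_derive sf (b i))).
Qed.

Lemma sm_derive_partials (f : V -> R) x w : sm setT f ->
  'D_w f x = \sum_i c i w * 'D_(b i) f x.
Proof. by move=> sf; apply: derive_partials => //; exact: sm_partials. Qed.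

Lemma derive_coord (U : normedModType R) (g : U -> V) (p v : U) i :
  derivable g p v -> 'D_v (fun q => c i (g q)) p = c i ('D_v g p).
Proof.
move=> dg; apply: cvg_lim => //=.
have cw : c i (h^-1 *: (g (h *: v + p) - g p)) @[h --> (0 : R)^'] --> c i ('D_v g p).
  apply: (@cvg_comp _ _ _ (fun h : R => h^-1 *: (g (h *: v + p) - g p)) (c i) _ _ _ dg).
  exact: c_cont.
apply: cvg_trans cw; apply: near_eq_cvg; apply: nearW => h /=.
rewrite (coordZ c_scalar); congr (_ * _).
by have := c_scalar i (-1) (g p) (g (h *: v + p)); rewrite scaleN1r mulN1r (addrC (- g p)) => ->; exact: addrC.
Qed.

(** Induction on the order for all [f] at once: a derivative of the composite is a sum of products
    of a derivative of a coordinate of [g] with a partial derivative of [f] composed with [g], and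
    the induction hypothesis covers the latter. *)
Lemma sm_comp (U : normedModType R) (A : set U) (f : V -> R) (g : U -> V) :
  open A -> sm setT f ->
  (forall p, A p -> {for p, continuous g}) ->
  (forall p v, A p -> derivable g p v) ->
  (forall i, sm A (fun p => c i (g p))) ->
  sm A (fun p => f (g p)).
Proof.
move=> oA + cg dg sg k; elim: k f => [|k IH] f sf.
  split => // p Ap; apply: continuous_comp; first exact: cg.
  exact: (sm_cont sf).
split; first by move=> p Ap; apply: continuous_comp; [exact: cg|exact: (sm_cont sf)].
have D p v : A p -> is_derive p v (f \o g)
    (\sum_i c i ('D_v g p) * 'D_(b i) f (g p)).
  by move=> Ap; apply: is_derive_comp_partials => //; [exact: sm_partials|exact: dg].
split => [p v Ap|v].
  by have Dp := D p v Ap; apply: (@ex_derive _ _ _ _ _ (f \o g)).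
have : Ck k A (fun p => \sum_i 'D_v (fun q => c i (g q)) p * 'D_(b i) f (g p)).
  elim: (index_enum I) => [|i s IHs].
    by under eq_fun do rewrite big_nil; exact: sm_cst.
  under eq_fun do rewrite big_cons.
  apply: CkD => //; apply: CkM => //; first exact: (sm_derive (sg i)).
  exact: (IH _ (sm_derive sf (b i))).
apply: Ck_ext => // p Ap.
have Dp := D p v Ap.
rewrite (_ : 'D_v _ p = 'D_v (f \o g) p)// (@derive_val _ _ _ _ _ _ _ Dp).
by apply: eq_bigr => i _; rewrite derive_coord //; exact: dg.
Qed.

End Composition.

Lemma C_k_ext (R : realType) (V W : normedModType R) k (A : set V) (f g : V -> W) :
  open A -> (forall x, A x -> f x = g x) -> C_k k A f -> C_k k A g.
Proof.
move=> oA; elim: k f g => [|k IH] f g fg /= Cf.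
  move=> x Ax; rewrite /prop_for /continuous_at -(fg x Ax).
  apply: cvg_trans (Cf x Ax); apply: near_eq_cvg.
  by apply: (filterS _ (open_nbhs_nbhs (conj oA Ax))) => y Ay; rewrite fg.
have near_fg x : A x -> \forall y \near x, f y = g y.
  by move=> Ax; apply: (filterS _ (open_nbhs_nbhs (conj oA Ax))).
move: Cf => [df Df]; split => [x v Ax|v].
  by apply: (near_eq_derivable (near_fg x Ax)); exact: df.
by apply: IH (Df v) => x Ax; apply: near_eq_derive (near_fg x Ax).
Qed.

(** * Matrix-valued maps, entry by entry *)

Section MatrixValued.
Context (R : realType) (V : normedModType R) (m n : nat).

Lemma continuous_entriesP (T : topologicalType) (f : T -> 'M[R]_(m, n)) (x : T) :
  {for x, continuous f} <-> forall i j, {for x, continuous (fun y => f y i j)}.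
Proof.
split => [fc i j|fc].
  apply/cvgrPdist_le => /= e e0; move/cvgrPdist_le : fc => /(_ _ e0).
  apply: filterS => y; apply: le_trans.
  rewrite [leRHS]/Num.Def.normr/= mx_normrE.
  by apply: le_trans; last exact: (le_bigmax _ _ (i, j)); rewrite !mxE.
apply/cvgrPdist_le => /= e e0.
near=> y.
rewrite /Num.Def.normr/= mx_normrE (bigmax_le _ (ltW e0))//= => i _.
rewrite !mxE/=.
move: i; near: y; apply: filter_forall => /= i.
by have /cvgrPdist_le := fc i.1 i.2; apply.
Unshelve. all: by end_near. Qed.

(** Bridge between the vector-valued [smooth_on] of the statement and the scalar class [sm]: it is
    used to read the hypotheses entrywise and to return the constructed solution. *)
Lemma smooth_on_entriesP (A : set V) (f : V -> 'M[R]_(m, n)) : open A ->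
  smooth_on A f <-> forall i j, sm A (fun x => f x i j).
Proof.
move=> oA.
have Dentry (g : V -> 'M[R]_(m, n)) i j v x : derivable g x v ->
    'D_v (fun y => g y i j) x = ('D_v g x) i j.
  by move=> dg; rewrite derive_mx // mxE.
split => [sf i j|sf k].
  apply/smooth_onP => k; elim: k f {sf}(sf k) => [|k IH] f /=.
    by move=> cf x /cf/continuous_entriesP.
  move=> [df Df]; split => [x v /(df x v)/derivable_mxP//|v].
  by apply: (C_k_ext oA _ (IH _ (Df v))) => x Ax; rewrite Dentry //; exact: df.
elim: k f sf => [|k IH] f sf /=.
  by move=> x Ax; apply/continuous_entriesP => i j; exact: (sm_cont (sf i j)).
have df x v : A x -> derivable f x v.
  by move=> Ax; apply/derivable_mxP => i j; exact: (sm_derivable (sf i j)).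
split => [x v /df//|v]; apply: IH => i j.
by apply: (sm_ext oA _ (sm_derive (sf i j) v)) => x Ax; rewrite Dentry //; exact: df.
Qed.

End MatrixValued.

(** * Iterated directional derivatives and Taylor's estimate *)

Section Iterated.
Context (R : realType) (V : normedModType R).

Definition Dn (w : V) (k : nat) (f : V -> R) : V -> R :=
  iter k (fun g x => 'D_w g x) f.

Lemma DnSr w k f : Dn w k.+1 f = Dn w k (fun x => 'D_w f x).
Proof. by rewrite /Dn iterSr. Qed.

Lemma Dn_sum (J : Type) (r : seq J) (a : J -> R) (g : J -> V -> R) w k :
  (forall j, sm setT (g j)) ->
  Dn w k (fun x => \sum_(j <- r) a j * g j x)
    = fun x => \sum_(j <- r) a j * Dn w k (g j) x.
Proof.
elim: k g => [//|k IH] g sg.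
rewrite DnSr (_ : (fun x => 'D_w _ x) = fun x => \sum_(j <- r) a j * 'D_w (g j) x).
  by rewrite IH => [|j]; [under eq_fun do under eq_bigr do rewrite -DnSr|exact: sm_derive].
apply/funext => x.
suff H : is_derive x w (fun y => \sum_(j <- r) a j * g j y)
    (\sum_(j <- r) a j * 'D_w (g j) x) by rewrite derive_val.
elim: r {IH} => [|j r IHr].
  under eq_fun do rewrite big_nil; rewrite big_nil; exact: is_derive_cst.
under eq_fun do rewrite big_cons; rewrite big_cons.
apply: is_deriveD.
apply: is_deriveZ; apply: derivableP; exact: (sm_derivable (sg j)).
Qed.

Lemma sm_line_derive (A : set V) (f : V -> R) x w (t : R) :
  sm A f -> A (t *: w + x) ->
  is_derive t (1 : R) (fun s : R => f (s *: w + x)) ('D_w f (t *: w + x)).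
Proof. by move=> sf At; apply: is_derive_line; exact: (sm_derivable sf). Qed.

(** Induction on [n]: as a function of [t], the remainder vanishes at 0 and its derivative is the
    remainder, one order lower, of the directional derivative of [f]; the mean value theorem then
    contributes one factor [|e|]. The factorial in the error is given up, since only the power of
    [e] matters. *)
Lemma taylor_bound (A : set V) (f : V -> R) x w n (e M : R) : sm A f ->
  (forall t, `|t| <= `|e| -> A (t *: w + x)) ->
  (forall t, `|t| <= `|e| -> `|Dn w n f (t *: w + x)| <= M) ->
  `|f (e *: w + x) - \sum_(p < n) e ^+ p / p`!%:R * Dn w p f x| <= M * `|e| ^+ n.
Proof.
elim: n f e => [|n IH] f e sf Ae Me.
  by rewrite big_ord0 subr0 expr0 mulr1; exact: Me.
pose r (t : R) := f (t *: w + x) - \sum_(p < n.+1) t ^+ p / p`!%:R * Dn w p f x.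
pose r' (t : R) := 'D_w f (t *: w + x)
   - \sum_(p < n) t ^+ p / p`!%:R * Dn w p (fun y => 'D_w f y) x.
have dr t : `|t| <= `|e| -> is_derive t (1 : R) r (r' t).
  move=> te; apply: is_deriveB; first exact: sm_line_derive (Ae t te).
  under eq_fun do rewrite big_ord_recl expr0.
  rewrite -[X in is_derive _ _ _ X]add0r; apply: is_deriveD.
  have -> : (fun s : R => \sum_(i < n) s ^+ lift ord0 i / (lift ord0 i)`!%:R
       * Dn w (lift ord0 i) f x) = \sum_(i < n) (fun s : R => s ^+ i.+1 / i.+1`!%:R
       * Dn w i.+1 f x).
    by apply/funext => s; rewrite fct_sumE.
  apply: is_derive_sum => i.
  apply: (is_derive_eq (f' := (Dn w i.+1 f x / i.+1`!%:R) *: ((i.+1%:R * t ^+ i) *: (1 : R)))).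
    have -> : (fun s : R => s ^+ i.+1 / i.+1`!%:R * Dn w i.+1 f x)
      = (Dn w i.+1 f x / i.+1`!%:R) *: (id : R -> R) ^+ i.+1.
      apply/funext => s; rewrite -[RHS]/(_ * ((id : R -> R) ^+ i.+1) s) exprfctE /=. ring.
    by apply: is_deriveZ.
  rewrite DnSr factS natrM /GRing.scale /=; field.
  by rewrite addrC natr1 !pnatr_eq0 -lt0n fact_gt0.
have r0 : r 0 = 0.
  rewrite /r scale0r add0r big_ord_recl expr0 fact0 divr1 mul1r big1 ?addr0 ?subrr //.
  by move=> i _; rewrite lift0 expr0n mul0r mul0r.
have [t te] := MVT_abs dr; rewrite r0 subr0 -/(r e) => ->.
rewrite normrM mulrC exprSr mulrA ler_wpM2r //.
have M0 : 0 <= M by apply: le_trans (Me 0 _); rewrite ?normr0.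
have := IH (fun y => 'D_w f y) t (sm_derive sf w).
rewrite -/(r' t) => /(_ _ _)/le_trans; apply.
- by move=> s st; apply: Ae; exact: le_trans st te.
- by move=> s st; rewrite -DnSr; apply: Me; exact: le_trans st te.
by rewrite ler_wpM2l // lerXn2r // nnegrE.
Qed.

End Iterated.

Section IteratedBasis.
Context (R : realType) (V : normedModType R) (I : finType).
Variables (b : I -> V) (c : I -> V -> R).
Hypothesis c_scalar : forall i, scalar (c i).
Hypothesis c_cont : forall i, continuous (c i).
Hypothesis bcE : forall x, x = \sum_i c i x *: b i.

Lemma derive_dir_sum (f : V -> R) w : sm setT f ->
  (fun x => 'D_w f x) = fun x => \sum_i c i w * 'D_(b i) f x.
Proof. by move=> sf; apply/funext => x; exact: sm_derive_partials. Qed.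

(** Expanding one derivative in the basis makes the dependence on the direction explicit: iterated,
    [Dn w k f] is a form of degree [k] in the coordinates of [w]. Homogeneity and bounds uniform in
    [w] rest on this. *)
Lemma DnS_sum (f : V -> R) w k : sm setT f ->
  Dn w k.+1 f = fun x => \sum_i c i w * Dn w k (fun y => 'D_(b i) f y) x.
Proof.
move=> sf; rewrite DnSr derive_dir_sum // Dn_sum // => i; exact: sm_derive.
Qed.

Lemma Dn_homo (f : V -> R) (a : R) w k : sm setT f ->
  Dn (a *: w) k f = fun x => a ^+ k * Dn w k f x.
Proof.
elim: k f => [|k IH] f sf; apply/funext => x; first by rewrite mul1r.
rewrite !DnS_sum // mulr_sumr; apply: eq_bigr => i _.
by rewrite IH ?(coordZ c_scalar) ?exprS; [ring|exact: sm_derive].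
Qed.

Lemma continuous_bounded_on (K : set V) (f : V -> R) : compact K ->
  (forall x, K x -> {for x, continuous f}) ->
  exists2 M, 0 <= M & forall x, K x -> `|f x| <= M.
Proof.
move=> cK cf; have [->|/set0P K0] := eqVneq K set0; first by exists 0.
have [|x Kx xM] := @compact_EVT_max _ _ (fun x => `|f x|) K K0 cK.
  apply: continuous_in_subspaceT => x /set_mem Kx.
  by apply: cvg_norm; exact: cf.
by exists `|f x| => // y Ky; apply: xM; rewrite inE.
Qed.

Lemma Dn_bounded (K : set V) (f : V -> R) (B : R) k : compact K -> sm setT f ->
  exists2 M, 0 <= M & forall x w, K x -> (forall i, `|c i w| <= B) ->
    `|Dn w k f x| <= M.
Proof.
move=> cK; elim: k f => [|k IH] f sf.
  have [|M M0 fM] := continuous_bounded_on (f := f) cK.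
    by move=> x _; exact: (sm_cont sf).
  by exists M => // x w Kx _; exact: fM.
have /choice[M MP] : forall i, exists M, 0 <= M /\ forall x w, K x ->
    (forall i, `|c i w| <= B) -> `|Dn w k (fun y => 'D_(b i) f y) x| <= M.
  by move=> i; have [M M0 ?] := IH _ (sm_derive sf (b i)); exists M.
exists (\sum_i `|B| * M i).
  by apply: sumr_ge0 => i _; rewrite mulr_ge0 // (MP i).1.
move=> x w Kx wB; rewrite DnS_sum //.
apply: le_trans (ler_norm_sum _ _ _) _; apply: ler_sum => i _.
rewrite normrM ler_pM // ?((MP i).2 _ _ Kx wB) //.
exact: le_trans (wB i) (ler_norm B).
Qed.

End IteratedBasis.

(** * Periodic linear differential equations *)

Section RealLine.
Context (R : realType).
Implicit Types f g h : R -> R.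

Lemma is_derive_real_dir f (x v d : R) :
  is_derive x (1 : R) f d -> is_derive x v f (v * d).
Proof.
move=> df; have /derivable1_diffP dfx : derivable f x 1 by exact: ex_derive.
apply: DeriveDef; first exact: diff_derivable.
rewrite deriveE // -[v in LHS]mulr1 -[v * 1]/(v *: (1 : R)) linearZ /=.
by rewrite -deriveE // derive_val.
Qed.

Lemma CkS_is_derive1 f f' k :
  (forall t, is_derive t (1 : R) f (f' t)) -> Ck k setT f' -> Ck k.+1 setT f.
Proof.
move=> df Cf'; split.
  move=> x _; apply/differentiable_continuous/derivable1_diffP.
  by have dfx := df x; exact: ex_derive.
split => [x v _|v].
  by have dfx := is_derive_real_dir v (df x); exact: ex_derive.
apply: (@Ck_ext _ _ _ _ (fun x => v * f' x)) => [|x _|]; first exact: openT.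
  by have dfx := is_derive_real_dir v (df x); rewrite derive_val.
by apply: CkM; [exact: openT|exact: sm_cst|].
Qed.

Lemma sm_is_derive1 f f' :
  (forall t, is_derive t (1 : R) f (f' t)) -> sm setT f' -> sm setT f.
Proof. by move=> df sf' k; apply: CkS; apply: CkS_is_derive1 df (sf' k). Qed.

Lemma derive0_cst f : (forall t, is_derive t (1 : R) f 0) -> forall t, f t = f 0.
Proof.
move=> df t; have [s _] := @MVT_abs R f (fun=> 0) t (fun s _ => df s).
by rewrite mulr0 => /eqP; rewrite subr_eq0 => /eqP.
Qed.

Lemma is_derive_eq_sub f g f' : (forall t, is_derive t (1 : R) f (f' t)) ->
  (forall t, is_derive t (1 : R) g (f' t)) -> forall t, f t - f 0 = g t - g 0.
Proof.
move=> df dg t.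
have d0 s : is_derive s (1 : R) (f - g) 0 by rewrite -(subrr (f' s)); exact: is_deriveB.
have := derive0_cst d0 t; rewrite !fctE => E; lra.
Qed.

Let mu := @lebesgue_measure R.

Lemma continuous_integrable_segment f a b : continuous f ->
  mu.-integrable `[a, b] (EFin \o f).
Proof.
move=> cf; apply: continuous_compact_integrable; first exact: segment_compact.
exact: continuous_subspaceT.
Qed.

(** An integral with a fixed lower limit is a primitive only to the right of that limit. The
    integrals from [-n], normalized to vanish at 0, agree wherever two of them are primitives, and
    so glue to a primitive on the whole line. *)
Lemma antiderivative f : continuous f ->
  exists F : R -> R, forall t, is_derive t (1 : R) F (f t).
Proof.
move=> cf.
pose F (n : nat) (x : R) : R := \int[mu]_(t in `[- n%:R, x]) f t.
have dF n (x : R) : - n%:R < x -> is_derive x (1 : R) (F n) (f x).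
  move=> nx; have xx1 : x < x + 1 by rewrite ltrDl.
  have [dF Fx] := continuous_FTC1_closed xx1
    (continuous_integrable_segment (- n%:R) (x + 1) cf) nx (cf x).
  apply: DeriveDef; first exact: dF.
  by rewrite -derive1E; exact: Fx.
pose N (x : R) := (Num.truncn `|x|).+2.
have NP x : `|x| < (N x)%:R.
  by rewrite (lt_trans (truncnS_gt _))// ltr_nat.
pose G x := F (N x) x - F (N x) 0.
have GE n x : `|x| < n%:R -> G x = F n x - F n 0.
  move=> xn; pose g := F (N x) - F n.
  have [s _] : exists2 t : R, `|t| <= `|x| & g x - g 0 = x * 0.
    apply: (@MVT_abs R g (fun=> 0)) => s sx.
    rewrite -(subrr (f s)); apply: is_deriveB; apply: dF.
      have := NP x; have := ler_norm (- s); rewrite normrN; lra.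
    have := ler_norm (- s); rewrite normrN; lra.
  by rewrite mulr0 /g !fctE /G => E; lra.
exists G => t.
have dFt : is_derive t (1 : R) (F (N t) - cst (F (N t) 0)) (f t).
  rewrite -[f t]subr0; apply: is_deriveB; apply: dF.
  by have := NP t; have := ler_norm (- t); rewrite normrN; lra.
apply: near_eq_is_derive dFt.
have : \forall x \near t, `|x| < (N t)%:R.
  exact: (@cvgr_norm_lt _ _ _ _ _ id t cvg_id _ (NP t)).
by apply: filterS => x /GE ->; rewrite !fctE.
Qed.

Definition smper f := sm setT f /\ Defs.periodic f.

(* For a smooth periodic function, having a periodic primitive means having
   mean zero. *)
Definition smper0 f :=
  exists2 H, smper H & forall t, is_derive t (1 : R) H (f t).

Lemma smperD f g : smper f -> smper g -> smper (fun t => f t + g t).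
Proof.
move=> [sf pf] [sg pg]; split; first by apply: smD => //; exact: openT.
by move=> t; rewrite pf pg.
Qed.

Lemma smperM f g : smper f -> smper g -> smper (fun t => f t * g t).
Proof.
move=> [sf pf] [sg pg]; split; first by apply: smM => //; exact: openT.
by move=> t; rewrite pf pg.
Qed.

Lemma smper_cst (a : R) : smper (fun=> a).
Proof. by split => //; exact: sm_cst. Qed.

Lemma smperZ (a : R) f : smper f -> smper (fun t => a * f t).
Proof. by move=> sf; apply: smperM => //; exact: smper_cst. Qed.

Lemma smperN f : smper f -> smper (fun t => - f t).
Proof.
move=> [sf pf]; split; first by apply: smN => //; exact: openT.
by move=> t; rewrite pf.
Qed.

Lemma derive_periodic f f' : Defs.periodic f ->
  (forall t, is_derive t (1 : R) f (f' t)) -> Defs.periodic f'.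
Proof.
move=> pf df t.
have dt : is_derive t (1 : R) f (f' (t + 2 * pi)).
  have -> : f = f \o shift (2 * pi) by apply/funext => s; rewrite /= pf.
  rewrite -[f' _]mulr1.
  have dft : is_derive (shift (2 * pi) t) (1 : R) f (f' (t + 2 * pi)) by exact: df.
  by apply: is_derive1_comp; exact: is_derive_shift.
by rewrite -(@derive_val _ _ _ _ _ _ _ dt); have dft := df t; rewrite derive_val.
Qed.

Lemma smper_derive f f' : smper f -> (forall t, is_derive t (1 : R) f (f' t)) ->
  smper f'.
Proof.
move=> [sf pf] df; split; last exact: derive_periodic df.
suff -> : f' = (fun t => 'D_1 f t) by exact: sm_derive.
by apply/funext => t; have dft := df t; rewrite derive_val.
Qed.

Lemma smper0_smper f : smper0 f -> smper f.
Proof. by case=> H sH dH; exact: smper_derive dH. Qed.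

(** [c] is the mean of [f]. A primitive grows by [2 pi c] over each period, so removing the drift
    [c t] leaves a periodic primitive of [f - c]. *)
Lemma smper_split f : smper f -> exists (c : R) f0, smper0 f0 /\ forall t, f t = c + f0 t.
Proof.
move=> [sf pf].
have [F dF] : exists F, forall t, is_derive t (1 : R) F (f t).
  by apply: antiderivative => x; exact: (sm_cont sf).
have pi0 : 2 * pi != 0 :> R by rewrite mulf_neq0 // gt_eqF // pi_gt0.
pose c := (F (2 * pi) - F 0) / (2 * pi).
pose H := F - ( *%R c).
have dH t : is_derive t (1 : R) H (f t - c).
  apply: is_deriveB; rewrite -[X in is_derive _ _ _ X]mulr1.
  exact: is_deriveZ.
exists c, (fun t => f t - c); split; last by move=> t; rewrite addrC subrK.
exists H => //; split.
  apply: sm_is_derive1 dH _; apply: smD; [exact: openT|exact: sf|exact: sm_cst].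
move=> t.
have dHs s : is_derive s (1 : R) (H \o shift (2 * pi)) (f s - c).
  rewrite -[X in is_derive _ _ _ X]mulr1.
  have dHt : is_derive (shift (2 * pi) s) (1 : R) H (f s - c).
    by rewrite /= -(pf s); exact: dH.
  by apply: is_derive1_comp; exact: is_derive_shift.
have := is_derive_eq_sub dHs dH t.
have : H (2 * pi) = H 0 by rewrite /H !fctE /= mulr0 subr0 /c divfK // opprB addrC subrK.
by rewrite /= add0r => -> E; lra.
Qed.

End RealLine.

(** * Periodic solutions of the complex scalar equation, in real form *)

Section ScalarODE.
Context (R : realType).
Implicit Types f g h k u v : R -> R.

Definition der f f' := forall t : R, is_derive t (1 : R) f (f' t).

Lemma derE f f' g : der f f' -> (forall t, f' t = g t) -> der f g.
Proof. by move=> df fg t; rewrite -fg. Qed.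

Lemma der_cst (a : R) : der (fun=> a) (fun=> 0).
Proof. by move=> t; exact: is_derive_cst. Qed.

Lemma derM f g f' g' : der f f' -> der g g' ->
  der (fun t => f t * g t) (fun t => f' t * g t + f t * g' t).
Proof.
move=> df dg t; apply: is_derive_eq (is_deriveM (df t) (dg t)) _.
by rewrite /GRing.scale /= addrC; congr (_ + _); exact: mulrC.
Qed.

Lemma derD f g f' g' : der f f' -> der g g' ->
  der (fun t => f t + g t) (fun t => f' t + g' t).
Proof. by move=> df dg t; exact: (is_deriveD (df t) (dg t)). Qed.

Lemma derB f g f' g' : der f f' -> der g g' ->
  der (fun t => f t - g t) (fun t => f' t - g' t).
Proof. by move=> df dg t; exact: (is_deriveB (df t) (dg t)). Qed.

Lemma derZ (a : R) f f' : der f f' -> der (fun t => a * f t) (fun t => a * f' t).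
Proof. by move=> df t; exact: (is_deriveZ a (df t)). Qed.

Lemma der_sum (J : Type) (r : seq J) (f f' : J -> R -> R) :
  (forall j, der (f j) (f' j)) ->
  der (fun t => \sum_(j <- r) f j t) (fun t => \sum_(j <- r) f' j t).
Proof.
move=> df; elim: r => [|j r IH].
  under eq_fun do rewrite big_nil; apply: derE; first exact: der_cst.
  by move=> t; rewrite big_nil.
under eq_fun do rewrite big_cons; apply: derE; first exact: derD (df j) IH.
by move=> t; rewrite big_cons.
Qed.

Lemma der_lin f f' (a : R) : der f f' ->
  der (fun t => f (a * t)) (fun t => a * f' (a * t)).
Proof.
move=> df t; rewrite mulrC.
have da : is_derive t (1 : R) ( *%R a) a.
  by apply: is_derive_eq; exact: mulr1.
exact: (@is_derive1_comp R f ( *%R a) t _ a (df _) da).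
Qed.

Lemma der_shift f f' (a : R) : der f f' ->
  der (fun t => f (t + a)) (fun t => f' (t + a)).
Proof.
move=> df t; rewrite -[f' _]mulr1.
exact: (@is_derive1_comp R f (shift a) t _ 1 (df _) (is_derive_shift _ _ _)).
Qed.

Lemma periodic_nat (T : Type) (f : R -> T) (n : nat) t : Defs.periodic f ->
  f (t + 2 * pi * n%:R) = f t.
Proof.
move=> pf; elim: n => [|n IH]; first by rewrite mulr0 addr0.
by rewrite -(natr1 n) mulrDr mulr1 addrA pf.
Qed.

Lemma periodic_int (T : Type) (f : R -> T) (n : int) t : Defs.periodic f ->
  f (t + 2 * pi * n%:~R) = f t.
Proof.
move=> pf; case: n => n; first exact: periodic_nat.
rewrite NegzE mulrNz -(periodic_nat n.+1 (t + _) pf).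
by rewrite mulrN subrK.
Qed.

Lemma cos_periodic : Defs.periodic (@cos R).
Proof. by move=> t; rewrite mulr_natl; exact: cosD2pi. Qed.

Lemma sin_periodic : Defs.periodic (@sin R).
Proof. by move=> t; rewrite mulr_natl; exact: sinD2pi. Qed.

(** Injectivity of [cos] on [[0, pi]] is applied to the fractional part [r] of [b]: directly when
    [r <= 1/2], and after reflecting [2 pi r] to [2 pi - 2 pi r] otherwise, where it yields a
    contradiction. *)
Lemma cos_2pi_eq1 (b : R) : cos (2 * pi * b) = 1 -> exists n : int, b = n%:~R.
Proof.
move=> cb; exists (Num.floor b); pose r := b - (Num.floor b)%:~R.
have /andP[r0 r1] : 0 <= r < 1.
  by rewrite /r subr_ge0 floor_le_tmp ltrBlDl -intrD1 floorD1_gt.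
suff r00 : r = 0 by apply/eqP; rewrite -subr_eq0; apply/eqP.
have cr : cos (2 * pi * r) = 1.
  have := periodic_int (Num.floor b) (2 * pi * r) cos_periodic.
  by rewrite -mulrDr /r subrK cb.
have pi0 := pi_gt0 R.
have [r2|r2] := leP (2 * r) 1.
  have : 2 * pi * r = 0.
    by apply: cos_inj; rewrite ?cos0 // in_itv /=; apply/andP; split; nra.
  by move/eqP; rewrite mulf_eq0 (gt_eqF (_ : 0 < 2 * pi)) ?mulr_gt0 // => /eqP.
have : 2 * pi - 2 * pi * r = 0.
  apply: cos_inj; rewrite ?in_itv /=; [apply/andP; split; nra|apply/andP; split; nra|].
  by rewrite cos0 -cosN opprB -(cos_periodic (_ - _)) subrK.
nra.
Qed.

(** Bootstrap: the equations express the derivatives by [u], [v] and smooth data, so each order of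
    regularity of the solution yields the next. *)
Lemma ode_smooth (a b : R) h k u v : sm setT h -> sm setT k ->
  der u (fun t => a * u t - b * v t + h t) ->
  der v (fun t => b * u t + a * v t + k t) ->
  sm setT u /\ sm setT v.
Proof.
move=> sh sk du dv.
suff H n : Ck n setT u /\ Ck n setT v by split => n; have [] := H n.
have oT : open (setT : set R) by exact: openT.
elim: n => [|n [Cu Cv]].
  split; split => // x _; apply/differentiable_continuous/derivable1_diffP.
    by have dux := du x; exact: ex_derive.
  by have dvx := dv x; exact: ex_derive.
have CZ (c : R) (w : R -> R) : Ck n setT w -> Ck n setT (fun t => c * w t).
  by move=> Cw; apply: CkM => //; exact: sm_cst.
have CN (w : R -> R) : Ck n setT w -> Ck n setT (fun t => - w t).
  by move=> /(CZ (-1)); apply: Ck_ext => // x _; exact: mulN1r.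
split.
  apply: (CkS_is_derive1 du); do !apply: CkD => //; [exact: CZ|exact/CN/CZ].
by apply: (CkS_is_derive1 dv); do !apply: CkD => //; exact: CZ.
Qed.

Lemma der_expRM (a : R) : der (fun t => expR (a * t)) (fun t => a * expR (a * t)).
Proof. by apply: (@der_lin expR expR) => t; exact: is_derive_expR. Qed.

Lemma der_cosM (a : R) : der (fun t => cos (a * t)) (fun t => - (a * sin (a * t))).
Proof.
apply: derE (der_lin a (fun t => is_derive_cos t)) _ => t.
by rewrite mulrN.
Qed.

Lemma der_sinM (a : R) : der (fun t => sin (a * t)) (fun t => a * cos (a * t)).
Proof. exact: (der_lin a (fun t => is_derive_sin t)). Qed.

Lemma sm_cosM_sinM (a : R) :
  sm setT (fun t : R => cos (a * t)) /\ sm setT (fun t : R => sin (a * t)).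
Proof.
apply: (@ode_smooth 0 a (fun=> 0) (fun=> 0) (fun t => cos (a * t)) (fun t => sin (a * t)));
  [exact: sm_cst|exact: sm_cst| |].
  by apply: derE (der_cosM a) _ => t; ring.
by apply: derE (der_sinM a) _ => t; ring.
Qed.

Lemma sm_expRM (a : R) : sm setT (fun t : R => expR (a * t)).
Proof.
apply: (@ode_smooth a 0 (fun=> 0) (fun=> 0) (fun t : R => expR (a * t)) (fun=> 0) _ _ _ _).1;
  [exact: sm_cst|exact: sm_cst| |].
  by apply: derE (der_expRM a) _ => t; ring.
by apply: derE (der_cst 0) _ => t; ring.
Qed.

(** The weighted energy [exp(-2 a t) (u^2 + v^2)] is constant, since the rotation by [b] drops out
    of its derivative, and it vanishes at 0. *)
Lemma ode_unique (a b : R) u v :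
  der u (fun t => a * u t - b * v t) -> der v (fun t => b * u t + a * v t) ->
  u 0 = 0 -> v 0 = 0 -> forall t, u t = 0 /\ v t = 0.
Proof.
move=> du dv u0 v0 t.
pose w s := expR (- 2 * a * s) * (u s * u s + v s * v s).
have dw : der w (fun=> 0).
  apply: derE (derM (der_expRM _) (derD (derM du du) (derM dv dv))) _ => s.
  ring.
have /eqP := derive0_cst dw t.
rewrite /w u0 v0 !mul0r addr0 mulr0 mulf_eq0 gt_eqF ?expR_gt0 //=.
rewrite -!expr2 paddr_eq0 ?sqr_ge0 // !expf_eq0 /=.
by move=> /andP[/eqP -> /eqP ->].
Qed.

(* [exp (2 pi (a + i b)) <> 1], so the monodromy of the scalar equation has no
   eigenvalue 1. *)
Definition nonresonant (a b : R) := a = 0 -> forall n : int, b <> n%:~R.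

(** With [y = u + i v] this is [y' = (a + i b) y + (h + i k)]. Variation of constants solves it from
    any initial value [U0 + i V0], and the requirement [y(2 pi) = y(0)] determines that value
    because [1 - exp(2 pi (a + i b))] is nonzero. *)
Lemma ode_periodic (a b : R) h k : nonresonant a b -> smper h -> smper k ->
  exists u v, [/\ smper u, smper v,
    der u (fun t => a * u t - b * v t + h t) &
    der v (fun t => b * u t + a * v t + k t)].
Proof.
move=> nr [sh ph] [sk pk].
have oT : open (setT : set R) by exact: openT.
have [sC sS] := sm_cosM_sinM b.
have sE := sm_expRM (- a).
(* [I] and [J] are primitives of the real and imaginary parts of [exp(-(a + i b) t) (h + i k)]. *)
have [I dI] := antiderivative (f := fun t => expR (- a * t) * (cos (b * t) * h t + sin (b * t) * k t))
  (fun x => sm_cont (smM oT sE (smD oT (smM oT sC sh) (smM oT sS sk))) I).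
have [J dJ] := antiderivative (f := fun t => expR (- a * t) * (cos (b * t) * k t - sin (b * t) * h t))
  (fun x => sm_cont (smM oT sE (smB oT (smM oT sC sk) (smM oT sS sh))) Logic.I).
pose u (U0 V0 : R) t := expR (a * t) * (cos (b * t) * (U0 + (I t - I 0)) - sin (b * t) * (V0 + (J t - J 0))).
pose v (U0 V0 : R) t := expR (a * t) * (sin (b * t) * (U0 + (I t - I 0)) + cos (b * t) * (V0 + (J t - J 0))).
have EE t : expR (a * t) * expR (- a * t) = 1.
  by rewrite -expRD mulNr subrr expR0.
have dIc (c : R) : der (fun s => c + (I s - I 0))
   (fun t => expR (- a * t) * (cos (b * t) * h t + sin (b * t) * k t)).
  by apply: derE (derD (der_cst c) (derB dI (der_cst _))) _ => t; ring.
have dJc (c : R) : der (fun s => c + (J s - J 0))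
   (fun t => expR (- a * t) * (cos (b * t) * k t - sin (b * t) * h t)).
  by apply: derE (derD (der_cst c) (derB dJ (der_cst _))) _ => t; ring.
have du U0 V0 : der (u U0 V0) (fun t => a * u U0 V0 t - b * v U0 V0 t + h t).
  apply: derE (derM (der_expRM a) (derB (derM (der_cosM b) (dIc U0))
    (derM (der_sinM b) (dJc V0)))) _ => t.
  rewrite /u /v -[h t in RHS]mul1r -(EE t) -[X in _ = _ + X]mulr1 -(cos2Dsin2 (b * t)); ring.
have dv U0 V0 : der (v U0 V0) (fun t => b * u U0 V0 t + a * v U0 V0 t + k t).
  apply: derE (derM (der_expRM a) (derD (derM (der_sinM b) (dIc U0))
    (derM (der_cosM b) (dJc V0)))) _ => t.
  rewrite /u /v -[k t in RHS]mul1r -(EE t) -[X in _ = _ + X]mulr1 -(cos2Dsin2 (b * t)); ring.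
pose rho := expR (a * (2 * pi)); pose C := cos (b * (2 * pi)); pose S := sin (b * (2 * pi)).
(* [d] is the squared modulus of [1 - exp(2 pi (a + i b))]. *)
pose d := (1 - rho * C) ^+ 2 + (rho * S) ^+ 2.
have d0 : d != 0.
  apply/eqP => /eqP; rewrite paddr_eq0 ?sqr_ge0 // !expf_eq0 /= subr_eq0.
  have rho0 : 0 < rho by exact: expR_gt0.
  move=> /andP[/eqP rC]; rewrite mulf_eq0 gt_eqF //= => /eqP S0.
  have C2 : C ^+ 2 = 1 by rewrite -(cos2Dsin2 (b * (2 * pi))) -/S S0 expr0n addr0.
  have C1 : C = 1 by nra.
  have a0 : a = 0.
    have : expR (a * (2 * pi)) = expR 0 by rewrite expR0 [RHS]rC C1 mulr1.
    move=> /expR_inj/eqP; rewrite mulf_eq0 mulf_eq0.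
    by rewrite (gt_eqF (pi_gt0 R)) orbF pnatr_eq0 orbF => /eqP.
  have [n] := cos_2pi_eq1 (etrans (congr1 cos (mulrC _ _)) C1).
  exact: nr.
pose A1 := rho * (C * (I (2 * pi) - I 0) - S * (J (2 * pi) - J 0)).
pose B1 := rho * (S * (I (2 * pi) - I 0) + C * (J (2 * pi) - J 0)).
(* Solution of [(1 - rho (C + i S)) (U0 + i V0) = A1 + i B1] by means of the conjugate factor,
   whence the division by [d]. *)
pose U0 := ((1 - rho * C) * A1 - rho * S * B1) / d.
pose V0 := (rho * S * A1 + (1 - rho * C) * B1) / d.
have uper : u U0 V0 (2 * pi) = u U0 V0 0.
  rewrite /u !mulr0 expR0 cos0 sin0 -/rho -/C -/S /U0 /V0 /A1 /B1.
  by rewrite /d in d0 *; field.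
have vper : v U0 V0 (2 * pi) = v U0 V0 0.
  rewrite /v !mulr0 expR0 cos0 sin0 -/rho -/C -/S /U0 /V0 /A1 /B1.
  by rewrite /d in d0 *; field.
have [su sv] := ode_smooth sh sk (du U0 V0) (dv U0 V0).
(* The translate by [2 pi] minus the solution solves the homogeneous equation with initial value
   zero, so closing up at one point gives periodicity everywhere. *)
have P t : u U0 V0 (t + 2 * pi) - u U0 V0 t = 0 /\ v U0 V0 (t + 2 * pi) - v U0 V0 t = 0.
  apply: (@ode_unique a b (fun t => u U0 V0 (t + 2 * pi) - u U0 V0 t)
    (fun t => v U0 V0 (t + 2 * pi) - v U0 V0 t)).
  - apply: derE (derB (der_shift (2 * pi) (du U0 V0)) (du U0 V0)) _ => s.
    by rewrite ph; ring.
  - apply: derE (derB (der_shift (2 * pi) (dv U0 V0)) (dv U0 V0)) _ => s.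
    by rewrite pk; ring.
  - by rewrite add0r uper subrr.
  - by rewrite add0r vper subrr.
exists (u U0 V0), (v U0 V0); split => //; split => // t.
  by have [/eqP] := P t; rewrite subr_eq0 => /eqP.
by have [_ /eqP] := P t; rewrite subr_eq0 => /eqP.
Qed.

(* On derivatives of periodic functions (mean zero) the exponent 0 is harmless. *)
Lemma ode_periodic0 (a b : R) h k :
  (a = 0 -> forall n : int, n != 0 -> b <> n%:~R) -> smper0 h -> smper0 k ->
  exists u v, [/\ smper0 u, smper0 v,
    der u (fun t => a * u t - b * v t + h t) &
    der v (fun t => b * u t + a * v t + k t)].
Proof.
move=> nr [H sH dH] [K sK dK].
(* For exponent 0 the equation is a mere integration: [H] and [K] solve it, and subtracting their
   means restores mean zero. *)
have [/eqP/andP[/eqP a0 /eqP b0]|ab] := boolP ((a == 0) && (b == 0) == true).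
  have [c [u [u0 Hu]]] := smper_split sH.
  have [c' [v [v0 Kv]]] := smper_split sK.
  have duc (w W W' : R -> R) d : (forall t, W t = d + w t) -> der W W' -> der w W'.
    move=> Ww dW; have -> : w = (fun s => W s - d).
      by apply/funext => s; rewrite Ww addrAC subrr add0r.
    by apply: derE (derB dW (der_cst d)) _ => t; rewrite subr0.
  exists u, v; split => //.
    by apply: derE (duc _ _ _ _ Hu dH) _ => t; rewrite a0 b0; ring.
  by apply: derE (duc _ _ _ _ Kv dK) _ => t; rewrite a0 b0; ring.
have nrab : nonresonant a b.
  move=> a0 n bn; have [n0|n0] := eqVneq n 0; last exact: nr bn.
  by move: ab; rewrite a0 bn n0 !eqxx.
(* For a nonzero exponent the equation is solved with the primitives [H], [K] as forcing and the
   solution is differentiated: the derivative solves the original equation and has the periodic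
   primitives [U], [V]. *)
have [U [V [sU sV dU dV]]] := ode_periodic nrab sH sK.
exists (fun t => a * U t - b * V t + H t), (fun t => b * U t + a * V t + K t).
split; [by exists U|by exists V|exact: derD (derB (derZ a dU) (derZ b dV)) dH|].
exact: derD (derD (derZ b dU) (derZ a dV)) dK.
Qed.

End ScalarODE.

(** * Complex linear systems with constant coefficients *)

Section ComplexODE.
Context (R : realType).
Local Notation Re := (@complex.Re R).
Local Notation Im := (@complex.Im R).

Lemma ReM (x y : R[i]) : Re (x * y) = Re x * Re y - Im x * Im y.
Proof. by case: x => a b; case: y. Qed.

Lemma ImM (x y : R[i]) : Im (x * y) = Re x * Im y + Im x * Re y.
Proof. by case: x => a b; case: y. Qed.

Lemma ReD (x y : R[i]) : Re (x + y) = Re x + Re y.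
Proof. by case: x => a b; case: y. Qed.

Lemma ImD (x y : R[i]) : Im (x + y) = Im x + Im y.
Proof. by case: x => a b; case: y. Qed.

Definition smper0C (U : R -> R[i]) := smper0 (Re \o U) /\ smper0 (Im \o U).

Definition derC (U dU : R -> R[i]) :=
  der (Re \o U) (Re \o dU) /\ der (Im \o U) (Im \o dU).

Lemma smper0_cst0 : smper0 (fun _ : R => 0 : R).
Proof. by exists (fun=> 0); [exact: smper_cst|exact: der_cst]. Qed.

Lemma smper0D (f g : R -> R) : smper0 f -> smper0 g -> smper0 (fun t => f t + g t).
Proof.
move=> [F sF dF] [G sG dG].
by exists (fun t => F t + G t); [exact: smperD|exact: derD].
Qed.

Lemma smper0Z (a : R) (f : R -> R) : smper0 f -> smper0 (fun t => a * f t).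
Proof.
by move=> [F sF dF]; exists (fun t => a * F t); [exact: smperZ|exact: derZ].
Qed.

Lemma smper0_ext (f g : R -> R) : (forall t, f t = g t) -> smper0 f -> smper0 g.
Proof. by move=> /funext ->. Qed.

Lemma smper0CD U V : smper0C U -> smper0C V -> smper0C (fun t => U t + V t).
Proof.
move=> [Ur Ui] [Vr Vi]; split.
  by apply: smper0_ext (smper0D Ur Vr) => t /=; rewrite ReD.
by apply: smper0_ext (smper0D Ui Vi) => t /=; rewrite ImD.
Qed.

Lemma smper0CZ c U : smper0C U -> smper0C (fun t => c * U t).
Proof.
move=> [Ur Ui]; split.
  apply: smper0_ext (smper0D (smper0Z (Re c) Ur) (smper0Z (- Im c) Ui)) => t /=.
  by rewrite ReM mulNr.
by apply: smper0_ext (smper0D (smper0Z (Re c) Ui) (smper0Z (Im c) Ur)) => t /=; rewrite ImM.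
Qed.

Lemma smper0C_sum (J : Type) (r : seq J) (P : pred J) (c : J -> R[i]) (U : J -> R -> R[i]) :
  (forall j, smper0C (U j)) -> smper0C (fun t => \sum_(j <- r | P j) c j * U j t).
Proof.
move=> sU; elim: r => [|j r IH].
  by under eq_fun do rewrite big_nil; split; exact: smper0_cst0.
under eq_fun do rewrite big_cons.
by case: (P j) => //; apply: smper0CD => //; exact: smper0CZ.
Qed.

Lemma derC_ext U dU dU' : derC U dU -> (forall t, dU t = dU' t) -> derC U dU'.
Proof. by move=> + /funext <-. Qed.

Lemma derC_cst0 : derC (fun=> 0) (fun=> 0).
Proof. by split; exact: der_cst. Qed.

Lemma derCD U V dU dV : derC U dU -> derC V dV ->
  derC (fun t => U t + V t) (fun t => dU t + dV t).
Proof.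
move=> [Ur Ui] [Vr Vi]; split.
  have -> : Re \o (fun t => U t + V t) = fun t => Re (U t) + Re (V t).
    by apply/funext => t /=; rewrite ReD.
  by apply: derE (derD Ur Vr) _ => t /=; rewrite ReD.
have -> : Im \o (fun t => U t + V t) = fun t => Im (U t) + Im (V t).
  by apply/funext => t /=; rewrite ImD.
by apply: derE (derD Ui Vi) _ => t /=; rewrite ImD.
Qed.

Lemma derCZ c U dU : derC U dU -> derC (fun t => c * U t) (fun t => c * dU t).
Proof.
move=> [Ur Ui]; split.
  have -> : Re \o (fun t => c * U t) = fun t => Re c * Re (U t) - Im c * Im (U t).
    by apply/funext => t /=; rewrite ReM.
  by apply: derE (derB (derZ (Re c) Ur) (derZ (Im c) Ui)) _ => t /=; rewrite ReM.
have -> : Im \o (fun t => c * U t) = fun t => Re c * Im (U t) + Im c * Re (U t).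
  by apply/funext => t /=; rewrite ImM.
by apply: derE (derD (derZ (Re c) Ui) (derZ (Im c) Ur)) _ => t /=; rewrite ImM.
Qed.

Lemma derC_sum (J : Type) (r : seq J) (c : J -> R[i]) (U dU : J -> R -> R[i]) :
  (forall j, derC (U j) (dU j)) ->
  derC (fun t => \sum_(j <- r) c j * U j t) (fun t => \sum_(j <- r) c j * dU j t).
Proof.
move=> dUP; elim: r => [|j r IH].
  by under eq_fun do rewrite big_nil; apply: derC_ext derC_cst0 _ => t; rewrite big_nil.
under eq_fun do rewrite big_cons.
by apply: derC_ext (derCD (derCZ (c j) (dUP j)) IH) _ => t; rewrite big_cons.
Qed.

(* The exponent 0 is allowed: it is only obstructed by the mean value. *)
Definition harmless (s : R[i]) := Re s = 0 -> forall n : int, n != 0 -> Im s <> n%:~R.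

Lemma scalar_ode0 s H : harmless s -> smper0C H ->
  exists2 U, smper0C U & derC U (fun t => s * U t + H t).
Proof.
move=> hs [sr si].
have [u [v [su sv du dv]]] := ode_periodic0 hs sr si.
exists (fun t => Complex (u t) (v t)) => //.
split.
  by apply: derE du _ => t /=; rewrite ReD ReM.
by apply: derE dv _ => t /=; rewrite ImD ImM /= addrC; ring.
Qed.

(* Components are solved one after the other, starting from the first row of
   the lower triangular matrix. *)
Lemma triangular_ode0 r (T : 'M[R[i]]_r) (H : 'I_r -> R -> R[i]) :
  is_trig_mx T -> (forall i, harmless (T i i)) -> (forall i, smper0C (H i)) ->
  exists X : 'I_r -> R -> R[i], forall i, smper0C (X i) /\
    derC (X i) (fun t => \sum_j T i j * X j t + H i t).
Proof.
move=> /is_trig_mxP Ttrig hT sH.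
suff IH n : exists X : 'I_r -> R -> R[i], forall i, smper0C (X i) /\
    ((i < n)%N -> derC (X i) (fun t => \sum_j T i j * X j t + H i t)).
  by have [X XP] := IH r; exists X => i; have [sX] := XP i; split; auto.
elim: n => [|n [X XP]].
  by exists (fun _ _ => 0) => i; split => //; split; exact: smper0_cst0.
have [nr|nr] := ltnP n r; last first.
  by exists X => i; have [sX dX] := XP i; split => // _; apply: dX; exact: leq_trans nr.
pose i0 := Ordinal nr.
have sF : smper0C (fun t => \sum_(j | j != i0) T i0 j * X j t + H i0 t).
  apply: smper0CD => //; apply: smper0C_sum => j; exact: (XP j).1.
have [U sU dU] := scalar_ode0 (hT i0) sF.
exists (fun j => if j == i0 then U else X j) => i.
have [->|ii0] := eqVneq i i0; split => //.
- move=> _; apply: derC_ext dU _ => t.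
  rewrite [in RHS](bigD1 i0) //= eqxx addrA; congr (_ + _ + _).
  by apply: eq_bigr => j /negPf ->.
- exact: (XP i).1.
move=> iSn; have iN : (i < n)%N.
  by rewrite ltn_neqAle -ltnS iSn andbT; apply: contra ii0 => /eqP iN; apply/eqP/val_inj.
apply: derC_ext ((XP i).2 iN) _ => t; congr (_ + _); apply: eq_bigr => j _.
(* Redefining the component [i0] leaves the earlier rows intact, because their entry in column [i0]
   lies above the diagonal and vanishes. *)
have [->|//] := eqVneq j i0.
by rewrite Ttrig // !mul0r.
Qed.

(** A unitary Schur conjugation leads to a triangular matrix whose diagonal entries are eigenvalues
    of [A], hence harmless. The change of coordinates is constant in [theta], so it preserves mean
    zero and commutes with differentiation. *)
Lemma vector_ode0 r (A : 'M[R[i]]_r) (H : 'I_r -> R -> R[i]) :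
  (forall s, eigenvalue A s -> harmless s) -> (forall i, smper0C (H i)) ->
  exists X : 'I_r -> R -> R[i], forall i, smper0C (X i) /\
    derC (X i) (fun t => \sum_j A i j * X j t + H i t).
Proof.
move=> hA sH; have [r0|r0] := leqP r 0.
  by exists (fun _ _ => 0) => i; have := ltn_ord i; rewrite ltnNge (leq_trans r0).
have [P Pu trP] := spectral.Schur A r0.
have Punit := spectral.unitarymx_unit Pu.
pose T := P *m A *m invmx P.
have TE : conjmx P A = T by rewrite /conjmx pinvmxE.
have Ttrig : is_trig_mx T by move: trP; rewrite /similar_to TE.
have hT i : harmless (T i i).
  apply: hA; have : eigenvalue T (T i i).
    rewrite eigenvalue_root_char char_poly_trig // /root horner_prod.
    by rewrite (bigD1 i) //= hornerXsubC subrr mul0r.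
  move=> /eigenvalueP[v vT v0]; apply/eigenvalueP; exists (v *m P).
    by rewrite scalemxAl -vT /T !mulmxA mulmxKV.
  by apply: contra v0 => /eqP vP; rewrite -(mulmxK Punit v) vP mul0mx.
have sPH i : smper0C (fun t => \sum_j P i j * H j t) by exact: smper0C_sum.
have [X XP] := triangular_ode0 Ttrig hT sPH.
exists (fun i t => \sum_j invmx P i j * X j t) => i; split.
  by apply: smper0C_sum => j; exact: (XP j).1.
have := derC_sum (index_enum _) (invmx P i) (fun j => (XP j).2).
move=> dX; apply: derC_ext dX _ => t.
pose x := \col_j X j t; pose h := \col_j H j t.
have E : \sum_j invmx P i j * (\sum_k T j k * X k t + \sum_k P j k * H k t)
   = (invmx P *m (T *m x + P *m h)) i 0.
  rewrite mxE; apply: eq_bigr => j _; congr (_ * _); rewrite !mxE.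
  by congr (_ + _); apply: eq_bigr => k _; congr (_ * _); rewrite mxE.
rewrite E mulmxDr /T !mulmxA mulVmx // !mul1mx -!mulmxA !mxE; congr (_ + _).
apply: eq_bigr => j _; congr (_ * _); rewrite mxE.
by apply: eq_bigr => k _; congr (_ * _); rewrite mxE.
Qed.

End ComplexODE.

(** * The equation of a single Fourier mode in [phi] *)

Section ModeODE.
Context (R : realType) (r : nat) (B : 'M[R]_r) (kappa : R).
Local Notation Re := (@complex.Re R).
Local Notation Im := (@complex.Im R).
Local Notation BC := (map_mx (real_complex R) B).

Lemma Re_sum (J : Type) (s : seq J) (f : J -> R[i]) :
  Re (\sum_(j <- s) f j) = \sum_(j <- s) Re (f j).
Proof. by elim: s => [|j s IH]; rewrite ?big_nil // !big_cons ReD IH. Qed.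

Lemma Im_sum (J : Type) (s : seq J) (f : J -> R[i]) :
  Im (\sum_(j <- s) f j) = \sum_(j <- s) Im (f j).
Proof. by elim: s => [|j s IH]; rewrite ?big_nil // !big_cons ImD IH. Qed.

(** With [Y = yc - i ys], the function [yc cos(k phi) + ys sin(k phi)] is the real part of
    [Y exp(i k phi)], and for [kappa = k om] the mode equation becomes [Y' = A Y + (gc - i gs)]. *)
Let A : 'M[R[i]]_r := BC - (Complex 0 kappa)%:M.

Lemma eigenvalue_shift s : eigenvalue A s ->
  complex_eigenvalue B (s + Complex 0 kappa).
Proof.
move=> /eigenvalueP[v vA v0]; apply/eigenvalueP; exists v => //.
by rewrite scalerDl -vA mulmxBr mul_mx_scalar subrK.
Qed.

Lemma shifted_rowE (X : 'I_r -> R[i]) i : \sum_j A i j * X j =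
  Complex (\sum_j B i j * Re (X j) + kappa * Im (X i))
          (\sum_j B i j * Im (X j) - kappa * Re (X i)).
Proof.
have -> : \sum_j A i j * X j = \sum_j BC i j * X j - Complex 0 kappa * X i.
  under eq_bigr do rewrite /A !mxE mulrBl.
  rewrite big_split /= sumrN; congr (_ - _).
    by apply: eq_bigr => j _; rewrite mxE.
  rewrite (bigD1 i) //= eqxx mulr1n big1 ?addr0 // => j ji.
  by rewrite eq_sym (negPf ji) mulr0n mul0r.
apply/eqP; rewrite eq_complex /= ReD ImD Re_sum Im_sum; apply/andP; split; apply/eqP.
  have -> : Re (- (Complex 0 kappa * X i)) = kappa * Im (X i).
    by case: (X i) => a b /=; ring.
  by congr (_ + _); apply: eq_bigr => j _; rewrite ReM mxE /= mul0r subr0.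
have -> : Im (- (Complex 0 kappa * X i)) = - (kappa * Re (X i)).
  by case: (X i) => a b /=; ring.
by congr (_ + _); apply: eq_bigr => j _; rewrite ImM mxE /= mul0r addr0.
Qed.

(** These are the coefficients of [cos(k phi)] and [sin(k phi)] in
    [B z - dz/dtheta - om dz/dphi + g = 0], with [kappa = k om]; the opposite signs come from the
    [phi]-derivative. *)
Definition mode_solution (gc gs yc ys : 'I_r -> R -> R) :=
  forall i,
    der (yc i) (fun t => \sum_j B i j * yc j t - kappa * ys i t + gc i t) /\
    der (ys i) (fun t => \sum_j B i j * ys j t + kappa * yc i t + gs i t).

Lemma mode_ode0 (gc gs : 'I_r -> R -> R) :
  (forall s, complex_eigenvalue B s -> harmless (s - Complex 0 kappa)) ->
  (forall i, smper0 (gc i)) -> (forall i, smper0 (gs i)) ->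
  exists yc ys, [/\ forall i, smper0 (yc i), forall i, smper0 (ys i) &
    mode_solution gc gs yc ys].
Proof.
move=> hB sgc sgs.
have hA s : eigenvalue A s -> harmless s.
  by move=> /eigenvalue_shift/hB; rewrite addrK.
have sH i : smper0C (fun t => Complex (gc i t) (- gs i t)).
  split; first exact: sgc.
  by apply: smper0_ext (smper0Z (-1) (sgs i)) => t; rewrite mulN1r.
have [X XP] := vector_ode0 hA sH.
exists (fun i t => Re (X i t)), (fun i t => - Im (X i t)); split => i.
- exact: (XP i).1.1.
- by apply: smper0_ext (smper0Z (-1) (XP i).1.2) => t; rewrite mulN1r.
have [_ [dr di]] := XP i; split.
  apply: derE dr _ => t /=; rewrite shifted_rowE /=; ring.
have -> : (fun t => - Im (X i t)) = fun t => -1 * (Im \o X i) t.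
  by apply/funext => t; rewrite mulN1r.
apply: derE (derZ (-1) di) _ => t /=; rewrite shifted_rowE /=.
under [in RHS]eq_bigr do rewrite mulrN; rewrite sumrN; ring.
Qed.

(* The mean values [mc], [ms] of the right-hand sides are split off: the
   mean-zero part is always solvable, the rest is linear algebra. *)
Lemma mode_ode_split (gc gs : 'I_r -> R -> R) :
  (forall s, complex_eigenvalue B s -> harmless (s - Complex 0 kappa)) ->
  (forall i, smper (gc i)) -> (forall i, smper (gs i)) ->
  exists (mc ms : 'I_r -> R) (yc0 ys0 : 'I_r -> R -> R),
    [/\ forall i, smper0 (yc0 i), forall i, smper0 (ys0 i),
        mode_solution (fun i t => gc i t - mc i) (fun i t => gs i t - ms i) yc0 ys0 &
     forall (g : 'I_r -> R) (h : 'I_r -> R) (Yc Ys : 'I_r -> R),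
      (forall i, \sum_j B i j * Yc j - kappa * Ys i + (g i + mc i) = 0) ->
      (forall i, \sum_j B i j * Ys j + kappa * Yc i + (h i + ms i) = 0) ->
      mode_solution (fun i t => gc i t + g i) (fun i t => gs i t + h i)
        (fun i t => Yc i + yc0 i t) (fun i t => Ys i + ys0 i t)].
Proof.
move=> hB sgc sgs.
have /choice[c cP] : forall i, exists cg : R * (R -> R), smper0 cg.2 /\
    forall t, gc i t = cg.1 + cg.2 t.
  by move=> i; have [c [f0 ?]] := smper_split (sgc i); exists (c, f0).
have /choice[s sP] : forall i, exists cg : R * (R -> R), smper0 cg.2 /\
    forall t, gs i t = cg.1 + cg.2 t.
  by move=> i; have [c' [f0 ?]] := smper_split (sgs i); exists (c', f0).
have [yc [ys [syc sys ysol]]] := mode_ode0 hB (fun i => (cP i).1) (fun i => (sP i).1).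
exists (fun i => (c i).1), (fun i => (s i).1), yc, ys; split => //.
  move=> i; have [dc ds] := ysol i; split.
    by apply: derE dc _ => t; rewrite (cP i).2; ring.
  by apply: derE ds _ => t; rewrite (sP i).2; ring.
move=> g h Yc Ys Ec Es i; have [dc ds] := ysol i.
have sumE (Y : 'I_r -> R) (y : 'I_r -> R -> R) t :
    \sum_j B i j * (Y j + y j t) = \sum_j B i j * Y j + \sum_j B i j * y j t.
  by rewrite -big_split /=; apply: eq_bigr => j _; rewrite mulrDr.
split.
  apply: derE (derD (der_cst _) dc) _ => t.
  by rewrite sumE (cP i).2; have := Ec i; lra.
apply: derE (derD (der_cst _) ds) _ => t.
by rewrite sumE (sP i).2; have := Es i; lra.
Qed.

(** If [i kappa] is no eigenvalue of [B] then [A] is invertible, and a constant forcing is answered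
    by a constant solution. *)
Lemma mode_constants (g h : 'I_r -> R) :
  ~~ complex_eigenvalue B (Complex 0 kappa) ->
  exists Yc Ys : 'I_r -> R,
    (forall i, \sum_j B i j * Yc j - kappa * Ys i + g i = 0) /\
    (forall i, \sum_j B i j * Ys j + kappa * Yc i + h i = 0).
Proof.
move=> nB.
have uA : A \in unitmx.
  rewrite -row_free_unit -kermx_eq0; apply: contraNT nB => k0.
  have [v vk v0] : exists2 v : 'rV_r, (v <= kermx A)%MS & v != 0.
    by exists (nz_row (kermx A)); [exact: nz_row_sub|rewrite nz_row_eq0].
  rewrite -[Complex 0 kappa]add0r; apply: eigenvalue_shift.
  apply/eigenvalueP; exists v => //; rewrite scale0r; exact/sub_kermxP.
pose H := \col_i (Complex (g i) (- h i)).
pose Y := - (invmx A *m H).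
have AY : A *m Y = - H by rewrite /Y mulmxN mulKVmx.
exists (fun i => Re (Y i 0)), (fun i => - Im (Y i 0)).
have E i : \sum_j A i j * Y j 0 = - Complex (g i) (- h i).
  by have := congr1 (fun M : 'cV_r => M i 0) AY; rewrite !mxE.
split => i; have := E i; rewrite shifted_rowE => -[Er Ei].
  by have := Er; lra.
by under eq_bigr do rewrite mulrN; rewrite sumrN; lra.
Qed.

Lemma mode_ode (gc gs : 'I_r -> R -> R) :
  (forall s, complex_eigenvalue B s -> nonresonant (Re s) (Im s - kappa)) ->
  (forall i, smper (gc i)) -> (forall i, smper (gs i)) ->
  exists yc ys, [/\ forall i, smper (yc i), forall i, smper (ys i) &
    mode_solution gc gs yc ys].
Proof.
move=> nr sgc sgs.
have hB s : complex_eigenvalue B s -> harmless (s - Complex 0 kappa).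
  move=> /nr; case: s => a b /= nrs; rewrite /harmless /= oppr0 addr0.
  by move=> a0 n _; exact: nrs.
(* The integer 0 in the nonresonance condition excludes the eigenvalue [i kappa] and settles the
   mean values; the other integers settle the mean-zero part. *)
have nB : ~~ complex_eigenvalue B (Complex 0 kappa).
  by apply/negP => /nr /(_ erefl 0); rewrite subrr; exact.
have [mc [ms [yc [ys [syc sys _ H]]]]] := mode_ode_split hB sgc sgs.
have [Yc [Ys [Ec Es]]] := mode_constants mc ms nB.
exists (fun i t => Yc i + yc i t), (fun i t => Ys i + ys i t); split.
- by move=> i; apply: smperD; [exact: smper_cst|exact/smper0_smper].
- by move=> i; apply: smperD; [exact: smper_cst|exact/smper0_smper].
have := H (fun=> 0) (fun=> 0) Yc Ys.
rewrite (_ : (fun i t => gc i t + 0) = gc); last by do 2!apply/funext => ?; rewrite addr0.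
rewrite (_ : (fun i t => gs i t + 0) = gs); last by do 2!apply/funext => ?; rewrite addr0.
by apply=> i; rewrite add0r.
Qed.

End ModeODE.

(** * The Floquet blocks and their resonances *)

Section Blocks.
Context (R : realType) (m : nat).

(* Indices of the rotation block, of the hyperbolic block and of the last
   coordinate. *)
Definition ih (i : 'I_2) : 'I_(ns_dim m) := lshift (m + 1) i.
Definition it (i : 'I_m) : 'I_(ns_dim m) := rshift 2 (lshift 1 i).
Definition il : 'I_(ns_dim m) := rshift 2 (rshift m ord0).

Lemma block_ind (P : 'I_(ns_dim m) -> Prop) :
  (forall i, P (ih i)) -> (forall i, P (it i)) -> P il -> forall i, P i.
Proof.
move=> Ph Pt Pl i; case: (split_ordP i) => [a ->|b ->]; first exact: Ph.
by case: (split_ordP b) => [c ->|d ->]; [exact: Pt|rewrite (ord1 d); exact: Pl].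
Qed.

Lemma block_fun (X : Type) (xh : 'I_2 -> X) (xt : 'I_m -> X) (xl : X) :
  exists x : 'I_(ns_dim m) -> X,
    [/\ forall i, x (ih i) = xh i, forall i, x (it i) = xt i & x il = xl].
Proof.
exists (fun i => match fintype.split i with
  | inl a => xh a
  | inr b => match fintype.split b with inl c => xt c | inr _ => xl end end).
have spl p q (a : 'I_p) : fintype.split (lshift q a) = inl a.
  exact: (unsplitK (inl a : 'I_p + 'I_q)).
have spr p q (a : 'I_q) : fintype.split (rshift p a) = inr a.
  exact: (unsplitK (inr a : 'I_p + 'I_q)).
by split => [i|i|]; rewrite /ih /it /il ?spr ?spl.
Qed.

Variables (Ehat : 'M[R]_2) (Et : 'M[R]_m).
Let E := floquet_block Ehat Et.

Lemma floquet_hh i j : E (ih i) (ih j) = Ehat i j.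
Proof. by rewrite /E /floquet_block /ih block_mxEul. Qed.

Lemma floquet_h i (x : 'I_(ns_dim m) -> R) :
  \sum_j E (ih i) j * x j = \sum_j Ehat i j * x (ih j).
Proof.
rewrite big_split_ord /= [X in _ + X]big1 ?addr0 => [|j _].
  by apply: eq_bigr => j _; rewrite floquet_hh.
by rewrite /E /floquet_block /ih block_mxEur mxE mul0r.
Qed.

Lemma floquet_t i (x : 'I_(ns_dim m) -> R) :
  \sum_j E (it i) j * x j = \sum_j Et i j * x (it j).
Proof.
rewrite big_split_ord /= [X in X + _]big1 ?add0r => [|j _]; last first.
  by rewrite /E /floquet_block /it block_mxEdl mxE mul0r.
rewrite big_split_ord /= [X in _ + X]big1 ?addr0 => [|j _].
  by apply: eq_bigr => j _; rewrite /E /floquet_block /it block_mxEdr block_mxEul.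
by rewrite /E /floquet_block /it block_mxEdr block_mxEur mxE mul0r.
Qed.

Lemma floquet_l (x : 'I_(ns_dim m) -> R) : \sum_j E il j * x j = 0.
Proof.
apply: big1; apply: block_ind => [j|j|] _; rewrite /E /floquet_block /il.
- by rewrite block_mxEdl mxE mul0r.
- by rewrite block_mxEdr block_mxEdl mxE mul0r.
- by rewrite block_mxEdr block_mxEdr mxE mul0r.
Qed.

(** [E] is block diagonal and [kappa] couples each component only with itself, so a mode splits into
    independent problems on the three blocks. *)
Lemma mode_solution_blocks kappa (gc gs yc ys : 'I_(ns_dim m) -> R -> R) :
  mode_solution Ehat kappa (gc \o ih) (gs \o ih) (yc \o ih) (ys \o ih) ->
  mode_solution Et kappa (gc \o it) (gs \o it) (yc \o it) (ys \o it) ->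
  der (yc il) (fun t => - kappa * ys il t + gc il t) ->
  der (ys il) (fun t => kappa * yc il t + gs il t) ->
  mode_solution E kappa gc gs yc ys.
Proof.
move=> sh st slc sls; apply: block_ind => [i|i|].
- by have [dc ds] := sh i; split;
    [apply: derE dc _ => t|apply: derE ds _ => t]; rewrite floquet_h.
- by have [dc ds] := st i; split;
    [apply: derE dc _ => t|apply: derE ds _ => t]; rewrite floquet_t.
- by split; [apply: derE slc _ => t|apply: derE sls _ => t]; rewrite floquet_l ?sub0r ?add0r ?mulNr.
Qed.

End Blocks.
Arguments il {m}.

(** The only integer left in this range is 1, so each potential resonance is excluded by removing a
    single value of [omega]. *)
Lemma scaled_range (R : realType) (k w : R) : 0 < k <= 4 -> 0 < w < 2^-1 ->
  0 < k * w < 2.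
Proof.
move=> /andP[k0 k4] /andP[w0 w2]; apply/andP; split; first exact: mulr_gt0.
have : 4 * w < 2 by lra.
by apply: le_lt_trans; rewrite ler_pM2r.
Qed.

Section Resonances.
Context (R : realType) (m : nat) (omega : R) (Et : 'M[R]_m).
Hypothesis omega0 : 0 < omega.
Hypothesis omega2 : omega < 2^-1.
Hypothesis omega3 : omega != 3^-1.
Hypothesis omega4 : omega != 4^-1.
Hypothesis Et_hyp : forall a : R[i],
  complex.Re a = 0 -> ~~ complex_eigenvalue Et a.
Local Notation Re := (@complex.Re R).
Local Notation Im := (@complex.Im R).

Let Ehat : 'M[R]_2 := rot_block 0 omega.
Let E := floquet_block Ehat Et.

(** Since the eigenvector is nonzero, its two relations force [s^2 + omega^2 = 0]; real and
    imaginary parts are then separated. *)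
Lemma rot_block_eigenvalue s : complex_eigenvalue Ehat s ->
  Re s = 0 /\ (Im s = omega \/ Im s = - omega).
Proof.
move=> /eigenvalueP[v vE v0].
pose x := v 0 0; pose y := v 0 1; pose w : R[i] := (omega%:C)%C.
have l1 : lift ord0 ord0 = 1 :> 'I_2 by exact/val_inj.
have E0 : w * y = s * x.
  have := congr1 (fun M : 'rV_2 => M 0 0) vE.
  rewrite !mxE 2!big_ord_recl big_ord0 !mxE /= l1 => <-.
  by rewrite -[(0%:C)%C]/(0 : R[i]) mulr0 add0r addr0 mulrC.
have E1 : - w * x = s * y.
  have := congr1 (fun M : 'rV_2 => M 0 1) vE.
  rewrite !mxE 2!big_ord_recl big_ord0 !mxE /= l1 => <-.
  by rewrite -[(0%:C)%C]/(0 : R[i]) mulr0 !addr0 rmorphN /= mulrC.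
have sw : s * s + w * w = 0.
  have Ex : (s * s + w * w) * x = 0.
    by rewrite mulrDl -mulrA -E0 mulrCA -E1; ring.
  have Ey : (s * s + w * w) * y = 0.
    by rewrite mulrDl -mulrA -E1 -[w * w * y]mulrA E0; ring.
  apply/eqP; apply: contraNT v0 => sw0; apply/eqP/rowP => j; rewrite mxE.
  have [->|->] : j = 0 \/ j = 1.
    by case: j => [[|[|//]] jlt]; [left|right]; exact/val_inj.
    by move/eqP: Ex; rewrite mulf_eq0 (negPf sw0) => /eqP.
  by move/eqP: Ey; rewrite mulf_eq0 (negPf sw0) => /eqP.
move: sw; rewrite /w; case: (s) => a b /eqP; rewrite eq_complex /=.
move=> /andP[/eqP er /eqP ei].
have a0 : a = 0.
  have [//|a0] := eqVneq a 0; have : a * b = 0 by lra.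
  move/eqP; rewrite mulf_eq0 (negPf a0) /= => /eqP b0; rewrite b0 in er.
  by have := mulr_gt0 omega0 omega0; have := sqr_ge0 a; rewrite expr2; lra.
split=> //; have : (b - omega) * (b + omega) = 0 by rewrite a0 in er; nra.
by move/eqP; rewrite mulf_eq0 subr_eq0 addr_eq0 => /orP[/eqP|/eqP]; auto.
Qed.

Lemma multiple_not_int (x : R) : 0 < x < 2 -> x != 1 -> forall n : int, x <> n%:~R.
Proof.
move=> /andP[x0 x2] x1 n xn; move: x0 x2; rewrite xn ltr0z.
rewrite (_ : 2 = (2 : int)%:~R) // ltr_int => n0 n2.
by case/eqP: x1; rewrite xn; case: n n0 n2 {xn} => [[|[|n]]|n].
Qed.

Lemma opp_multiple_not_int (x : R) : 0 < x < 2 -> x != 1 ->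
  forall n : int, - x <> n%:~R.
Proof.
move=> x02 x1 n xn; apply: (multiple_not_int x02 x1 (n := - n)).
by rewrite mulrNz -xn opprK.
Qed.

Let range (k : R) : 0 < k <= 4 -> 0 < k * omega < 2.
Proof. by move=> k4; apply: scaled_range; rewrite // omega0. Qed.

Let omega1' : 1 * omega != 1.
Proof. by rewrite mul1r lt_eqF // (lt_trans omega2) // invf_lt1 // ltr1n. Qed.

Let omega2' : 2 * omega != 1.
Proof. by apply/eqP => o2; move: omega2; rewrite ltNge (_ : omega = 2^-1) ?lexx //; lra. Qed.

Let omega3' : 3 * omega != 1.
Proof. by apply: contra omega3 => /eqP o3; apply/eqP; lra. Qed.

Let omega4' : 4 * omega != 1.
Proof. by apply: contra omega4 => /eqP o4; apply/eqP; lra. Qed.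

Lemma zero_eigenvalue (s : R[i]) : complex_eigenvalue (0 : 'M[R]_1) s -> s = 0.
Proof.
move=> /eigenvalueP[v vE v0]; move: vE; rewrite map_mx0 mulmx0 => /esym/eqP.
by rewrite scaler_eq0 (negPf v0) orbF => /eqP.
Qed.

Lemma Et_nonresonant (kappa : R) s : complex_eigenvalue Et s ->
  nonresonant (Re s) (Im s - kappa).
Proof. by move=> sE s0; have := Et_hyp s0; rewrite sE. Qed.

(** The only eigenvalue of the last block is 0, so mode [k] meets the frequency [k omega]; at
    [k = 3] this is once more the exclusion of 1/3. *)
Lemma zero_nonresonant k (s : R[i]) : (1 <= k <= 3)%N ->
  complex_eigenvalue (0 : 'M[R]_1) s -> nonresonant (Re s) (Im s - k%:R * omega).
Proof.
move=> k13 /zero_eigenvalue -> _ n; rewrite sub0r.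
by case: k k13 => [|[|[|[|//]]]] // _; apply: opp_multiple_not_int;
  rewrite ?omega1' ?omega2' ?omega3' // range // ltr0n ler_nat.
Qed.

(** Mode 0 meets the frequency [omega], mode 2 the frequencies [omega] and [3 omega], mode 3 the
    frequencies [2 omega] and [4 omega], up to sign. The exclusion of 1/3 serves mode 2 and that of
    1/4 serves mode 3. *)
Lemma rot_nonresonant k s : k \in [:: 0; 2; 3]%N -> complex_eigenvalue Ehat s ->
  nonresonant (Re s) (Im s - k%:R * omega).
Proof.
move=> kin /rot_block_eigenvalue[_ sw] _ n.
have H (x y : R) : (x = y \/ x = - y) -> 0 < y < 2 -> y != 1 -> x <> n%:~R.
  by move=> [] -> y02 y1; [exact: multiple_not_int|exact: opp_multiple_not_int].
move: kin; rewrite !inE => /or3P[] /eqP ->.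
- apply: (H _ (1 * omega)); rewrite ?omega1' // ?range ?ltr01 ?ler1n //.
  by rewrite mul1r mul0r subr0.
- case: sw => ->.
    apply: (H _ (1 * omega)); rewrite ?omega1' // ?range ?ltr01 ?ler1n //.
    by right; ring.
  apply: (H _ (3 * omega)); rewrite ?omega3' // ?range ?ltr0n ?ler_nat //.
  by right; ring.
case: sw => ->.
  apply: (H _ (2 * omega)); rewrite ?omega2' // ?range ?ltr0n ?ler_nat //.
  by right; ring.
apply: (H _ (4 * omega)); rewrite ?omega4' // ?range ?ltr0n ?ler_nat //.
by right; ring.
Qed.

(** In mode 1 the frequencies are 0 and [2 omega]. The second lies strictly between 0 and 1; the
    first is a true resonance, but one that obstructs the mean value only. *)
Lemma rot_harmless s : complex_eigenvalue Ehat s -> harmless (s - Complex 0 omega).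
Proof.
move=> /rot_block_eigenvalue[sr sw] _ n n0; rewrite ImD /=.
case: sw => ->.
  by rewrite subrr => /esym/eqP; rewrite intr_eq0 (negPf n0).
rewrite -opprD -mulr2n -mulr_natl; apply: opp_multiple_not_int => //.
by rewrite range // ltr0n ler_nat.
Qed.

End Resonances.

Section SolveModes.
Context (R : realType) (m : nat) (omega : R) (Et : 'M[R]_m).
Hypothesis omega0 : 0 < omega.
Hypothesis omega2 : omega < 2^-1.
Hypothesis omega3 : omega != 3^-1.
Hypothesis omega4 : omega != 4^-1.
Hypothesis Et_hyp : forall a : R[i],
  complex.Re a = 0 -> ~~ complex_eigenvalue Et a.

Let Ehat : 'M[R]_2 := rot_block 0 omega.
Let E := floquet_block Ehat Et.
Let N := ns_dim m.

Lemma solve_mode23 k (gc gs : 'I_N -> R -> R) : k \in [:: 2; 3]%N ->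
  (forall i, smper (gc i)) -> (forall i, smper (gs i)) ->
  exists yc ys, [/\ forall i, smper (yc i), forall i, smper (ys i) &
    mode_solution E (k%:R * omega) gc gs yc ys].
Proof.
move=> k23 sgc sgs.
have k02 : k \in [:: 0; 2; 3]%N by rewrite inE k23 orbT.
have k13 : (1 <= k <= 3)%N by move: k23; rewrite !inE => /orP[] /eqP ->.
have [hc [hs [shc shs hsol]]] := mode_ode
  (fun s => rot_nonresonant omega0 omega2 omega3 omega4 k02 (s := s))
  (fun i => sgc (ih m i)) (fun i => sgs (ih m i)).
have [tc [ts [stc sts tsol]]] := mode_ode
  (fun s => Et_nonresonant Et_hyp (kappa := k%:R * omega) (s := s))
  (fun i => sgc (it i)) (fun i => sgs (it i)).
have [lc [ls [slc sls lsol]]] := mode_ode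
  (fun s => zero_nonresonant omega0 omega2 omega3 k13 (s := s))
  (fun i : 'I_1 => sgc il) (fun i : 'I_1 => sgs il).
have [yc [ych yct ycl]] := block_fun hc tc (lc ord0).
have [ys [ysh yst ysl]] := block_fun hs ts (ls ord0).
exists yc, ys; split.
- by apply: block_ind => [i|i|]; rewrite ?ych ?yct ?ycl.
- by apply: block_ind => [i|i|]; rewrite ?ysh ?yst ?ysl.
have [dlc dls] := lsol ord0.
apply: mode_solution_blocks.
- by rewrite (funext ych : yc \o _ = hc) (funext ysh : ys \o _ = hs).
- by rewrite (funext yct : yc \o _ = tc) (funext yst : ys \o _ = ts).
- rewrite ycl ysl; apply: derE dlc _ => t.
  by rewrite big_ord1 mxE mul0r sub0r mulNr.
- rewrite ycl ysl; apply: derE dls _ => t.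
  by rewrite big_ord1 mxE mul0r add0r.
Qed.

(* The constant [eta] absorbs the mean of the resonant last component. *)
Lemma solve_mode0 (g : 'I_N -> R -> R) : (forall i, smper (g i)) ->
  exists (eta : R) (y : 'I_N -> R -> R),
    [/\ forall i, smper (y i), smper0 (y il) &
    forall i, der (y i) (fun t => \sum_j E i j * y j t + (g i t - eta * (i == il)%:R))].
Proof.
move=> sg.
have [hc [hs [shc _ hsol]]] := mode_ode
  (fun s => rot_nonresonant omega0 omega2 omega3 omega4
     (isT : 0%N \in [:: 0; 2; 3]%N) (s := s))
  (fun i => sg (ih m i)) (fun i : 'I_2 => smper_cst 0).
have [tc [ts [stc _ tsol]]] := mode_ode
  (fun s => Et_nonresonant Et_hyp (kappa := 0%:R * omega) (s := s))
  (fun i => sg (it i)) (fun i : 'I_m => smper_cst 0).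
(* [eta] is the mean of the last component of the forcing. The rest is integrated, and the mean-zero
   primitive is the one that will meet the phase condition. *)
have [eta [g0 [sg0 gE]]] := smper_split (sg il).
have [|l [l' [sl _ dl _]]] := ode_periodic0 (a := 0) (b := 0) _ sg0 (smper0_cst0 R).
  by move=> _ n n0 /esym/eqP; rewrite intr_eq0 (negPf n0).
have [y [yh yt yl]] := block_fun hc tc l.
exists eta, y; split.
- by apply: block_ind => [i|i|]; rewrite ?yh ?yt ?yl //; exact: smper0_smper.
- by rewrite yl.
apply: block_ind => [i|i|].
- rewrite yh; apply: derE (hsol i).1 _ => t.
  have -> : (ih m i == il) = false by rewrite /ih /il eq_lrshift.
  rewrite floquet_h mul0r mul0r mulr0 !subr0; congr (_ + _).
  by apply: eq_bigr => j _; rewrite yh.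
- rewrite yt; apply: derE (tsol i).1 _ => t.
  have -> : (it i == il) = false.
    by rewrite /it /il (inj_eq (@rshift_inj _ _)) eq_lrshift.
  rewrite floquet_t mul0r mul0r mulr0 !subr0; congr (_ + _).
  by apply: eq_bigr => j _; rewrite yt.
rewrite yl; apply: derE dl _ => t.
by rewrite floquet_l eqxx mulr1 gE; ring.
Qed.

(* [p] and [q] are the multiples of [a_star] and [a_star_dot] that make the
   resonant first harmonic solvable. *)
Lemma solve_mode1 (gc gs : 'I_N -> R -> R) :
  (forall i, smper (gc i)) -> (forall i, smper (gs i)) ->
  exists (p q : R) (yc ys : 'I_N -> R -> R),
    [/\ forall i, smper (yc i), forall i, smper (ys i),
    smper0 (fun t => yc (ih m 0) t + ys (ih m 1) t),
    smper0 (fun t => yc (ih m 1) t - ys (ih m 0) t) &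
    mode_solution E omega
      (fun i t => gc i t + (p * (i == ih m 0)%:R + q * (i == ih m 1)%:R))
      (fun i t => gs i t + (p * (i == ih m 1)%:R - q * (i == ih m 0)%:R)) yc ys].
Proof.
move=> sgc sgs.
have [mc [ms [hc [hs [shc shs _ hsol]]]]] := mode_ode_split
  (fun s => rot_harmless omega0 omega2 (s := s))
  (fun i => sgc (ih m i)) (fun i => sgs (ih m i)).
have [tc [ts [stc sts tsol]]] := mode_ode
  (fun s => Et_nonresonant Et_hyp (kappa := omega) (s := s))
  (fun i => sgc (it i)) (fun i => sgs (it i)).
have lnr (s : R[i]) : complex_eigenvalue (0 : 'M[R]_1) s ->
    nonresonant (complex.Re s) (complex.Im s - omega).
  by move=> /(zero_nonresonant omega0 omega2 omega3 (isT : (1 <= 1 <= 3)%N)); rewrite mul1r.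
have [lc [ls [slc sls lsol]]] := mode_ode lnr
  (fun i : 'I_1 => sgc il) (fun i : 'I_1 => sgs il).
(* The equations for the constants have rank two. They are compatible when [p + mc 0 = - (p + ms 1)]
   and [q + mc 1 = ms 0 - q], which determines [p] and [q]. *)
pose p := - (mc 0 + ms 1) / 2; pose q := (ms 0 - mc 1) / 2.
(* Only [Yc 1 + Ys 0] and [Yc 0 - Ys 1] are then prescribed. Dividing each evenly makes
   [Yc 0 + Ys 1] and [Yc 1 - Ys 0] vanish, which is the normalization of the amplitude
   conditions. *)
pose Q := (p + mc 0) / (2 * omega); pose P := - (q + mc 1) / (2 * omega).
pose Yc (i : 'I_2) := if i == 0 then P else Q.
pose Ys (i : 'I_2) := if i == 0 then Q else - P.
pose g (i : 'I_2) := p * (i == 0)%:R + q * (i == 1)%:R.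
pose h (i : 'I_2) := p * (i == 1)%:R - q * (i == 0)%:R.
have o0 : omega != 0 by rewrite gt_eqF.
have sumE i (Y : 'I_2 -> R) : \sum_j Ehat i j * Y j =
    if i == 0 then - omega * Y 1 else omega * Y 0.
  have l1 : lift ord0 ord0 = 1 :> 'I_2 by exact/val_inj.
  rewrite 2!big_ord_recl big_ord0 !mxE l1.
  by case: i => [[|[|//]] ilt] /=; ring.
have ord2 (i : 'I_2) : i = 0 \/ i = 1.
  by case: i => [[|[|//]] ilt]; [left|right]; exact/val_inj.
have hsol' := hsol g h Yc Ys.
have {hsol'} hsol' : mode_solution Ehat omega (fun i t => gc (ih m i) t + g i)
    (fun i t => gs (ih m i) t + h i) (fun i t => Yc i + hc i t) (fun i t => Ys i + hs i t).
  apply: hsol' => i; rewrite sumE; case: (ord2 i) => ->;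
    by rewrite /Yc /Ys /g /h /= /P /Q /p /q; field.
have [yc [ych yct ycl]] := block_fun (fun i t => Yc i + hc i t) tc (lc ord0).
have [ys [ysh yst ysl]] := block_fun (fun i t => Ys i + hs i t) ts (ls ord0).
exists p, q, yc, ys; split.
- apply: block_ind => [i|i|]; rewrite ?ych ?yct ?ycl //.
  by apply: smperD; [exact: smper_cst|exact/smper0_smper].
- apply: block_ind => [i|i|]; rewrite ?ysh ?yst ?ysl //.
  by apply: smperD; [exact: smper_cst|exact/smper0_smper].
- rewrite ych ysh; apply: smper0_ext (smper0D (shc 0) (shs 1)) => t.
  by rewrite /Yc /Ys /=; ring.
- rewrite ych ysh; apply: smper0_ext (smper0D (shc 1) (smper0Z (-1) (shs 0))) => t.
  by rewrite /Yc /Ys /=; ring.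
have ihE i j : (ih m i == ih m j) = (i == j) by rewrite /ih (inj_eq (@lshift_inj _ _)).
have itE i j : (it i == ih m j) = false by rewrite /it /ih eq_rlshift.
have ilE j : (il == ih m j) = false by rewrite /il /ih eq_rlshift.
have [dlc dls] := lsol ord0.
apply: mode_solution_blocks.
- move=> i; have [dc ds] := hsol' i; rewrite /= ych ysh; split.
    apply: derE dc _ => t; rewrite !ihE; congr (_ - _ + _).
    by apply: eq_bigr => j _; rewrite /= ych.
  apply: derE ds _ => t; rewrite !ihE; congr (_ + _ + _).
  by apply: eq_bigr => j _; rewrite /= ysh.
- move=> i; have [dc ds] := tsol i; rewrite /= yct yst; split.
    apply: derE dc _ => t; rewrite ?itE !mulr0 !addr0; congr (_ - _ + _).
    by apply: eq_bigr => j _; rewrite /= yct.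
  apply: derE ds _ => t; rewrite ?itE !mulr0 subrr addr0; congr (_ + _ + _).
  by apply: eq_bigr => j _; rewrite /= yst.
- rewrite ycl ysl; apply: derE dlc _ => t.
  by rewrite big_ord1 mxE ?ilE !mulr0 !addr0 mul0r sub0r mulNr.
- rewrite ycl ysl; apply: derE dls _ => t.
  by rewrite big_ord1 mxE ?ilE !mulr0 subrr addr0 mul0r add0r.
Qed.

End SolveModes.

(** * Expansion of G *)

Section Strip.
Context (R : realType) (l r : R).
Hypothesis r0 : 0 < r.

Definition strip : set (R * R) := [set p : R * R | `|p.2 - l| < r].

Lemma open_preimage_snd (B : set R) : open B -> open [set p : R * R | B p.2].
Proof. by move=> oB; apply: open_comp oB => p _; exact: cvg_snd. Qed.

Lemma open_center : open [set x : R | `|x - l| < r].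
Proof.
rewrite (_ : mkset _ = ball l r); first exact: ball_open.
by rewrite -ball_normE; apply/seteqP; split => x /=; rewrite distrC.
Qed.

Lemma open_strip : open strip.
Proof. exact: open_preimage_snd open_center. Qed.

Lemma sm_snd (B : set R) (g : R -> R) : sm B g -> sm [set p : R * R | B p.2] (fun p => g p.2).
Proof.
move=> sg k; elim: k g {sg}(sg k) => [|k IH] g [cg].
  move=> _; split => // p Bp; apply: (@continuous_comp _ _ _ snd g); first exact: cvg_snd.
  exact: cg.
move=> [dg Dg]; split.
  move=> p Bp; apply: (@continuous_comp _ _ _ snd g); first exact: cvg_snd.
  exact: cg.
by split => [p v Bp|v]; [exact: (dg p.2 v.2)|exact: (IH _ (Dg v.2))].
Qed.

Lemma sm_fst (g : R -> R) : sm setT g -> sm setT (fun p : R * R => g p.1).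
Proof.
move=> sg k; elim: k g {sg}(sg k) => [|k IH] g [cg].
  move=> _; split => // p Bp; apply: (@continuous_comp _ _ _ fst g); first exact: cvg_fst.
  exact: cg.
move=> [dg Dg]; split.
  move=> p Bp; apply: (@continuous_comp _ _ _ fst g); first exact: cvg_fst.
  exact: cg.
by split => [p v Bp|v]; [exact: (dg p.1 v.1)|exact: (IH _ (Dg v.1))].
Qed.

(* Functions of [(theta, lam)], defined for [lam] within [r] of [l]. *)
Definition coef (h : R * R -> R) :=
  sm strip h /\ forall x, `|x - l| < r -> Defs.periodic (fun t => h (t, x)).

Lemma coefM f g : coef f -> coef g -> coef (fun p => f p * g p).
Proof.
move=> [sf pf] [sg pg]; split; first exact: smM open_strip sf sg.
by move=> x xl t; rewrite pf // pg.
Qed.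

Lemma coef_cst a : coef (fun=> a).
Proof. by split => //; exact: sm_cst. Qed.

Lemma coefN f : coef f -> coef (fun p => - f p).
Proof.
move=> [sf pf]; split; first exact: smN open_strip sf.
by move=> x xl t; rewrite pf.
Qed.

Lemma coef_sum (J : Type) (s : seq J) (P : pred J) (f : J -> R * R -> R) :
  (forall j, coef (f j)) -> coef (fun p => \sum_(j <- s | P j) f j p).
Proof.
move=> cf; split; first by apply: sm_sum => [|j]; [exact: open_strip|exact: (cf j).1].
by move=> x xl t; apply: eq_bigr => j _; rewrite (cf j).2.
Qed.

Lemma coef_prod (J : Type) (s : seq J) (P : pred J) (f : J -> R * R -> R) :
  (forall j, coef (f j)) -> coef (fun p => \prod_(j <- s | P j) f j p).
Proof.
move=> cf; split; first by apply: sm_prod => [|j]; [exact: open_strip|exact: (cf j).1].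
by move=> x xl t; apply: eq_bigr => j _; rewrite (cf j).2.
Qed.

Lemma coefV f : (forall p, strip p -> f p != 0) -> coef f -> coef (fun p => (f p)^-1).
Proof.
move=> f0 [sf pf]; split; first exact: smV open_strip f0 sf.
by move=> x xl t; rewrite pf.
Qed.

Lemma coef_ext f g : (forall p, strip p -> f p = g p) -> coef f -> coef g.
Proof.
move=> fg [sf pf]; split; first exact: sm_ext open_strip fg sf.
by move=> x xl t; rewrite -!fg ?pf.
Qed.

Lemma coef_derive f w : coef f -> coef (fun p => 'D_w f p).
Proof.
move=> [sf pf]; split; first exact: sm_derive.
move=> x xl t.
have -> : 'D_w f (t + 2 * pi, x) = 'D_w (fun p : R * R => f (p.1 + 2 * pi, p.2)) (t, x).
  suff E : (fun h => h^-1 *: ((f \o shift (t + 2 * pi, x)) (h *: w) - f (t + 2 * pi, x)))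
      = (fun h => h^-1 *: (((fun p : R * R => f (p.1 + 2 * pi, p.2)) \o shift (t, x)) (h *: w)
          - f (t + 2 * pi, x))) by rewrite /derive E.
  apply/funext => h /=; congr (_ *: (f _ - _)).
  by congr pair; rewrite /= addrA.
by apply: derive_ext open_strip _ _ => // -[s y] ys /=; exact: pf.
Qed.

Lemma coef_snd (g : R -> R) : sm [set x | `|x - l| < r] g -> coef (fun p => g p.2).
Proof. by move=> sg; split => //; exact: sm_snd sg. Qed.

Lemma coef_det n (M : R * R -> 'M[R]_n) : (forall i j, coef (fun p => M p i j)) ->
  coef (fun p => \det (M p)).
Proof.
move=> cM; apply: coef_sum => s; apply: coefM; first exact: coef_cst.
by apply: coef_prod => i; exact: cM.
Qed.

(** Cramer's rule: the entries of the inverse are cofactors over a determinant that does not vanish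
    on the strip. *)
Lemma coef_invmx n (M : R * R -> 'M[R]_n) i j : (forall i j, coef (fun p => M p i j)) ->
  (forall p, strip p -> M p \in unitmx) -> coef (fun p => invmx (M p) i j).
Proof.
move=> cM uM.
have c1 : coef (fun p => (\det (M p))^-1 * cofactor (M p) j i).
  apply: coefM.
    apply: coefV; last exact: coef_det.
    by move=> p /uM; rewrite unitmxE unitfE.
  apply: coefM; first exact: coef_cst.
  apply: coef_det => a b; apply: coef_ext (cM (lift j a) (lift i b)) => p _.
  by rewrite !mxE.
apply: coef_ext c1 => p Ap.
by rewrite /invmx uM // !mxE.
Qed.

Lemma continuous_pairl (x : R) : continuous (fun s : R => (s, x)).
Proof. by move=> t; exact: (@cvg_pair _ _ _ (nbhs t) (nbhs t) (nbhs x) _ _ _ id (fun=> x) cvg_id (cvg_cst _)). Qed.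

Lemma coef_smper f x : coef f -> `|x - l| < r -> smper (fun t => f (t, x)).
Proof.
move=> [sf pf] xl; split; last exact: pf.
move=> k; elim: k f {pf sf}(sf k) => [|k IH] f [cf].
  move=> _; split => // t _.
  apply: (@continuous_comp _ _ _ (fun s => (s, x)) f); last exact: cf.
  exact: continuous_pairl.
move=> [df Df]; have Ex (v t : R) : (fun h => h^-1 *: (((fun s => f (s, x)) \o shift t) (h *: v) - f (t, x)))
    = (fun h => h^-1 *: ((f \o shift (t, x)) (h *: (v, 0)) - f (t, x))).
  apply/funext => h /=; congr (_ *: (f _ - _)); congr pair.
  by rewrite -[RHS]/(h * 0 + x) mulr0 add0r.
split.
  move=> t _; apply: (@continuous_comp _ _ _ (fun s => (s, x)) f); last exact: cf.
  exact: continuous_pairl.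
split => [t v _|v].
  by rewrite /derivable Ex; exact: df.
have -> : (fun t => 'D_v (fun s => f (s, x)) t) = (fun t => 'D_(v, 0) f (t, x)).
  by apply/funext => t; rewrite /derive Ex.
exact: (IH _ (Df _)).
Qed.

Lemma derive_slice (f : R * R -> R) (x t : R) : 'D_1 (fun s => f (s, x)) t = 'D_(1, 0) f (t, x).
Proof.
suff E : (fun h => h^-1 *: (((fun s => f (s, x)) \o shift t) (h *: 1) - f (t, x)))
    = (fun h => h^-1 *: ((f \o shift (t, x)) (h *: (1, 0)) - f (t, x))) by rewrite /derive E.
apply/funext => h /=; congr (_ *: (f _ - _)); congr pair.
by rewrite -[RHS]/(h * 0 + x) mulr0 add0r.
Qed.

Lemma period_reduce (t : R) : exists (s : R) (n : int), 0 <= s <= 2 * pi /\ t = s + 2 * pi * n%:~R.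
Proof.
have pi0 : 0 < 2 * pi :> R by rewrite mulr_gt0 // pi_gt0.
pose n := Num.floor (t / (2 * pi)).
exists (t - 2 * pi * n%:~R), n; split; last by rewrite subrK.
have : n%:~R <= t / (2 * pi) by exact: floor_le_tmp.
have : t / (2 * pi) < n%:~R + 1 by rewrite -intrD1; exact: floorD1_gt.
rewrite ltr_pdivrMr // ler_pdivlMr // mulrDl mul1r (mulrC (n%:~R)) => t2 t1.
by apply/andP; split; [rewrite subr_ge0|rewrite lerBlDl ltW].
Qed.

(** Periodicity brings [theta] into [[0, 2 pi]], and the closed strip of half-width [r / 2] lies
    inside the open one; a compact rectangle therefore controls all values. *)
Lemma coef_bounded f : coef f -> exists2 C, 0 <= C &
  forall t x, `|x - l| <= r / 2 -> `|f (t, x)| <= C.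
Proof.
move=> [sf pf].
have r2 : r / 2 < r by rewrite ltr_pdivrMr // ltr_pMr // ltr1n.
pose K : set (R * R) := `[0, 2 * pi] `*` `[l - r / 2, l + r / 2].
have cK : compact K by apply: compact_setX; exact: segment_compact.
have KE x : (x \in `[l - r / 2, l + r / 2]) = (`|x - l| <= r / 2).
  by rewrite in_itv /= ler_distl.
have [|C C0 fC] := @continuous_bounded_on R _ K f cK.
  move=> [t x] [_ /=]; rewrite KE => xl; apply: (sm_cont sf).
  exact: le_lt_trans r2.
exists C => // t x xl; have [s [n [s2 ->]]] := period_reduce t.
rewrite (periodic_int n s (pf x _)); last exact: le_lt_trans r2.
by apply: fC; split; rewrite /= ?KE // in_itv.
Qed.

Lemma coef_taylor f : coef f -> exists2 C, 0 <= C &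
  forall t s, `|s| <= r / 2 ->
    `|f (t, l + s) - f (t, l) - s * 'D_(0, 1) f (t, l)| <= C * `|s| ^+ 2.
Proof.
move=> cf; have r2 : r / 2 < r by rewrite ltr_pdivrMr // ltr_pMr // ltr1n.
have [C C0 fC] := coef_bounded (coef_derive (0, 1) (coef_derive (0, 1) cf)).
exists C => // t s sr.
have lineE (h : R) : h *: ((0, 1) : R * R) + (t, l) = (t, l + h).
  by congr pair; rewrite /= ?scaler0 ?add0r // [h *: 1]mulr1 addrC.
have := @taylor_bound R (R * R)%type strip f (t, l) (0, 1) 2 s C cf.1.
rewrite !big_ord_recl big_ord0 /= lineE expr0 expr1 !divr1 mul1r addr0 opprD addrA.
apply=> h hs; rewrite lineE.
  by rewrite /strip /= addrC addKr (le_lt_trans hs) // (le_lt_trans sr).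
by apply: fC; rewrite addrC addKr (le_trans hs).
Qed.

End Strip.

Section ProductBasis.
Context (R : realType) (n : nat).
Local Notation V := ('cV[R]_n * R)%type.

Definition pb (o : option 'I_n) : V := if o is Some i then (delta_mx i 0, 0) else (0, 1).
Definition pc (o : option 'I_n) (x : V) : R := if o is Some i then x.1 i 0 else x.2.

Lemma pc_scalar o : scalar (pc o).
Proof. by case: o => [i|] a x y //=; rewrite !mxE. Qed.

Lemma pc_cont o : continuous (pc o).
Proof.
case: o => [i|] x /=; last exact: cvg_snd.
have := (continuous_entriesP (fun y : V => y.1) x).1; apply; exact: cvg_fst.
Qed.

Lemma pbcE x : x = \sum_o pc o x *: pb o.
Proof.
have sum1 (f : option 'I_n -> V) : (\sum_o f o) = (\sum_o (f o).1, \sum_o (f o).2).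
  by elim/big_rec3: _ => // o a b c _ ->; case: (f o) => [] ? ?.
have sumo (W : zmodType) (f : option 'I_n -> W) : \sum_o f o = f None + \sum_i f (Some i).
  rewrite (bigD1 None) //= (reindex_omap Some id) /=; last by case.
  by congr (_ + _); apply: eq_bigl => i; rewrite eqxx.
case: x => x s; rewrite sum1 !sumo /=; congr pair.
  rewrite scaler0 add0r; apply/matrixP => i j; rewrite (ord1 j) summxE (bigD1 i) //= big1.
    by rewrite !mxE !eqxx mulr1 addr0.
  by move=> k ki; rewrite !mxE eq_sym (negPf ki) mulr0.
rewrite [s *: 1]mulr1 big1 ?addr0 // => i _.
by rewrite scaler0.
Qed.

Lemma compact_box (a : R) (l d : R) :
  compact ([set x : 'cV[R]_n | forall i, `|x i 0| <= a] `*` `[l - d, l + d] : set V).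
Proof.
apply: compact_setX; last exact: segment_compact.
have -> : [set x : 'cV[R]_n | forall i, `|x i 0| <= a] =
    trmx @` [set x : 'rV[R]_n | forall i, `[- a, a]%classic (x ord0 i)].
  apply/seteqP; split => [x xa|_ [x xa <-] i].
    exists x^T; rewrite ?trmxK // => i; rewrite /= in_itv /= mxE -ler_norml.
    exact: xa.
  by have := xa i; rewrite /= in_itv /= mxE -ler_norml.
apply: continuous_compact; last first.
  apply: (@rV_compact _ _ (fun=> `[- a, a]%classic)) => i; exact: segment_compact.
apply: continuous_subspaceT => x; apply/continuous_entriesP => i j.
have idc : {for x, continuous (id : 'rV[R]_n -> 'rV[R]_n)} by exact: cvg_id.
have := (continuous_entriesP _ _).1 idc j i.
by under [X in _ -> continuous_at _ X] eq_fun do rewrite mxE.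
Qed.

End ProductBasis.

Lemma mx_norm_le (R : realType) (p q : nat) (A : 'M[R]_(p, q)) (c : R) : 0 <= c ->
  (forall i j, `|A i j| <= c) -> `|A| <= c.
Proof.
by move=> c0 Ac; rewrite /Num.Def.normr/= mx_normrE (bigmax_le _ c0) // => -[i j] _.
Qed.

Lemma mx_entry_le (R : realType) (p q : nat) (A : 'M[R]_(p, q)) i j : `|A i j| <= `|A|.
Proof.
rewrite [leRHS]/Num.Def.normr/= mx_normrE.
exact: (le_bigmax _ (fun k : 'I_p * 'I_q => `|A k.1 k.2|) (i, j)).
Qed.

(** * Taylor coefficients of [F] along the family of orbits *)

Section System.
Context (R : realType) (m : nat) (S : ns_data R m).
Hypothesis hS : neimark_sacker S.
Local Notation N := (ns_dim m).
Local Notation l := (lam_star S).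
Local Notation r := (Defs.rad S).
Local Notation coef := (coef l r).
Local Notation V := ('cV[R]_N * R)%type.

Let hO := NS_orbit hS.
Let hC := NS_continuation hS.

Lemma r_gt0 : 0 < r. Proof. exact: rad_gt0 hC. Qed.

Definition Fj (j : 'I_N) (p : V) : R := F S p.1 p.2 j 0.

Lemma sm_Fj j : sm setT (Fj j).
Proof.
by have /(smooth_on_entriesP _ openT) := F_smooth hO; apply.
Qed.

Lemma sm_id : sm setT (id : R -> R).
Proof.
by apply: (@sm_is_derive1 _ id (fun=> 1)); exact: sm_cst.
Qed.

Lemma coef_v i : coef (fun p => v S p.1 p.2 i 0).
Proof.
split; first by have /(smooth_on_entriesP _ (@open_strip R l r)) := v_smooth hC; apply.
by move=> x xl t; rewrite (v_periodic hC xl).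
Qed.

Lemma coef_P i j : coef (fun p => P S p.1 p.2 i j).
Proof.
split; first by have /(smooth_on_entriesP _ (@open_strip R l r)) := P_smooth hC; apply.
by move=> x xl t; rewrite (P_periodic hC xl).
Qed.

Lemma coef_T : coef (fun p => T S p.2).
Proof. by apply: coef_snd; apply/smooth_onP; exact: T_smooth hC. Qed.

Lemma coef_E i j : coef (fun p => E S p.2 i j).
Proof.
apply: (@coef_snd _ _ _ (fun x => E S x i j)).
by have /(smooth_on_entriesP _ (@open_center R l r)) := E_smooth hC; apply.
Qed.

Lemma coef_Pinv i j : coef (fun p => invmx (P S p.1 p.2) i j).
Proof.
apply: coef_invmx => [a b|p Ap]; first exact: coef_P.
by apply: (P_unit hC); exact: Ap.
Qed.

Lemma P_dotE t x i j : `|x - l| < r ->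
  P_dot S t x i j = 'D_(1, 0) (fun p : R * R => P S p.1 p.2 i j) (t, x).
Proof.
move=> xl; rewrite /P_dot derive1E derive_mx ?mxE.
  exact: (derive_slice (fun p : R * R => P S p.1 p.2 i j)).
apply/derivable_mxP => a b.
have [sPab _] := coef_smper (coef_P a b) xl.
exact: (sm_derivable sPab).
Qed.

Lemma coef_P_dot i j : coef (fun p => P_dot S p.1 p.2 i j).
Proof.
apply: coef_ext (coef_derive (1, 0) (coef_P i j)) => -[t x] Ap.
by rewrite P_dotE.
Qed.

(** The orbit lifted to [(x, lam)]-space, so that functions of both arguments of [F] can be composed
    with it and stay jointly smooth in [theta] and [lam]. *)
Definition gam (p : R * R) : V := (v S p.1 p.2, p.2).

Lemma coef_gam f : sm setT f -> coef (fun p => f (gam p)).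
Proof.
move=> sf; split.
  apply: (sm_comp (@pc_scalar R N) (@pc_cont R N) (@pbcE R N) (@open_strip R l r) sf).
  - move=> p Ap; apply: (@cvg_pair _ _ _ (nbhs p) (nbhs (v S p.1 p.2)) (nbhs p.2)).
      have := (continuous_entriesP (fun p : R * R => v S p.1 p.2) p).2; apply => i j.
      by rewrite (ord1 j); exact: (sm_cont (coef_v i).1).
    exact: cvg_snd.
  - move=> p w Ap.
    have dv : derivable (fun p : R * R => v S p.1 p.2) p w.
      apply/derivable_mxP => i j; rewrite (ord1 j).
      exact: (sm_derivable (coef_v i).1).
    have dsnd : derivable (snd : R * R -> R) p w by exact: (sm_derivable (sm_snd sm_id)).
    move: dv dsnd => /derivable1P/derivable1_diffP dv /derivable1P/derivable1_diffP dsnd.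
    apply/derivable1P/derivable1_diffP; exact: differentiable_pair dv dsnd.
  by move=> [i|]; [exact: (coef_v i).1|exact: (coef_snd (g := id) (sm_sub (@subsetT _ _) sm_id)).1].
by move=> x xl t; rewrite /gam /= (v_periodic hC xl).
Qed.

Definition dirP (z : 'cV[R]_N) (t x : R) : V := (P S t x *m z, 0).

(** The direction [P z] has no [lam]-component and is linear in [z], so each derivative peeled off
    yields one factor [z a]. The [k]-th derivative is thus a form of degree [k] in [z] whose
    coefficients depend on [theta] and [lam] alone. *)
Lemma Dn_dirP f z t x k y : sm setT f ->
  Dn (dirP z t x) k.+1 f y = \sum_a z a 0 *
    \sum_b P S t x b a * Dn (dirP z t x) k (fun y => 'D_(pb R (Some b)) f y) y.
Proof.
move=> sf; rewrite (DnS_sum (@pc_scalar R N) (@pc_cont R N) (@pbcE R N)) //.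
rewrite (bigD1 None) //= mul0r add0r (reindex_omap Some id) /=; last by case.
under eq_bigl do rewrite eqxx.
under eq_bigr do rewrite mxE mulr_suml.
rewrite exchange_big; apply: eq_bigr => a _; rewrite mulr_sumr.
by apply: eq_bigr => b _; ring.
Qed.

(* Iterated derivatives of [f] at the orbit along the columns of [P], i.e. the
   coefficients of its Taylor expansion in the Floquet coordinates [z]. *)
Fixpoint dd (s : seq 'I_N) (f : V -> R) (p : R * R) : R :=
  if s is a :: s' then \sum_b P S p.1 p.2 b a * dd s' (fun y => 'D_(pb R (Some b)) f y) p
  else f (gam p).

Lemma coef_dd s f : sm setT f -> coef (dd s f).
Proof.
elim: s f => [|a s IH] f sf /=; first exact: coef_gam.
apply: coef_sum => b; apply: coefM; first exact: coef_P.
exact/IH/sm_derive.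
Qed.

Lemma Dn_dd1 f z t x : sm setT f ->
  Dn (dirP z t x) 1 f (gam (t, x)) = \sum_a z a 0 * dd [:: a] f (t, x).
Proof. by move=> sf; rewrite Dn_dirP. Qed.

Lemma exchange_sum (J J' : finType) (z : J' -> R) (c : J -> R) (x : J -> J' -> R) :
  \sum_i c i * \sum_j z j * x i j = \sum_j z j * \sum_i c i * x i j.
Proof.
under eq_bigr do rewrite mulr_sumr; rewrite exchange_big.
by apply: eq_bigr => j _; rewrite mulr_sumr; apply: eq_bigr => i _; rewrite mulrCA.
Qed.

Lemma Dn_dd2 f z t x : sm setT f ->
  Dn (dirP z t x) 2 f (gam (t, x))
    = \sum_a z a 0 * \sum_b z b 0 * dd [:: a; b] f (t, x).
Proof.
move=> sf; rewrite Dn_dirP //; apply: eq_bigr => a _; congr (_ * _).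
under eq_bigr do rewrite (Dn_dd1 _ _ _ (sm_derive sf _)).
exact: (exchange_sum (fun b => z b 0) (fun i => P S t x i a)
  (fun i b => dd [:: b] (fun y => 'D_(pb R (Some i)) f y) (t, x))).
Qed.

Lemma Dn_dd3 f z t x : sm setT f ->
  Dn (dirP z t x) 3 f (gam (t, x))
    = \sum_a z a 0 * \sum_b z b 0 * \sum_c z c 0 * dd [:: a; b; c] f (t, x).
Proof.
move=> sf; rewrite Dn_dirP //; apply: eq_bigr => a _; congr (_ * _).
under eq_bigr do rewrite (Dn_dd2 _ _ _ (sm_derive sf _)).
apply: etrans (exchange_sum (fun b => z b 0) (fun i => P S t x i a)
  (fun i b => \sum_c z c 0 * dd [:: b; c] (fun y => 'D_(pb R (Some i)) f y) (t, x))) _.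
apply: eq_bigr => b _; apply: (congr1 ( *%R (z b 0))).
exact: (exchange_sum (fun c => z c 0) (fun i => P S t x i a)
  (fun i c => dd [:: b; c] (fun y => 'D_(pb R (Some i)) f y) (t, x))).
Qed.

Definition Dcol (p : nat) (z : 'cV[R]_N) (x t : R) : 'cV[R]_N :=
  \col_j Dn (dirP z t x) p (Fj j) (gam (t, x)).

(** [Gterm 1] is the coefficient of [eps * eta] and not the linear part of [G], which is [E z]. From
    [p = 2] on these are the Taylor terms of [T F], in Floquet coordinates. *)
Definition Gterm (p : nat) (z : 'cV[R]_N) (x t : R) : 'cV[R]_N :=
  match p with
  | 0%N => 0
  | 1%N => - (invmx (P S t x) *m (P_dot S t x *m z))
  | _ => (T S x / p`!%:R) *: (invmx (P S t x) *m Dcol p z x t)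
  end.

Lemma Gterm_homo p c z x t : Gterm p (c *: z) x t = c ^+ p *: Gterm p z x t.
Proof.
case: p => [|[|p]]; rewrite /Gterm ?scaler0 //.
  by rewrite -!scalemxAr expr1 scalerN.
have -> : Dcol p.+2 (c *: z) x t = c ^+ p.+2 *: Dcol p.+2 z x t.
  apply/matrixP => i j; rewrite !mxE.
  have -> : dirP (c *: z) t x = c *: dirP z t x.
    by congr pair; rewrite /= ?scaler0 // -scalemxAr.
  by rewrite (Dn_homo (@pc_scalar R N) (@pc_cont R N) (@pbcE R N)) //; exact: sm_Fj.
by rewrite -scalemxAr !scalerA mulrC.
Qed.

Lemma Dcol1 z x t : Dcol 1 z x t = Jac (F S) (v S t x) x *m (P S t x *m z).
Proof.
apply/matrixP => i j; rewrite (ord1 j) !mxE Dn_dd1; last exact: sm_Fj.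
under eq_bigr do rewrite /= mulr_sumr; rewrite exchange_big.
apply: eq_bigr => b _; rewrite !mxE mulr_sumr; apply: eq_bigr => a _.
rewrite mulrC mulrAC mulrC; congr (_ * _).
have dFb : derivable (F S ^~ x) (v S t x) (delta_mx b 0).
  apply/derivable_mxP => c d; rewrite (ord1 d).
  have := sm_derivable (sm_Fj c) (x := (v S t x, x)) (v := (delta_mx b 0, 0)) Logic.I.
  rewrite /derivable.
  suff -> : (fun h => h^-1 *: ((Fj c \o shift (v S t x, x)) (h *: (delta_mx b 0, 0)) - Fj c (v S t x, x)))
    = (fun h => h^-1 *: (((fun y => F S y x c 0) \o shift (v S t x)) (h *: delta_mx b 0) - F S (v S t x) x c 0)) by [].
  apply/funext => h; have -> : h *: ((delta_mx b 0, 0) : V) = (h *: delta_mx b 0, 0).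
    by congr pair; exact: mulr0.
  by rewrite /Fj /= add0r.
rewrite derive_mx // mxE /derive.
suff -> : (fun h => h^-1 *: ((Fj i \o shift (v S t x, x)) (h *: (delta_mx b 0, 0)) - Fj i (v S t x, x)))
    = (fun h => h^-1 *: (((fun y => F S y x i 0) \o shift (v S t x)) (h *: delta_mx b 0) - F S (v S t x) x i 0)) by [].
apply/funext => h; have -> : h *: ((delta_mx b 0, 0) : V) = (h *: delta_mx b 0, 0).
  by congr pair; exact: mulr0.
by rewrite /Fj /= add0r.
Qed.

Definition Rem n (z : 'cV[R]_N) (x t e : R) : 'cV[R]_N :=
  F S (v S t x + e *: (P S t x *m z)) x
   - \sum_(p < n) (e ^+ p / p`!%:R) *: Dcol p z x t.

(** The zeroth Taylor term cancels against [F] on the orbit, the first one combines with [P_dot z]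
    into [P E z] by the Floquet equation, and the extra [eps eta P_dot z] accounts for [Gterm 1].
    What is left is the Taylor remainder of [F], divided by [eps]. *)
Lemma G_rem n z x t e eta : `|x - l| < r -> e != 0 ->
  G S z x eta t e - (E S x *m z + (e * eta) *: Gterm 1 z x t
     + \sum_(2 <= p < n.+2) e ^+ p.-1 *: Gterm p z x t)
  = (e^-1 * T S x) *: (invmx (P S t x) *m Rem n.+2 z x t e).
Proof.
move=> xl e0; have Pu := P_unit hC t xl.
set Pi := invmx (P S t x).
have PE : E S x *m z = Pi *m (T S x *: Dcol 1 z x t - P_dot S t x *m z).
  apply: (canRL (mulKmx Pu)).
  have := congr1 (fun M => M *m z) (P_eq hC t xl).
  by rewrite mulmxBl -scalemxAl -!mulmxA Dcol1 => ->.
have RE : T S x *: F S (v S t x + e *: (P S t x *m z)) x - T S x *: F S (v S t x) x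
    = T S x *: Rem n.+2 z x t e + T S x *: (e *: Dcol 1 z x t)
      + \sum_(2 <= p < n.+2) (T S x * e ^+ p / p`!%:R) *: Dcol p z x t.
  have -> : F S (v S t x) x = (e ^+ 0 / 0`!%:R) *: Dcol 0 z x t.
    by rewrite fact0 expr0 divr1 scale1r; apply/matrixP => i j; rewrite !mxE (ord1 j).
  rewrite /Rem -(big_mkord xpredT (fun p => (e ^+ p / p`!%:R) *: Dcol p z x t)).
  rewrite big_ltn // big_ltn // (_ : 1`! = 1%N) // expr1 divr1.
  rewrite [X in _ = _ + X](eq_bigr (fun p => T S x *: ((e ^+ p / p`!%:R) *: Dcol p z x t))); last first.
    by move=> p _; rewrite scalerA mulrA.
  rewrite -scaler_sumr -!scalerBr -!scalerDr; congr (_ *: _).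
  by rewrite !divr1 -[RHS]addrA opprD (addrA (F S _ _)) subrK.
pose a := Pi *m Rem n.+2 z x t e; pose d := Pi *m Dcol 1 z x t.
pose q := Pi *m (P_dot S t x *m z).
pose s := \sum_(2 <= p < n.+2) e ^+ p.-1 *: Gterm p z x t.
have sE : Pi *m (\sum_(2 <= p < n.+2) (T S x * e ^+ p / p`!%:R) *: Dcol p z x t) = e *: s.
  rewrite /s mulmx_sumr scaler_sumr; apply: eq_big_nat => -[|[|p]] // _.
  rewrite -scalemxAr /Gterm -/Pi !scalerA; congr (_ *: _).
  by rewrite /= [in LHS]exprS; ring.
have -> : G S z x eta t e = e^-1 *: (T S x *: a + (T S x * e) *: d + e *: s - (e * (1 + e * eta)) *: q).
  rewrite /G RE -/Pi; congr (_ *: _).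
  by rewrite mulmxBr !mulmxDr sE -!scalemxAr scalerA.
rewrite PE mulmxBr -scalemxAr -/d -/q -/s -/a /Gterm -/Pi -/q.
by apply/matrixP => i j; rewrite !mxE; field.
Qed.

End System.

Lemma coef_bounded_family (R : realType) (l r : R) (J : finType) (f : J -> R * R -> R) :
  0 < r -> (forall j, coef l r (f j)) -> exists2 C, 0 <= C &
  forall j t x, `|x - l| <= r / 2 -> `|f j (t, x)| <= C.
Proof.
move=> r0 cf.
have /choice[C CP] : forall j, exists C, 0 <= C /\
    forall t x, `|x - l| <= r / 2 -> `|f j (t, x)| <= C.
  by move=> j; have [C C0 fC] := coef_bounded r0 (cf j); exists C.
exists (\sum_j C j); first by apply: sumr_ge0 => j _; exact: (CP j).1.
move=> j t x xl; apply: le_trans ((CP j).2 t x xl) _.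
rewrite (bigD1 j) //= lerDl; apply: sumr_ge0 => k _; exact: (CP k).1.
Qed.

Section Expansion.
Context (R : realType) (m : nat) (S : ns_data R m).
Hypothesis hS : neimark_sacker S.
Local Notation N := (ns_dim m).
Local Notation l := (lam_star S).
Local Notation r := (Defs.rad S).

(** For [|e| <= 1] the segment issuing from the orbit stays in a fixed compact box: [Cv] bounds the
    orbit and [B'] the displacement [P z]. The derivatives of order [n] are bounded there, which
    gives one constant for all [theta], [lam] and [z]. *)
Lemma Rem_bound n (B : R) : exists2 M, 0 <= M & forall z x t e j,
  `|z| <= B -> `|x - l| <= r / 2 -> `|e| <= 1 ->
  `|Rem S n z x t e j 0| <= M * `|e| ^+ n.
Proof.
have r0 := r_gt0 hS.
have [Cv Cv0 CvP] := coef_bounded_family r0 (coef_v hS).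
have [CP CP0 CPP] := coef_bounded_family (f := fun k : 'I_N * 'I_N => fun p => P S p.1 p.2 k.1 k.2) r0
  (fun k => coef_P hS k.1 k.2).
pose B' := \sum_(a < N) CP * `|B|.
have B'0 : 0 <= B' by apply: sumr_ge0 => a _; rewrite mulr_ge0.
have PzB (z : 'cV[R]_N) x t i : `|z| <= B -> `|x - l| <= r / 2 -> `|(P S t x *m z) i 0| <= B'.
  move=> zB xl; rewrite mxE; apply: le_trans (ler_norm_sum _ _ _) _.
  apply: ler_sum => a _; rewrite normrM ler_pM //.
    exact: (CPP (i, a) t x xl).
  by apply: le_trans (mx_entry_le z a 0) _; exact: le_trans zB (ler_norm B).
have cK := @compact_box R N (B' + Cv) l (r / 2).
have /choice[M MP] : forall j, exists M, 0 <= M /\ forall y w,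
    ([set x : 'cV[R]_N | forall i, `|x i 0| <= B' + Cv] `*` `[l - r / 2, l + r / 2]) y ->
    (forall o, `|pc o w| <= B') -> `|Dn w n (Fj S j) y| <= M.
  move=> j; have [M M0 MP] := Dn_bounded (@pc_scalar R N) (@pc_cont R N) (@pbcE R N)
    B' n cK (sm_Fj hS j).
  by exists M.
exists (\sum_j M j); first by apply: sumr_ge0 => j _; exact: (MP j).1.
move=> z x t e j zB xl e1.
have line s : s *: dirP S z t x + gam S (t, x) = (v S t x + s *: (P S t x *m z), x).
  by congr pair; rewrite /= ?[s *: 0]mulr0 ?add0r // addrC.
have -> : Rem S n z x t e j 0 = Fj S j (e *: dirP S z t x + gam S (t, x))
    - \sum_(p < n) e ^+ p / p`!%:R * Dn (dirP S z t x) p (Fj S j) (gam S (t, x)).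
  rewrite line /Rem mxE [in LHS]mxE summxE; congr (_ - _).
  by apply: eq_bigr => p _; rewrite !mxE.
have := @taylor_bound R _ setT (Fj S j) (gam S (t, x)) (dirP S z t x) n e (M j) (sm_Fj hS j).
move=> /(_ (fun _ _ => Logic.I) _)/le_trans; apply.
  move=> s se; apply: (MP j).2.
    rewrite line; split => [i|] /=; last by rewrite in_itv /= -ler_distl.
    rewrite !mxE addrC; apply: le_trans (ler_normD _ _) _; apply: lerD; last exact: (CvP i t x).
    rewrite normrM -[B']mul1r ler_pM //; first exact: le_trans se e1.
    by have := PzB z x t i zB xl; rewrite mxE.
  by case=> [i|] /=; [exact: PzB|rewrite normr0].
rewrite ler_wpM2r ?exprn_ge0 //.
by rewrite (bigD1 j) //= lerDl; apply: sumr_ge0 => k _; exact: (MP k).1.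
Qed.

Definition Gapprox n z x eta t e : 'cV[R]_N :=
  E S x *m z + (e * eta) *: Gterm S 1 z x t
  + \sum_(2 <= p < n) e ^+ p.-1 *: Gterm S p z x t.

(** The division by [eps] in [G] costs one power: the remainder of order [n + 2] leaves an error of
    order [n + 1]. The radius [min 1 (r / 2)] keeps [lam] where [T] and the inverse of [P] are
    bounded, and [|eps|] below 1. *)
Lemma G_approx_bound n (B : R) : exists C d, [/\ 0 <= C, 0 < d, d <= 1, d <= r / 2 &
  forall z x eta t e, `|z| <= B -> `|x - l| < d -> 0 < `|e| < d ->
    `|G S z x eta t e - Gapprox n.+2 z x eta t e| <= C * `|e| ^+ n.+1].
Proof.
have r0 := r_gt0 hS.
have [M M0 MP] := Rem_bound n.+2 B.
have [CT CT0 CTP] := coef_bounded r0 (coef_T hS).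
have [CI CI0 CIP] := coef_bounded_family (f := fun k : 'I_N * 'I_N => fun p => invmx (P S p.1 p.2) k.1 k.2)
  r0 (fun k => coef_Pinv hS k.1 k.2).
exists (CT * \sum_(j < N) CI * M), (Num.min 1 (r / 2)).
have C0 : 0 <= CT * \sum_(j < N) CI * M.
  by rewrite mulr_ge0 //; apply: sumr_ge0 => j _; rewrite mulr_ge0.
split => //; [by rewrite lt_min ltr01 divr_gt0|by rewrite ge_min lexx|by rewrite ge_min lexx orbT|].
move=> z x eta t e zB; rewrite !lt_min => /andP[_ xl] /andP[e0 /andP[e1 _]].
have en0 : e != 0 by rewrite -normr_gt0.
have xr : `|x - l| < r by apply: lt_trans xl _; rewrite ltr_pdivrMr // ltr_pMr // ltr1n.
rewrite /Gapprox (G_rem hS) //; apply: mx_norm_le => [|i j]; first by rewrite mulr_ge0 // exprn_ge0.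
rewrite (ord1 j) !mxE !normrM normfV.
have SB : `|\sum_j invmx (P S t x) i j * Rem S n.+2 z x t e j 0| <=
    (\sum_(j < N) CI * M) * `|e| ^+ n.+2.
  rewrite mulr_suml; apply: le_trans (ler_norm_sum _ _ _) _; apply: ler_sum => k _.
  rewrite normrM -mulrA ler_pM //; first exact: (CIP (i, k) t x (ltW xl)).
  by apply: MP => //; exact: ltW.
rewrite -mulrA mulrCA; apply: (le_trans (y := CT * (`|e|^-1 * ((\sum_(j < N) CI * M) * `|e| ^+ n.+2)))).
  apply: ler_pM; [exact: normr_ge0|by apply: mulr_ge0; rewrite ?invr_ge0| |].
    exact: (CTP t x (ltW xl)).
  by rewrite ler_wpM2l // invr_ge0.
by rewrite -mulrA ler_wpM2l // mulrCA exprS mulKf // gt_eqF.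
Qed.

Lemma G_expansion_holds : G_expansion S.
Proof.
exists (Gterm S); split; first by move=> p c z x t _; exact: Gterm_homo.
move=> n B.
(* For positive [n] the predecessor gives exactly the required truncation and power. For [n = 0]
   both sums are empty, and the bound [C |eps|] is weakened to [C] using [d <= 1]. *)
have [C [d [C0 d0 d1 _ CP]]] := G_approx_bound n.-1 B.
exists C, d; split => // z x eta t e zB _ xl ed.
have := CP z x eta t e zB xl ed; rewrite /Gapprox; case: n {CP} => [|n] //=.
rewrite !big_geq // => /le_trans; apply; rewrite ler_wpM2l // expr1 expr0.
by have /andP[_ /ltW/le_trans] := ed; apply.
Qed.

End Expansion.

(** * Second-order jets in eps and trigonometric polynomials in phi *)

Section Jets.
Context (R : realType).
Implicit Types (h : R -> R -> R).

(** Uniform in [theta] and [phi]; the value [eps = 0] is left out because [G] contains a division by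
    [eps]. *)
Definition bigO (k : nat) (f : R -> R -> R -> R) := exists C d : R, [/\ 0 <= C, 0 < d &
  forall e t s, 0 < `|e| < d -> `|f e t s| <= C * `|e| ^+ k].

Definition bdd h := exists C : R, forall t s, `|h t s| <= C.

Lemma bigO_ext k f g : (forall e t s, f e t s = g e t s) -> bigO k f -> bigO k g.
Proof.
move=> fg [C [d [C0 d0 fC]]]; exists C, d; split => // e t s ed.
by rewrite -fg; exact: fC.
Qed.

Lemma bigOD k f g : bigO k f -> bigO k g -> bigO k (fun e t s => f e t s + g e t s).
Proof.
move=> [C [d [C0 d0 fC]]] [C' [d' [C0' d0' gC]]].
exists (C + C'), (Num.min d d'); split; [exact: addr_ge0|by rewrite lt_min d0|].
move=> e t s; rewrite lt_min => /andP[e0 /andP[ed ed']].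
apply: le_trans (ler_normD _ _) _; rewrite mulrDl.
by apply: lerD; [apply: fC|apply: gC]; rewrite e0.
Qed.

Lemma bigOM j k f g : bigO j f -> bigO k g ->
  bigO (j + k) (fun e t s => f e t s * g e t s).
Proof.
move=> [C [d [C0 d0 fC]]] [C' [d' [C0' d0' gC]]].
exists (C * C'), (Num.min d d'); split; [exact: mulr_ge0|by rewrite lt_min d0|].
move=> e t s; rewrite lt_min => /andP[e0 /andP[ed ed']].
rewrite normrM exprD mulrACA.
by apply: ler_pM => //; [apply: fC|apply: gC]; rewrite e0.
Qed.

Lemma bigO_weaken j k f : (k <= j)%N -> bigO j f -> bigO k f.
Proof.
move=> kj [C [d [C0 d0 fC]]]; exists C, (Num.min d 1); split => //.
  by rewrite lt_min d0 ltr01.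
move=> e t s; rewrite lt_min => /andP[e0 /andP[ed e1]].
apply: le_trans (fC _ _ _ _) _; first by rewrite e0.
by rewrite ler_wpM2l // ler_wiXn2l // ltW.
Qed.

Lemma bigO_eps k : bigO k (fun e _ _ => e ^+ k).
Proof. by exists 1, 1; split => // e t s _; rewrite mul1r normrX. Qed.

Lemma bdd_bigO h : bdd h -> bigO 0 (fun _ t s => h t s).
Proof.
move=> [C hC]; exists `|C|, 1; split => // e t s _.
by rewrite expr0 mulr1; apply: le_trans (hC t s) (ler_norm C).
Qed.

Lemma bdd_cst (a : R) : bdd (fun _ _ => a).
Proof. by exists `|a|. Qed.

Lemma bddD h h' : bdd h -> bdd h' -> bdd (fun t s => h t s + h' t s).
Proof.
move=> [C hC] [C' hC']; exists (C + C') => t s.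
by apply: le_trans (ler_normD _ _) _; apply: lerD.
Qed.

Lemma bddM h h' : bdd h -> bdd h' -> bdd (fun t s => h t s * h' t s).
Proof.
move=> [C hC] [C' hC']; exists (C * C') => t s.
by rewrite normrM ler_pM.
Qed.

Lemma bddN h : bdd h -> bdd (fun t s => - h t s).
Proof. by move=> [C hC]; exists C => t s; rewrite normrN. Qed.

(* [f = h0 + eps h1 + eps^2 h2 + O(eps^3)], uniformly in [theta] and [phi]. *)
Definition jet (f : R -> R -> R -> R) h0 h1 h2 := [/\ bdd h0, bdd h1, bdd h2 &
  bigO 3 (fun e t s => f e t s - (h0 t s + e * h1 t s + e ^+ 2 * h2 t s))].

Lemma jet_ext f g h0 h1 h2 h0' h1' h2' : (forall e t s, f e t s = g e t s) ->
  (forall t s, h0 t s = h0' t s) -> (forall t s, h1 t s = h1' t s) ->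
  (forall t s, h2 t s = h2' t s) -> jet f h0 h1 h2 -> jet g h0' h1' h2'.
Proof.
move=> fg e0 e1 e2.
have -> : g = f by apply/funext => e; apply/funext => t; apply/funext => s; rewrite fg.
have -> : h0' = h0 by apply/funext => t; apply/funext => s; rewrite e0.
have -> : h1' = h1 by apply/funext => t; apply/funext => s; rewrite e1.
by have -> : h2' = h2 by apply/funext => t; apply/funext => s; rewrite e2.
Qed.

Lemma jet_poly h0 h1 h2 : bdd h0 -> bdd h1 -> bdd h2 ->
  jet (fun e t s => h0 t s + e * h1 t s + e ^+ 2 * h2 t s) h0 h1 h2.
Proof.
move=> b0 b1 b2; split => //; exists 0, 1; split => // e t s _.
by rewrite subrr normr0 mul0r.
Qed.

Lemma jet_cst h : bdd h -> jet (fun _ t s => h t s) h (fun _ _ => 0) (fun _ _ => 0).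
Proof.
move=> bh; apply: jet_ext (jet_poly bh (bdd_cst 0) (bdd_cst 0)) => // e t s.
by rewrite !mulr0 !addr0.
Qed.

Lemma jetD f g f0 f1 f2 g0 g1 g2 : jet f f0 f1 f2 -> jet g g0 g1 g2 ->
  jet (fun e t s => f e t s + g e t s) (fun t s => f0 t s + g0 t s)
    (fun t s => f1 t s + g1 t s) (fun t s => f2 t s + g2 t s).
Proof.
move=> [bf0 bf1 bf2 Of] [bg0 bg1 bg2 Og]; split; try exact: bddD.
by apply: bigO_ext (bigOD Of Og) => e t s; ring.
Qed.

Lemma jet_bigO f f0 f1 f2 : jet f f0 f1 f2 -> bigO 0 f.
Proof.
move=> [b0 b1 b2 Of].
have O1 := bigO_weaken (leq0n _) (bigOM (bigO_eps 1) (bdd_bigO b1)).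
have O2 := bigO_weaken (leq0n _) (bigOM (bigO_eps 2) (bdd_bigO b2)).
apply: bigO_ext (bigOD (bigO_weaken (leq0n _) Of) (bigOD (bigOD (bdd_bigO b0) O1) O2)) => e t s.
by rewrite subrK.
Qed.

Lemma jetM f g f0 f1 f2 g0 g1 g2 : jet f f0 f1 f2 -> jet g g0 g1 g2 ->
  jet (fun e t s => f e t s * g e t s) (fun t s => f0 t s * g0 t s)
    (fun t s => f0 t s * g1 t s + f1 t s * g0 t s)
    (fun t s => f0 t s * g2 t s + f1 t s * g1 t s + f2 t s * g0 t s).
Proof.
move=> jf jg; have O0f := jet_bigO jf; have O0g := jet_bigO jg.
move: jf jg => [bf0 bf1 bf2 Of] [bg0 bg1 bg2 Og].
split; [exact: bddM|by apply: bddD; exact: bddM|by do 2?apply: bddD; exact: bddM|].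
(* [T1] and [T2] cover the difference between [f g] and the product of the two truncations; [T3] and
   [T4] are the cubic and quartic terms of that product. *)
have OP := jet_bigO (jet_poly bf0 bf1 bf2).
have T1 := bigOM OP Og; rewrite add0n in T1.
have T2 := bigOM Of O0g; rewrite addn0 in T2.
have T3 := bigOM (bigO_eps 3) (bdd_bigO (bddD (bddM bf1 bg2) (bddM bf2 bg1))).
have T4 := bigO_weaken (isT : (3 <= 4 + 0)%N) (bigOM (bigO_eps 4) (bdd_bigO (bddM bf2 bg2))).
rewrite addn0 in T3.
by apply: bigO_ext (bigOD (bigOD T1 T2) (bigOD T3 T4)) => e t s; ring.
Qed.

Lemma jetZ (a : R) f f0 f1 f2 : jet f f0 f1 f2 ->
  jet (fun e t s => a * f e t s) (fun t s => a * f0 t s)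
    (fun t s => a * f1 t s) (fun t s => a * f2 t s).
Proof.
move=> jf; apply: jet_ext (jetM (jet_cst (bdd_cst a)) jf) => // t s; ring.
Qed.

Lemma jetN f f0 f1 f2 : jet f f0 f1 f2 ->
  jet (fun e t s => - f e t s) (fun t s => - f0 t s)
    (fun t s => - f1 t s) (fun t s => - f2 t s).
Proof.
by move=> jf; apply: jet_ext (jetZ (-1) jf) => *; rewrite mulN1r.
Qed.

Lemma jet_eps f f0 f1 f2 : jet f f0 f1 f2 ->
  jet (fun e t s => e * f e t s) (fun _ _ => 0) f0 f1.
Proof.
move=> jf; have je : jet (fun e _ _ => e) (fun _ _ => 0) (fun _ _ => 1) (fun _ _ => 0).
  apply: jet_ext (jet_poly (bdd_cst 0) (bdd_cst 1) (bdd_cst 0)) => // e t s; ring.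
apply: jet_ext (jetM je jf) => // t s; ring.
Qed.

Lemma jet_sum (J : Type) (r : seq J) (f : J -> R -> R -> R -> R) (f0 f1 f2 : J -> R -> R -> R) :
  (forall j, jet (f j) (f0 j) (f1 j) (f2 j)) ->
  jet (fun e t s => \sum_(j <- r) f j e t s) (fun t s => \sum_(j <- r) f0 j t s)
    (fun t s => \sum_(j <- r) f1 j t s) (fun t s => \sum_(j <- r) f2 j t s).
Proof.
move=> jf; elim: r => [|j r IH].
  by apply: jet_ext (jet_cst (bdd_cst 0)) => *; rewrite big_nil.
by apply: jet_ext (jetD (jf j) IH) => *; rewrite big_cons.
Qed.

Lemma smper_bdd (f : R -> R) : smper f -> exists C, forall t, `|f t| <= C.
Proof.
move=> [sf pf].
have [|C _ fC] := @continuous_bounded_on R R `[0, 2 * pi]%classic f (@segment_compact R 0 (2 * pi)).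
  by move=> t _; exact: (sm_cont sf).
exists C => t; have [s [n [s2 ->]]] := period_reduce t.
by rewrite (periodic_int n s pf); apply: fC; rewrite /= in_itv.
Qed.

(** A shift of [lam] by [eps^2 lam2] creates no term of order [eps] and brings in the
    [lam]-derivative at order [eps^2]; the Taylor error is of order [eps^4]. *)
Lemma coef_jet (l r lam2 : R) (c : R * R -> R) : 0 < r -> coef l r c ->
  jet (fun e t _ => c (t, l + e ^+ 2 * lam2)) (fun t _ => c (t, l)) (fun _ _ => 0)
    (fun t _ => lam2 * 'D_(0, 1) c (t, l)).
Proof.
move=> r0 cc.
have ll : `|l - l| < r by rewrite subrr normr0.
have b0 : bdd (fun t _ => c (t, l)).
  by have [C CP] := smper_bdd (coef_smper cc ll); exists C => t s; exact: CP.
have b2 : bdd (fun t _ => 'D_(0, 1) c (t, l)).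
  by have [C CP] := smper_bdd (coef_smper (coef_derive (0, 1) cc) ll); exists C => t s; exact: CP.
split => //; [exact: bdd_cst|by apply: bddM => //; exact: bdd_cst|].
have [C C0 CP] := coef_taylor r0 cc.
(* For [|eps| < 1] the shift is at most [|eps| (1 + |lam2|)], which this radius keeps below
   [r / 2]. *)
exists (C * `|lam2| ^+ 2), (Num.min 1 (r / 2 / (1 + `|lam2|))); split.
- by rewrite mulr_ge0 // exprn_ge0.
- by rewrite lt_min ltr01 !divr_gt0 // ltr_wpDr.
move=> e t s; rewrite lt_min => /andP[e0 /andP[e1]].
rewrite ltr_pdivlMr ?ltr_wpDr // => e2.
have sr : `|e ^+ 2 * lam2| <= r / 2.
  rewrite normrM normrX; apply: le_trans (ltW e2).
  rewrite expr2 -mulrA ler_wpM2l //; apply: le_trans (_ : 1 * `|lam2| <= _).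
    by rewrite ler_wpM2r // ltW.
  by rewrite mul1r lerDr.
have := CP t _ sr; rewrite mulr0 addr0 opprD addrA [e ^+ 2 * (lam2 * _)]mulrA.
move=> /le_trans; apply.
have -> : `|e ^+ 2 * lam2| ^+ 2 = `|lam2| ^+ 2 * `|e| ^+ 4 by rewrite normrM normrX; ring.
rewrite -[leRHS]mulrA; do 2?[apply: ler_wpM2l; first by rewrite ?exprn_ge0].
by rewrite ler_wiXn2l // ltW.
Qed.

End Jets.

(** * Trigonometric polynomials in [phi] *)

Section Modal.
Context (R : realType).
Implicit Types (h : R -> R -> R).

Definition modal (ms : seq nat) (a b : nat -> R -> R) (t s : R) : R :=
  \sum_(k <- ms) (cos (k%:R * s) * a k t + sin (k%:R * s) * b k t).

Definition Mod (ms : seq nat) h := exists a b : nat -> R -> R,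
  [/\ forall k, smper (a k), forall k, smper (b k) & forall t s, h t s = modal ms a b t s].

Lemma ModD ms h h' : Mod ms h -> Mod ms h' -> Mod ms (fun t s => h t s + h' t s).
Proof.
move=> [a [b [sa sb hE]]] [a' [b' [sa' sb' hE']]].
exists (fun k t => a k t + a' k t), (fun k t => b k t + b' k t); split.
- by move=> k; exact: smperD.
- by move=> k; exact: smperD.
move=> t s; rewrite hE hE' /modal -big_split; apply: eq_bigr => k _ /=; ring.
Qed.

Lemma ModZ ms h (f : R -> R) : smper f -> Mod ms h -> Mod ms (fun t s => f t * h t s).
Proof.
move=> sf [a [b [sa sb hE]]].
exists (fun k t => f t * a k t), (fun k t => f t * b k t); split.
- by move=> k; exact: smperM.
- by move=> k; exact: smperM.
move=> t s; rewrite hE /modal mulr_sumr; apply: eq_bigr => k _ /=; ring.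
Qed.

Lemma Mod0 ms : Mod ms (fun _ _ => 0).
Proof.
exists (fun _ _ => 0), (fun _ _ => 0); split; try by move=> k; exact: smper_cst.
by move=> t s; rewrite /modal big1 // => k _; rewrite !mulr0 addr0.
Qed.

Lemma Mod_ext ms h h' : (forall t s, h t s = h' t s) -> Mod ms h -> Mod ms h'.
Proof. by move=> e [a [b [sa sb hE]]]; exists a, b; split => // t s; rewrite -e. Qed.

Lemma Mod_sum ms (J : Type) (r : seq J) (h : J -> R -> R -> R) :
  (forall j, Mod ms (h j)) -> Mod ms (fun t s => \sum_(j <- r) h j t s).
Proof.
move=> Mh; elim: r => [|j r IH].
  by apply: Mod_ext (Mod0 ms) => t s; rewrite big_nil.
by apply: Mod_ext (ModD (Mh j) IH) => t s; rewrite big_cons.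
Qed.

Lemma cos2x (s : R) : cos (2 * s) = cos s ^+ 2 - sin s ^+ 2.
Proof. by rewrite (_ : 2 * s = s + s) ?cosD; ring. Qed.

Lemma sin2x (s : R) : sin (2 * s) = 2 * sin s * cos s.
Proof. by rewrite (_ : 2 * s = s + s) ?sinD; ring. Qed.

Lemma cos3x (s : R) : cos (3 * s) = cos s ^+ 3 - 3 * cos s * sin s ^+ 2.
Proof. by rewrite (_ : 3 * s = 2 * s + s) ?cosD ?cos2x ?sin2x; ring. Qed.

Lemma sin3x (s : R) : sin (3 * s) = 3 * cos s ^+ 2 * sin s - sin s ^+ 3.
Proof. by rewrite (_ : 3 * s = 2 * s + s) ?sinD ?cos2x ?sin2x; ring. Qed.

(** Certificate for trigonometric identities: exhibiting the multiplier [K] of [cos^2 + sin^2 - 1]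
    reduces the identity to polynomial algebra. *)
Lemma trig_eq (K s x y : R) : x - y = K * (cos s ^+ 2 + sin s ^+ 2 - 1) -> x = y.
Proof. by rewrite cos2Dsin2 subrr mulr0 => /eqP; rewrite subr_eq0 => /eqP. Qed.

Lemma modal02 a b t s : modal [:: 0; 2]%N a b t s = a 0%N t
  + (cos s ^+ 2 - sin s ^+ 2) * a 2%N t + 2 * sin s * cos s * b 2%N t.
Proof.
rewrite /modal !big_cons big_nil mul0r cos0 sin0 cos2x sin2x; ring.
Qed.

Lemma modal13 a b t s : modal [:: 1; 3]%N a b t s =
  cos s * a 1%N t + sin s * b 1%N t + (cos s ^+ 3 - 3 * cos s * sin s ^+ 2) * a 3%N t
  + (3 * cos s ^+ 2 * sin s - sin s ^+ 3) * b 3%N t.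
Proof.
rewrite /modal !big_cons big_nil mul1r cos3x sin3x; ring.
Qed.

(** Product-to-sum: [cos s cos 2s] is half of [cos s + cos 3s], and [cos s sin 2s] is half of
    [sin s + sin 3s]; hence the coefficients 1/2. *)
Lemma Mod_cos02 h : Mod [:: 0; 2]%N h -> Mod [:: 1; 3]%N (fun t s => cos s * h t s).
Proof.
move=> [a [b [sa sb hE]]].
exists (fun k => match k with
    | 1%N => fun t => a 0%N t + 2^-1 * a 2%N t | 3%N => fun t => 2^-1 * a 2%N t | _ => fun=> 0 end),
  (fun k => match k with
    | 1%N => fun t => 2^-1 * b 2%N t | 3%N => fun t => 2^-1 * b 2%N t | _ => fun=> 0 end); split.
- move=> [|[|[|[|k]]]]; [exact: smper_cst| |exact: smper_cst|exact: smperZ|exact: smper_cst].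
  by apply: smperD => //; exact: smperZ.
- by move=> [|[|[|[|k]]]]; [exact: smper_cst|exact: smperZ|exact: smper_cst|exact: smperZ|exact: smper_cst].
move=> t s; rewrite hE modal02 modal13.
by apply: (@trig_eq (2^-1 * (cos s * a 2%N t + sin s * b 2%N t)) s); field.
Qed.

Lemma Mod_sin02 h : Mod [:: 0; 2]%N h -> Mod [:: 1; 3]%N (fun t s => sin s * h t s).
Proof.
move=> [a [b [sa sb hE]]].
exists (fun k => match k with
    | 1%N => fun t => 2^-1 * b 2%N t | 3%N => fun t => - 2^-1 * b 2%N t | _ => fun=> 0 end),
  (fun k => match k with
    | 1%N => fun t => a 0%N t + - 2^-1 * a 2%N t | 3%N => fun t => 2^-1 * a 2%N t | _ => fun=> 0 end); split.
- by move=> [|[|[|[|k]]]]; [exact: smper_cst|exact: smperZ|exact: smper_cst|exact: smperZ|exact: smper_cst].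
- move=> [|[|[|[|k]]]]; [exact: smper_cst| |exact: smper_cst|exact: smperZ|exact: smper_cst].
  by apply: smperD => //; exact: smperZ.
move=> t s; rewrite hE modal02 modal13.
by apply: (@trig_eq (2^-1 * (cos s * b 2%N t - sin s * a 2%N t)) s); field.
Qed.

Lemma Mod_quadratic (x y x' y' : R) : Mod [:: 0; 2]%N
  (fun _ s => (cos s * x + sin s * y) * (cos s * x' + sin s * y')).
Proof.
exists (fun k => match k with
    | 0%N => fun=> 2^-1 * (x * x' + y * y') | 2%N => fun=> 2^-1 * (x * x' - y * y') | _ => fun=> 0 end),
  (fun k => match k with 2%N => fun=> 2^-1 * (x * y' + y * x') | _ => fun=> 0 end); split.
- by move=> [|[|[|k]]]; exact: smper_cst.
- by move=> [|[|[|k]]]; exact: smper_cst.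
move=> t s; rewrite modal02.
by apply: (@trig_eq (2^-1 * (x * x' + y * y')) s); field.
Qed.

Lemma der_modal_t ms (a b a' b' : nat -> R -> R) s :
  (forall k, der (a k) (a' k)) -> (forall k, der (b k) (b' k)) ->
  der (fun t => modal ms a b t s) (fun t => modal ms a' b' t s).
Proof.
by move=> da db; apply: der_sum => k; apply: derD; apply: derZ.
Qed.

Lemma der_modal_s ms (a b : nat -> R -> R) t :
  der (modal ms a b t)
    (modal ms (fun k t => k%:R * b k t) (fun k t => - (k%:R * a k t)) t).
Proof.
apply: der_sum => k.
apply: derE (derD (derM (der_cosM k%:R) (der_cst (a k t)))
  (derM (der_sinM k%:R) (der_cst (b k t)))) _ => s; ring.
Qed.

Lemma bdd_modal ms a b : (forall k, smper (a k)) -> (forall k, smper (b k)) ->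
  bdd (modal ms a b).
Proof.
move=> sa sb; rewrite /modal; elim: ms => [|k ms IH].
  by exists 0 => t s; rewrite big_nil normr0.
have [C aC] := smper_bdd (sa k); have [C' bC] := smper_bdd (sb k).
have [D hD] := IH; exists (C + C' + D) => t s; rewrite big_cons.
apply: le_trans (ler_normD _ _) _; apply: lerD => //.
apply: le_trans (ler_normD _ _) _; rewrite !normrM.
by apply: lerD; rewrite -[leRHS]mul1r; apply: ler_pM => //; [exact: cos_max|exact: sin_max].
Qed.

End Modal.

(** * The linear problems at orders [eps] and [eps^2] *)

Section OrderByOrder.
Context (R : realType) (m : nat) (omega : R) (Et : 'M[R]_m).
Hypothesis omega0 : 0 < omega.
Hypothesis omega2 : omega < 2^-1.
Hypothesis omega3 : omega != 3^-1.
Hypothesis omega4 : omega != 4^-1.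
Hypothesis Et_hyp : forall a : R[i],
  complex.Re a = 0 -> ~~ complex_eigenvalue Et a.
Local Notation N := (ns_dim m).
Let E := floquet_block (rot_block 0 omega) Et.

Definition avec (i : 'I_N) (s : R) : R :=
  cos s * (i == ih m 0)%:R + sin s * (i == ih m 1)%:R.
Definition avec_dot (i : 'I_N) (s : R) : R :=
  cos s * (i == ih m 1)%:R - sin s * (i == ih m 0)%:R.

Lemma Mod_avec i h : Mod [:: 0; 2]%N h -> Mod [:: 1; 3]%N (fun t s => avec i s * h t s).
Proof.
move=> Mh; have Mc := ModZ (smper_cst (i == ih m 0)%:R) (Mod_cos02 Mh).
have Ms := ModZ (smper_cst (i == ih m 1)%:R) (Mod_sin02 Mh).
by apply: Mod_ext (ModD Mc Ms) => t s; rewrite /avec; ring.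
Qed.

Definition smooth_family (a : 'I_N -> nat -> R -> R) := forall i k, smper (a i k).

(** The forcing at order [eps] is quadratic in the first harmonic, so the resonant mode 1 is absent
    and [eta] is the only parameter to be adjusted. The [theta]-derivatives are returned as the
    families [a'] and [b']. *)
Lemma order1 (f : 'I_N -> R -> R -> R) : (forall i, Mod [:: 0; 2]%N (f i)) ->
  exists (eta : R) (a b a' b' : 'I_N -> nat -> R -> R),
  [/\ smooth_family a /\ smooth_family b,
      (forall i k, der (a i k) (a' i k)) /\ (forall i k, der (b i k) (b' i k)),
      smper0 (a il 0%N) &
      forall i t s, \sum_j E i j * modal [:: 0; 2]%N (a j) (b j) t s
        + (f i t s - eta * (i == il)%:R)
        - modal [:: 0; 2]%N (a' i) (b' i) t s
        - omega * modal [:: 0; 2]%N (fun k t => k%:R * b i k t)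
                    (fun k t => - (k%:R * a i k t)) t s = 0].
Proof.
move=> Mf; have /choice[g gP] : forall i, exists g : (nat -> R -> R) * (nat -> R -> R),
    [/\ forall k, smper (g.1 k), forall k, smper (g.2 k) &
        forall t s, f i t s = modal [:: 0; 2]%N g.1 g.2 t s].
  by move=> i; have [ga [gb gab]] := Mf i; exists (ga, gb).
have sg1 i k : smper ((g i).1 k) by have [H _ _] := gP i.
have sg2 i k : smper ((g i).2 k) by have [_ H _] := gP i.
have gE i : forall t s, f i t s = modal [:: 0; 2]%N (g i).1 (g i).2 t s.
  by have [_ _ H] := gP i.
have [eta [y [sy y0 dy]]] := solve_mode0 omega0 omega2 omega3 omega4 Et_hyp
  (fun i => sg1 i 0%N).
have [yc [ys [syc sys ysol]]] := solve_mode23 omega0 omega2 omega3 omega4 Et_hyp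
  (isT : 2%N \in [:: 2; 3]%N) (fun i => sg1 i 2%N) (fun i => sg2 i 2%N).
exists eta, (fun i k => match k with 0%N => y i | 2%N => yc i | _ => fun=> 0 end),
  (fun i k => match k with 2%N => ys i | _ => fun=> 0 end),
  (fun i k => match k with
    | 0%N => fun t => \sum_j E i j * y j t + ((g i).1 0%N t - eta * (i == il)%:R)
    | 2%N => fun t => \sum_j E i j * yc j t - 2 * omega * ys i t + (g i).1 2%N t
    | _ => fun=> 0 end),
  (fun i k => match k with
    | 2%N => fun t => \sum_j E i j * ys j t + 2 * omega * yc i t + (g i).2 2%N t
    | _ => fun=> 0 end); split.
- by split => i [|[|[|k]]] //; exact: smper_cst.
- split => i [|[|[|k]]]; try exact: der_cst; try exact: dy; have [dc ds] := ysol i.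
    exact: dc.
  exact: ds.
- exact: y0.
move=> i t s; rewrite gE !modal02.
under eq_bigr do rewrite modal02 !mulrDr !(mulrCA (E _ _)).
rewrite !big_split /= -!mulr_sumr; ring.
Qed.

(** Mode 1 now occurs. [p] and [q] are the amounts of [avec] and [avec_dot] that remove its
    resonance; [lam2] and [om2] are later computed from them. The two mean-zero combinations are
    those tested by the amplitude conditions. *)
Lemma order2 (f : 'I_N -> R -> R -> R) : (forall i, Mod [:: 1; 3]%N (f i)) ->
  exists (p q : R) (a b a' b' : 'I_N -> nat -> R -> R),
  [/\ smooth_family a /\ smooth_family b,
      (forall i k, der (a i k) (a' i k)) /\ (forall i k, der (b i k) (b' i k)),
      smper0 (fun t => a (ih m 0) 1%N t + b (ih m 1) 1%N t) /\
      smper0 (fun t => a (ih m 1) 1%N t - b (ih m 0) 1%N t) &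
      forall i t s, \sum_j E i j * modal [:: 1; 3]%N (a j) (b j) t s
        + (f i t s + p * avec i s + q * avec_dot i s)
        - modal [:: 1; 3]%N (a' i) (b' i) t s
        - omega * modal [:: 1; 3]%N (fun k t => k%:R * b i k t)
                    (fun k t => - (k%:R * a i k t)) t s = 0].
Proof.
move=> Mf; have /choice[g gP] : forall i, exists g : (nat -> R -> R) * (nat -> R -> R),
    [/\ forall k, smper (g.1 k), forall k, smper (g.2 k) &
        forall t s, f i t s = modal [:: 1; 3]%N g.1 g.2 t s].
  by move=> i; have [ga [gb gab]] := Mf i; exists (ga, gb).
have sg1 i k : smper ((g i).1 k) by have [H _ _] := gP i.
have sg2 i k : smper ((g i).2 k) by have [_ H _] := gP i.
have gE i : forall t s, f i t s = modal [:: 1; 3]%N (g i).1 (g i).2 t s.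
  by have [_ _ H] := gP i.
have [p [q [zc [zs [szc szs z0 z1 zsol]]]]] := solve_mode1 omega0 omega2 omega3 Et_hyp
  (fun i => sg1 i 1%N) (fun i => sg2 i 1%N).
have [yc [ys [syc sys ysol]]] := solve_mode23 omega0 omega2 omega3 omega4 Et_hyp
  (isT : 3%N \in [:: 2; 3]%N) (fun i => sg1 i 3%N) (fun i => sg2 i 3%N).
exists p, q, (fun i k => match k with 1%N => zc i | 3%N => yc i | _ => fun=> 0 end),
  (fun i k => match k with 1%N => zs i | 3%N => ys i | _ => fun=> 0 end),
  (fun i k => match k with
    | 1%N => fun t => \sum_j E i j * zc j t - omega * zs i t
        + ((g i).1 1%N t + (p * (i == ih m 0)%:R + q * (i == ih m 1)%:R))
    | 3%N => fun t => \sum_j E i j * yc j t - 3 * omega * ys i t + (g i).1 3%N t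
    | _ => fun=> 0 end),
  (fun i k => match k with
    | 1%N => fun t => \sum_j E i j * zs j t + omega * zc i t
        + ((g i).2 1%N t + (p * (i == ih m 1)%:R - q * (i == ih m 0)%:R))
    | 3%N => fun t => \sum_j E i j * ys j t + 3 * omega * yc i t + (g i).2 3%N t
    | _ => fun=> 0 end); split.
- by split => i [|[|[|[|k]]]] //; exact: smper_cst.
- split => i [|[|[|[|k]]]]; try exact: der_cst;
    have [dc ds] := ysol i; have [ec es] := zsol i.
  + exact: ec.
  + exact: dc.
  + exact: es.
  + exact: ds.
- by split.
move=> i t s; rewrite gE !modal13 /avec /avec_dot.
under eq_bigr do rewrite modal13 !mulrDr !(mulrCA (E _ _)).
rewrite !big_split /= -!mulr_sumr; ring.
Qed.

End OrderByOrder.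

Lemma is_derive_lincomb (R : realType) (V : normedModType R) (J : Type) (s : seq J)
    (w : J -> R) (f : J -> V -> R) (f' : J -> R) (x v : V) :
  (forall j, is_derive x v (f j) (f' j)) ->
  is_derive x v (fun y => \sum_(j <- s) w j * f j y) (\sum_(j <- s) w j * f' j).
Proof.
move=> df; elim: s => [|j s IH].
  by under eq_fun do rewrite big_nil; rewrite big_nil; exact: is_derive_cst.
under eq_fun do rewrite big_cons; rewrite big_cons.
exact: (is_deriveD (is_deriveZ (w j) (df j)) IH).
Qed.

Lemma bigO_sum_norm (R : realType) (k : nat) (J : Type) (s : seq J)
    (f : J -> R -> R -> R -> R) : (forall j, bigO k (f j)) ->
  bigO k (fun e t ph => \sum_(j <- s) `|f j e t ph|).
Proof.
move=> Of; elim: s => [|j s IH].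
  exists 0, 1; split => // e t ph _; by rewrite big_nil normr0 mul0r.
have Oj : bigO k (fun e t ph => `|f j e t ph|).
  have [C [d [C0 d0 fC]]] := Of j; exists C, d; split => // e t ph ed.
  by rewrite normr_id; exact: fC.
by apply: bigO_ext (bigOD Oj IH) => e t ph; rewrite big_cons.
Qed.

(** * Coefficients of the forms [Gterm p], and [E] on the first harmonic *)

Section Coefficients.
Context (R : realType) (m : nat) (S : ns_data R m).
Hypothesis hS : neimark_sacker S.
Local Notation N := (ns_dim m).
Local Notation l := (lam_star S).
Local Notation r := (Defs.rad S).
Local Notation coef := (coef l r).

Definition G1c (i a : 'I_N) (p : R * R) : R :=
  - \sum_j invmx (P S p.1 p.2) i j * P_dot S p.1 p.2 j a.

Definition G2c (i a b : 'I_N) (p : R * R) : R :=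
  T S p.2 * 2^-1 * \sum_j invmx (P S p.1 p.2) i j * dd S [:: a; b] (Fj S j) p.

Definition G3c (i a b c : 'I_N) (p : R * R) : R :=
  T S p.2 * 6^-1 * \sum_j invmx (P S p.1 p.2) i j * dd S [:: a; b; c] (Fj S j) p.

Lemma coef_G1c i a : coef (G1c i a).
Proof.
apply: coefN; apply: coef_sum => j; apply: coefM; [exact: coef_Pinv|exact: coef_P_dot].
Qed.

Lemma coef_G2c i a b : coef (G2c i a b).
Proof.
apply: coefM; first by apply: coefM; [exact: coef_T|exact: coef_cst].
by apply: coef_sum => j; apply: coefM; [exact: coef_Pinv|apply: coef_dd => //; exact: sm_Fj].
Qed.

Lemma coef_G3c i a b c : coef (G3c i a b c).
Proof.
apply: coefM; first by apply: coefM; [exact: coef_T|exact: coef_cst].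
by apply: coef_sum => j; apply: coefM; [exact: coef_Pinv|apply: coef_dd => //; exact: sm_Fj].
Qed.

Lemma Gterm1E z x t i : Gterm S 1 z x t i 0 = \sum_a z a 0 * G1c i a (t, x).
Proof.
rewrite mxE mulmxA mxE -sumrN; apply: eq_bigr => a _.
by rewrite mxE /G1c /= mulrN mulrC.
Qed.

Lemma Gterm2E z x t i : Gterm S 2 z x t i 0
  = \sum_a z a 0 * \sum_b z b 0 * G2c i a b (t, x).
Proof.
have sF j := sm_Fj hS j.
rewrite /Gterm mxE (_ : 2`!%:R = 2) // mxE.
have -> : \sum_j invmx (P S t x) i j * Dcol S 2 z x t j 0
  = \sum_j invmx (P S t x) i j * \sum_a z a 0 * \sum_b z b 0 * dd S [:: a; b] (Fj S j) (t, x).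
  by apply: eq_bigr => j _; rewrite [Dcol _ _ _ _ _ _ _]mxE Dn_dd2.
rewrite (exchange_sum (fun a => z a 0) _
  (fun j a => \sum_b z b 0 * dd S [:: a; b] (Fj S j) (t, x))).
rewrite mulr_sumr; apply: eq_bigr => a _.
rewrite mulrCA; apply: (congr1 ( *%R (z a 0))).
rewrite (exchange_sum (fun b => z b 0) _ (fun j b => dd S [:: a; b] (Fj S j) (t, x))).
by rewrite mulr_sumr; apply: eq_bigr => b _; rewrite mulrCA.
Qed.

Lemma Gterm3E z x t i : Gterm S 3 z x t i 0
  = \sum_a z a 0 * \sum_b z b 0 * \sum_c z c 0 * G3c i a b c (t, x).
Proof.
have sF j := sm_Fj hS j.
rewrite /Gterm mxE (_ : 3`!%:R = 6) // mxE.
have -> : \sum_j invmx (P S t x) i j * Dcol S 3 z x t j 0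
  = \sum_j invmx (P S t x) i j * \sum_a z a 0 * \sum_b z b 0 * \sum_c z c 0 * dd S [:: a; b; c] (Fj S j) (t, x).
  by apply: eq_bigr => j _; rewrite [Dcol _ _ _ _ _ _ _]mxE Dn_dd3.
rewrite (exchange_sum (fun a => z a 0) _
  (fun j a => \sum_b z b 0 * \sum_c z c 0 * dd S [:: a; b; c] (Fj S j) (t, x))).
rewrite mulr_sumr; apply: eq_bigr => a _.
rewrite mulrCA; apply: (congr1 ( *%R (z a 0))).
rewrite (exchange_sum (fun b => z b 0) _ (fun j b => \sum_c z c 0 * dd S [:: a; b; c] (Fj S j) (t, x))).
rewrite mulr_sumr; apply: eq_bigr => b _; rewrite mulrCA; apply: (congr1 ( *%R (z b 0))).
rewrite (exchange_sum (fun c => z c 0) _ (fun j c => dd S [:: a; b; c] (Fj S j) (t, x))).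
by rewrite mulr_sumr; apply: eq_bigr => c _; rewrite mulrCA.
Qed.

Let alpha_R' := derive1 (alpha_R S) l.
Let alpha_I' := derive1 (alpha_I S) l.

(** On the first harmonic [E] acts as [alpha_R] plus [alpha_I] times the quarter turn taking
    [a_star] to [a_star_dot]. Its [lam]-derivative shows how [lam2] enters the resonant mode. *)
Lemma E_entry_sum x i s : \sum_a avec a s * E S x i a
  = alpha_R S x * avec i s + alpha_I S x * avec_dot i s.
Proof.
under eq_bigr do rewrite mulrC.
have l1 : lift ord0 ord0 = 1 :> 'I_2 by exact/val_inj.
have ihE i' j : (ih m i' == ih m j) = (i' == j) by rewrite /ih (inj_eq (@lshift_inj _ _)).
have itE i' j : (it i' == ih m j) = false by rewrite /it /ih eq_rlshift.
have ilE j : (il == ih m j) = false by rewrite /il /ih eq_rlshift.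
move: i; apply: block_ind => [i|i|].
- rewrite floquet_h 2!big_ord_recl big_ord0 !mxE l1 /avec /avec_dot !ihE.
  by case: i => [[|[|//]] ilt] /=; ring.
- rewrite floquet_t big1 => [|j _]; last by rewrite /avec !itE !mulr0 addr0 mulr0.
  by rewrite /avec /avec_dot !itE !mulr0 subrr addr0 !mulr0 addr0.
- by rewrite floquet_l /avec /avec_dot !ilE !mulr0 subrr addr0 !mulr0 addr0.
Qed.

Lemma derive_E_sum t i s : \sum_a avec a s * 'D_(0, 1) (fun p : R * R => E S p.2 i a) (t, l)
  = alpha_R' * avec i s + alpha_I' * avec_dot i s.
Proof.
have ll : `|l - l| < r by rewrite subrr normr0; exact: r_gt0.
have sE j k : sm [set x | `|x - l| < r] (fun x => E S x j k).
  by have /(smooth_on_entriesP _ (@open_center R l r)) := E_smooth (NS_continuation hS); apply.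
have dE a : 'D_(0, 1) (fun p : R * R => E S p.2 i a) (t, l) = 'D_1 (fun x => E S x i a) l by [].
under eq_bigr do rewrite dE.
have aR : alpha_R S = fun x => E S x (ih m 0) (ih m 0).
  by apply/funext => x; rewrite floquet_hh mxE.
have aI : alpha_I S = fun x => E S x (ih m 1) (ih m 0).
  by apply/funext => x; rewrite floquet_hh mxE.
have dR : is_derive l (1 : R) (alpha_R S) alpha_R'.
  rewrite /alpha_R' derive1E; apply: derivableP; rewrite aR; exact: (sm_derivable (sE _ _)).
have dI : is_derive l (1 : R) (alpha_I S) alpha_I'.
  rewrite /alpha_I' derive1E; apply: derivableP; rewrite aI; exact: (sm_derivable (sE _ _)).
have dEa a : is_derive l (1 : R) (fun x => E S x i a) ('D_1 (fun x => E S x i a) l).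
  by apply: derivableP; exact: (sm_derivable (sE i a)).
have D1 := is_derive_lincomb (index_enum _) (fun a : 'I_N => avec a s) dEa.
have D2 : is_derive l (1 : R) (fun x => \sum_a avec a s * E S x i a)
    (alpha_R' * avec i s + alpha_I' * avec_dot i s).
  under eq_fun do rewrite E_entry_sum.
  have := is_deriveD (is_deriveZ (avec i s) dR) (is_deriveZ (avec_dot i s) dI).
  rewrite /GRing.scale /= (mulrC (avec i s)) (mulrC (avec_dot i s)).
  suff -> : (fun x => alpha_R S x * avec i s + alpha_I S x * avec_dot i s)
    = avec i s \*: alpha_R S + avec_dot i s \*: alpha_I S by [].
  by apply/funext => x; rewrite mulrC (mulrC (alpha_I S x)).
by rewrite -(@derive_val _ _ _ _ _ _ _ D1) (@derive_val _ _ _ _ _ _ _ D2).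
Qed.

End Coefficients.

Lemma lincomb_entry (R : pzRingType) (n : nat) (g f u v : 'cV[R]_n) (a b c : R) i :
  (g - a *: f - (b *: u + c *: v)) i 0 = g i 0 - a * f i 0 - (b * u i 0 + c * v i 0).
Proof. by rewrite !mxE. Qed.

(** * The asymptotic solution *)

Section Asymptotic.
Context (R : realType) (m : nat) (S : ns_data R m).
Hypothesis hS : neimark_sacker S.
Local Notation N := (ns_dim m).
Local Notation l := (lam_star S).
Local Notation r := (Defs.rad S).
Local Notation om := (om_star S).

Definition vec (z : 'I_N -> R -> R -> R) (t s : R) : 'cV[R]_N := \col_i z i t s.

Definition modal_vec ms (a b : 'I_N -> nat -> R -> R) := vec (fun i => modal ms (a i) (b i)).

Definition dphi ms (a b : 'I_N -> nat -> R -> R) i :=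
  modal ms (fun k t => k%:R * b i k t) (fun k t => - (k%:R * a i k t)).

Lemma a_starE (s : R) (i : 'I_N) : a_star s i 0 = avec i s.
Proof.
have h1 : ih m 1 = lshift (m + 1) ord_max by congr (lshift _ _); exact/val_inj.
by rewrite /avec h1 /a_star /e_1 /e_2 !mxE !andbT.
Qed.

Lemma z_E_entry z2 z3 (e t s : R) i :
  z_E (vec z2) (vec z3) e t s i 0 = avec i s + e * z2 i t s + e ^+ 2 * z3 i t s.
Proof. by rewrite /z_E !mxE -a_starE !mxE. Qed.

Lemma derive1_entry (f : R -> 'cV[R]_N) (f' : 'I_N -> R -> R) t i :
  (forall j, der (fun u => f u j 0) (f' j)) -> derive1 f t i 0 = f' i t.
Proof.
move=> df; have dft : derivable f t 1.
  apply/derivable_mxP => j k; rewrite (ord1 k).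
  by have dfj := df j t; exact: ex_derive.
rewrite derive1E derive_mx // mxE; have dfi := df i t.
exact: derive_val.
Qed.

Lemma der_avec (i : 'I_N) : der (avec (R := R) i) (avec_dot i).
Proof.
have dc : der (fun s : R => cos s) (fun s => - sin s) by move=> s; exact: is_derive_cos.
have ds : der (fun s : R => sin s) (fun s => cos s) by move=> s; exact: is_derive_sin.
apply: derE (derD (derM dc (der_cst (i == ih m 0)%:R)) (derM ds (der_cst (i == ih m 1)%:R))) _ => s.
rewrite /avec_dot; ring.
Qed.

Lemma bdd_avec (i : 'I_N) : bdd (fun _ s : R => avec i s).
Proof.
have bc : bdd (fun _ s : R => cos s) by exists 1 => _ s; exact: cos_max.
have bs : bdd (fun _ s : R => sin s) by exists 1 => _ s; exact: sin_max.
exact: bddD (bddM bc (bdd_cst _)) (bddM bs (bdd_cst _)).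
Qed.

Lemma bdd_avec_dot (i : 'I_N) : bdd (fun _ s : R => avec_dot i s).
Proof.
have bc : bdd (fun _ s : R => cos s) by exists 1 => _ s; exact: cos_max.
have bs : bdd (fun _ s : R => sin s) by exists 1 => _ s; exact: sin_max.
exact: bddD (bddM bc (bdd_cst _)) (bddN (bddM bs (bdd_cst _))).
Qed.

Lemma alpha_R_star : alpha_R S l = 0.
Proof.
have := congr1 (fun M : 'M[R]_N => M (ih m 0) (ih m 0)) (E_at_star (NS_continuation hS)).
by rewrite !floquet_hh !mxE.
Qed.

Lemma alpha_I_star : alpha_I S l = om.
Proof.
have := congr1 (fun M : 'M[R]_N => M (ih m 1) (ih m 0)) (E_at_star (NS_continuation hS)).
by rewrite !floquet_hh !mxE.
Qed.

Section Residual.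
Variables (lam2 om2 eta2 : R) (a2 b2 a2' b2' a3 b3 a3' b3' : 'I_N -> nat -> R -> R).
Hypotheses (sa2 : smooth_family a2) (sb2 : smooth_family b2).
Hypotheses (sa3 : smooth_family a3) (sb3 : smooth_family b3).
Hypotheses (da2 : forall i k, der (a2 i k) (a2' i k)) (db2 : forall i k, der (b2 i k) (b2' i k)).
Hypotheses (da3 : forall i k, der (a3 i k) (a3' i k)) (db3 : forall i k, der (b3 i k) (b3' i k)).
Let z2 i := modal [:: 0; 2]%N (a2 i) (b2 i).
Let z3 i := modal [:: 1; 3]%N (a3 i) (b3 i).
Let dt2 i := modal [:: 0; 2]%N (a2' i) (b2' i).
Let dt3 i := modal [:: 1; 3]%N (a3' i) (b3' i).
Let dp2 := dphi [:: 0; 2]%N a2 b2.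
Let dp3 := dphi [:: 1; 3]%N a3 b3.

(** [eq1] and [eq2] say that the coefficients of [eps] and [eps^2] in the residual vanish. The
    coefficient of order 0 is [E a_star - om a_star_dot], which vanishes by the value of [E] at the
    bifurcation. *)
Hypothesis eq1 : forall i t s,
  \sum_a z2 a t s * E S l i a
  + \sum_a avec a s * (\sum_b avec b s * G2c S i a b (t, l))
  - eta2 * (i == il)%:R - dt2 i t s - om * dp2 i t s = 0.

Hypothesis eq2 : forall i t s,
  \sum_a z3 a t s * E S l i a
  + \sum_a avec a s * (lam2 * 'D_(0, 1) (fun p : R * R => E S p.2 i a) (t, l))
  + eta2 * (\sum_a avec a s * G1c S i a (t, l))
  + \sum_a (avec a s * (\sum_b z2 b t s * G2c S i a b (t, l))
            + z2 a t s * (\sum_b avec b s * G2c S i a b (t, l)))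
  + \sum_a avec a s * (\sum_b avec b s * (\sum_c avec c s * G3c S i a b c (t, l)))
  - dt3 i t s - om * dp3 i t s - om2 * avec_dot i s = 0.

Let zc a e t s := avec a s + e * z2 a t s + e ^+ 2 * z3 a t s.
Let lam e := l + e ^+ 2 * lam2.

Let r0 := r_gt0 hS.

Let jz a : jet (zc a) (fun _ s => avec a s) (z2 a) (z3 a).
Proof.
by apply: jet_poly; [exact: bdd_avec|exact: bdd_modal|exact: bdd_modal].
Qed.

(** The residual with [G] replaced by its expansion through cubic terms; the quartic term would
    already carry [eps^3]. The nested factors [e] match the way jets are shifted. *)
Definition truncation i e t s : R :=
  \sum_a zc a e t s * E S (lam e) i a
  + e * (e * (eta2 * \sum_a zc a e t s * G1c S i a (t, lam e)))
  + e * (\sum_a zc a e t s * \sum_b zc b e t s * G2c S i a b (t, lam e))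
  + e * (e * \sum_a zc a e t s * \sum_b zc b e t s * \sum_c zc c e t s * G3c S i a b c (t, lam e))
  - e * (eta2 * (i == il)%:R)
  - (1 + e * (e * eta2)) * (e * dt2 i t s + e ^+ 2 * dt3 i t s)
  - (om + e ^+ 2 * om2) * (avec_dot i s + e * dp2 i t s + e ^+ 2 * dp3 i t s).

Lemma truncation_bigO i : bigO 3 (truncation i).
Proof.
have jE := jet_sum (index_enum _) (fun a => jetM (jz a) (coef_jet lam2 r0 (coef_E hS i a))).
have jG1 := jet_sum (index_enum _) (fun a => jetM (jz a) (coef_jet lam2 r0 (coef_G1c hS i a))).
have jG2 := jet_sum (index_enum _) (fun a => jetM (jz a) (jet_sum (index_enum _)
  (fun b => jetM (jz b) (coef_jet lam2 r0 (coef_G2c hS i a b))))).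
have jG3 := jet_sum (index_enum _) (fun a => jetM (jz a) (jet_sum (index_enum _)
  (fun b => jetM (jz b) (jet_sum (index_enum _)
  (fun c => jetM (jz c) (coef_jet lam2 r0 (coef_G3c hS i a b c))))))).
have sda2 j k : smper (a2' j k) := smper_derive (sa2 j k) (da2 j k).
have sdb2 j k : smper (b2' j k) := smper_derive (sb2 j k) (db2 j k).
have sda3 j k : smper (a3' j k) := smper_derive (sa3 j k) (da3 j k).
have sdb3 j k : smper (b3' j k) := smper_derive (sb3 j k) (db3 j k).
have bp2 : bdd (dp2 i).
  by apply: bdd_modal => k; [|apply: smperN]; exact: smperZ.
have bp3 : bdd (dp3 i).
  by apply: bdd_modal => k; [|apply: smperN]; exact: smperZ.
have b0 := bdd_cst (0 : R).
have jT := jetM (jet_poly (bdd_cst 1) b0 (bdd_cst eta2))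
  (jet_poly b0 (bdd_modal [:: 0; 2]%N (sda2 i) (sdb2 i)) (bdd_modal [:: 1; 3]%N (sda3 i) (sdb3 i))).
have jP := jetM (jet_poly (bdd_cst om) b0 (bdd_cst om2)) (jet_poly (bdd_avec_dot i) bp2 bp3).
have jeta := jet_eps (jet_cst (bdd_cst (eta2 * (i == il)%:R))).
have J := jetD (jetD (jetD (jetD jE (jet_eps (jet_eps (jetZ eta2 jG1)))) (jet_eps jG2))
  (jet_eps (jet_eps jG3))) (jetN (jetD (jetD jeta jT) jP)).
(* All three coefficients vanish: order 0 by the values of [alpha_R] and [alpha_I] at [l], the
   others by [eq1] and [eq2]. *)
have [_ _ _ O3] : jet (truncation i) (fun _ _ => 0) (fun _ _ => 0) (fun _ _ => 0).
  apply: jet_ext J => [e t s|t s|t s|t s].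
  - rewrite /truncation /lam /dt2 /dt3; ring.
  - rewrite (E_entry_sum S l) alpha_R_star alpha_I_star; ring.
  - rewrite -[RHS](eq1 i t s) -/(dt2 i t s).
    rewrite (eq_bigr (fun a => z2 a t s * E S l i a)); last by move=> a _; ring.
    ring.
  rewrite -[RHS](eq2 i t s) -/(dt3 i t s).
  have -> : \sum_j (avec j s * (lam2 * 'D_(0, 1) (fun p : R * R => E S p.2 i j) (t, l)) +
      z2 j t s * 0 + z3 j t s * E S (t, l).2 i j) = \sum_a z3 a t s * E S l i a
      + \sum_a avec a s * (lam2 * 'D_(0, 1) (fun p : R * R => E S p.2 i a) (t, l)).
    by rewrite -big_split; apply: eq_bigr => j _ /=; ring.
  have -> : \sum_j (avec j s * \sum_b (avec b s * 0 + z2 b t s * G2c S i j b (t, l)) +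
      z2 j t s * \sum_b avec b s * G2c S i j b (t, l)) =
     \sum_a (avec a s * (\sum_b z2 b t s * G2c S i a b (t, l))
            + z2 a t s * (\sum_b avec b s * G2c S i a b (t, l))).
    apply: eq_bigr => j _; congr (_ * _ + _); apply: eq_bigr => b _; ring.
  ring.
by apply: bigO_ext O3 => e t s; ring.
Qed.

Lemma derive1_t_entry e t s i :
  derive1 (fun u => z_E (vec z2) (vec z3) e u s) t i 0 = e * dt2 i t s + e ^+ 2 * dt3 i t s.
Proof.
apply: (derive1_entry (f' := fun j u => e * dt2 j u s + e ^+ 2 * dt3 j u s)) => j.
under eq_fun do rewrite z_E_entry.
have d2 := der_modal_t [:: 0; 2]%N s (da2 j) (db2 j).
have d3 := der_modal_t [:: 1; 3]%N s (da3 j) (db3 j).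
by apply: derE (derD (derD (der_cst (avec j s)) (derZ e d2)) (derZ (e ^+ 2) d3)) _ => u; rewrite add0r.
Qed.

Lemma derive1_s_entry e t s i : derive1 (z_E (vec z2) (vec z3) e t) s i 0
  = avec_dot i s + e * dp2 i t s + e ^+ 2 * dp3 i t s.
Proof.
apply: (derive1_entry (f' := fun j s => avec_dot j s + e * dp2 j t s + e ^+ 2 * dp3 j t s)) => j.
under eq_fun do rewrite z_E_entry.
exact: derD (derD (der_avec j) (derZ e (der_modal_s _ _ _ t))) (derZ (e ^+ 2) (der_modal_s _ _ _ t)).
Qed.

Lemma Gapprox_entry e t s i :
  Gapprox S 4 (z_E (vec z2) (vec z3) e t s) (lam e) (e * eta2) t e i 0
  = \sum_a zc a e t s * E S (lam e) i a
  + e * (e * (eta2 * \sum_a zc a e t s * G1c S i a (t, lam e)))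
  + e * (\sum_a zc a e t s * \sum_b zc b e t s * G2c S i a b (t, lam e))
  + e * (e * \sum_a zc a e t s * \sum_b zc b e t s * \sum_c zc c e t s * G3c S i a b c (t, lam e)).
Proof.
have zE a : z_E (vec z2) (vec z3) e t s a 0 = zc a e t s by exact: z_E_entry.
rewrite /Gapprox big_ltn // big_nat1.
rewrite [LHS]mxE [X in X + _]mxE [X in X + _ + _]mxE [X in _ + X + _]mxE [X in _ + X]mxE.
rewrite [X in _ + (X + _)]mxE [X in _ + (_ + X)]mxE.
have g0 : \sum_j E S (lam e) i j * z_E (vec z2) (vec z3) e t s j 0
  = \sum_a zc a e t s * E S (lam e) i a.
  by apply: eq_bigr => a _; rewrite zE mulrC.
have g1 := Gterm1E S (z_E (vec z2) (vec z3) e t s) (lam e) t i.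
have g2 := Gterm2E hS (z_E (vec z2) (vec z3) e t s) (lam e) t i.
have g3 := Gterm3E hS (z_E (vec z2) (vec z3) e t s) (lam e) t i.
rewrite (eq_bigr _ (fun a _ => congr1 ( *%R^~ (G1c S i a (t, lam e))) (zE a))) in g1.
have h2 a : \sum_b z_E (vec z2) (vec z3) e t s b 0 * G2c S i a b (t, lam e)
  = \sum_b zc b e t s * G2c S i a b (t, lam e).
  by apply: eq_bigr => b _; rewrite zE.
rewrite (eq_bigr _ (fun a _ => congr2 *%R (zE a) (h2 a))) in g2.
have h3 a b : \sum_c z_E (vec z2) (vec z3) e t s c 0 * G3c S i a b c (t, lam e)
  = \sum_c zc c e t s * G3c S i a b c (t, lam e).
  by apply: eq_bigr => c _; rewrite zE.
have h4 a : \sum_b z_E (vec z2) (vec z3) e t s b 0 *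
    \sum_c z_E (vec z2) (vec z3) e t s c 0 * G3c S i a b c (t, lam e)
  = \sum_b zc b e t s * \sum_c zc c e t s * G3c S i a b c (t, lam e).
  by apply: eq_bigr => b _; exact: (congr2 *%R (zE b) (h3 a b)).
rewrite (eq_bigr _ (fun a _ => congr2 *%R (zE a) (h4 a))) in g3.
rewrite g0 [in LHS](congr1 (fun x => _ * x) g1) (congr1 (fun x => _ * x) g2) (congr1 (fun x => _ * x) g3).
move: (\sum_a _) (\sum_a _) (\sum_a _) (\sum_a _) => X0 X1 X2 X3 /=.
rewrite expr1; ring.
Qed.

(** The residual is the error in the expansion of [G] plus [truncation], each of order [eps^3]
    uniformly on the torus. [B] bounds the approximate solution, and the smallness of [eps] relative
    to [lam2] keeps [lam] within reach of the estimate for [G]. *)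
Lemma asymptotic_equation_modal :
  asymptotic_equation S lam2 om2 eta2 (vec z2) (vec z3).
Proof.
have [B [d1 [B0 d10 zB]]] := bigO_sum_norm (index_enum _) (fun a => jet_bigO (jz a)).
have [C [d2 [C0 d20 _ _ GP]]] := G_approx_bound hS 2 B.
have [D [d3 [D0 d30 TP]]] := bigO_sum_norm (index_enum _) truncation_bigO.
exists (C + D).
have l0 : 0 < d2 / (1 + `|lam2|) by rewrite divr_gt0 // ltr_wpDr.
near=> e => t s.
have e0 : 0 < `|e| by rewrite normr_gt0; near: e; exact: nbhs_dnbhs_neq.
have e1 : `|e| < d1 by near: e; exact: dnbhs0_lt.
have e2 : `|e| < d2 by near: e; exact: dnbhs0_lt.
have e3 : `|e| < d3 by near: e; exact: dnbhs0_lt.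
have e4 : `|e| < 1 by near: e; exact: dnbhs0_lt.
have e5 : `|e| < d2 / (1 + `|lam2|) by near: e; exact: dnbhs0_lt.
have zle : `|z_E (vec z2) (vec z3) e t s| <= B.
  apply: mx_norm_le => // a k; rewrite (ord1 k) z_E_entry -/(zc a e t s).
  have := zB e t s; rewrite e0 e1 expr0 mulr1 => /(_ isT); apply: le_trans.
  rewrite [leRHS]ger0_norm; last by apply: sumr_ge0.
  by rewrite (bigD1 a) //= lerDl; apply: sumr_ge0.
have lamd : `|l + e ^+ 2 * lam2 - l| < d2.
  rewrite addrAC subrr add0r normrM normrX; apply: le_lt_trans (_ : `|e| * (1 + `|lam2|) < d2).
    rewrite expr2 -mulrA ler_wpM2l // (le_trans (y := 1 * `|lam2|)) //.
      by rewrite ler_wpM2r // ltW.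
    by rewrite mul1r lerDr.
  by rewrite -ltr_pdivlMr // ltr_wpDr.
have e02 : 0 < `|e| < d2 by rewrite e0.
have Gb := GP _ _ (e * eta2) t e zle lamd e02.
apply: mx_norm_le => [|i j]; first by rewrite mulr_ge0 ?addr_ge0 ?exprn_ge0.
rewrite (ord1 j).
have -> : residual S (z_E (vec z2) (vec z3) e) (l + e ^+ 2 * lam2) (om + e ^+ 2 * om2)
    (e * eta2) e t s i 0 = (G S (z_E (vec z2) (vec z3) e t s) (l + e ^+ 2 * lam2) (e * eta2) t e
      - Gapprox S 4 (z_E (vec z2) (vec z3) e t s) (l + e ^+ 2 * lam2) (e * eta2) t e) i 0
    + truncation i e t s.
  rewrite [X in _ = X + _]mxE [X in _ = _ + X + _]mxE -/(lam e) Gapprox_entry /truncation /residual.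
  rewrite lincomb_entry derive1_t_entry derive1_s_entry.
  have -> : e_n i 0 = (i == il)%:R :> R by rewrite mxE andbT.
  move: (G _ _ _ _ _ _ _ _) (\sum_a _) (\sum_a _) (\sum_a _) (\sum_a _) => g X0 X1 X2 X3.
  move: (dt2 _ _ _) (dt3 _ _ _) (dp2 _ _ _) (dp3 _ _ _) => ? ? ? ?; ring.
rewrite mulrDl; apply: le_trans (ler_normD _ _) _; apply: lerD.
  exact: le_trans (mx_entry_le _ i 0) Gb.
have := TP e t s; rewrite e0 e3 => /(_ isT); apply: le_trans.
have -> : `|truncation i e t s| = `| `|truncation i e t s| | by rewrite normr_id.
rewrite [leRHS]ger0_norm; last by apply: sumr_ge0.
by rewrite normr_id (bigD1 i) //= lerDl; apply: sumr_ge0.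
Unshelve. all: by end_near. Qed.

End Residual.
End Asymptotic.

Section Existence.
Context (R : realType) (m : nat) (S : ns_data R m).
Hypothesis hS : neimark_sacker S.
Hypothesis no_resonance_3 : om_star S != 3^-1.
Hypothesis no_resonance_4 : om_star S != 4^-1.
Local Notation N := (ns_dim m).
Local Notation l := (lam_star S).
Local Notation om := (om_star S).

Let ll : `|l - l| < Defs.rad S.
Proof. by rewrite subrr normr0; exact: r_gt0. Qed.

Lemma Mod_fst (f : R -> R) : smper f -> Mod [:: 0; 2]%N (fun t _ => f t).
Proof.
(* The constant 1 is written as [cos^2 + sin^2], a quadratic form in the first harmonics. *)
move=> sf; have one := Mod_quadratic (1 : R) 0 1 0; have two := Mod_quadratic (0 : R) 1 0 1.
apply: Mod_ext (ModZ sf (ModD one two)) => t s.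
rewrite !mulr1 !mulr0 addr0 add0r -!expr2 cos2Dsin2; ring.
Qed.

Lemma Mod_avec2 (a b : 'I_N) (g : R -> R) : smper g ->
  Mod [:: 0; 2]%N (fun t s => avec a s * (avec b s * g t)).
Proof.
move=> sg; have := ModZ sg (Mod_quadratic (a == ih m 0)%:R (a == ih m 1)%:R (b == ih m 0)%:R (b == ih m 1)%:R).
by apply: Mod_ext => t s; rewrite /avec; ring.
Qed.

Lemma modal_solution : exists (lam2 om2 eta2 : R) (a2 b2 a3 b3 : 'I_N -> nat -> R -> R),
  [/\ [/\ smooth_family a2, smooth_family b2, smooth_family a3 & smooth_family b3],
      asymptotic_equation S lam2 om2 eta2
        (modal_vec [:: 0; 2]%N a2 b2) (modal_vec [:: 1; 3]%N a3 b3),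
      smper0 (a2 il 0%N),
      smper0 (fun t => a3 (ih m 0) 1%N t + b3 (ih m 1) 1%N t) &
      smper0 (fun t => a3 (ih m 1) 1%N t - b3 (ih m 0) 1%N t)].
Proof.
have /andP[om0 om2] := om_star_bounds (NS_floquet hS).
have hyp := Etilde_star_hyperbolic (NS_floquet hS).
have EE : E S l = floquet_block (rot_block 0 om) (Etilde_star S) :=
  E_at_star (NS_continuation hS).
have s1 i a : smper (fun t => G1c S i a (t, l)) := coef_smper (coef_G1c hS i a) ll.
have s2 i a b : smper (fun t => G2c S i a b (t, l)) := coef_smper (coef_G2c hS i a b) ll.
have s3 i a b c : smper (fun t => G3c S i a b c (t, l)) := coef_smper (coef_G3c hS i a b c) ll.
pose f1 i t s : R := \sum_a avec a s * (\sum_b avec b s * G2c S i a b (t, l)).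
have Mf1 i : Mod [:: 0; 2]%N (f1 i).
  apply: Mod_sum => a; apply: Mod_ext (Mod_sum (index_enum _) (fun b => Mod_avec2 a b (s2 i a b))) => t s.
  by rewrite mulr_sumr.
have [eta2 [a2 [b2 [a2' [b2' [[sa2 sb2] [da2 db2] z2P eq1]]]]]] :=
  order1 om0 om2 no_resonance_3 no_resonance_4 hyp Mf1.
pose z2 i := modal [:: 0; 2]%N (a2 i) (b2 i).
have Mz2 i : Mod [:: 0; 2]%N (z2 i) by exists (a2 i), (b2 i).
(* The forcing at order [eps^2] apart from [lam2] and [om2]: the [eta2]-term, the quadratic form
   polarized between [a_star] and [z2], and the cubic term. Each is a first harmonic times modes 0
   and 2. *)
pose f2 i t s : R := eta2 * (\sum_a avec a s * G1c S i a (t, l))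
  + \sum_a (avec a s * (\sum_b z2 b t s * G2c S i a b (t, l))
            + z2 a t s * (\sum_b avec b s * G2c S i a b (t, l)))
  + \sum_a avec a s * (\sum_b avec b s * (\sum_c avec c s * G3c S i a b c (t, l))).
have Mf2 i : Mod [:: 1; 3]%N (f2 i).
  apply: ModD; first apply: ModD.
  - apply: ModZ (smper_cst eta2) _; apply: Mod_sum => a; exact: Mod_avec (Mod_fst (s1 i a)).
  - apply: Mod_sum => a; apply: ModD.
      apply: Mod_avec; apply: Mod_sum => b; apply: Mod_ext (ModZ (s2 i a b) (Mz2 b)) => t s.
      by rewrite mulrC.
    apply: Mod_ext (Mod_sum (index_enum _) (fun b => Mod_avec b (ModZ (s2 i a b) (Mz2 a)))) => t s.
    rewrite mulr_sumr; apply: eq_bigr => b _; ring.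
  - apply: Mod_sum => a; apply: Mod_avec; apply: Mod_sum => b.
    apply: Mod_ext (Mod_sum (index_enum _) (fun c => Mod_avec2 b c (s3 i a b c))) => t s.
    by rewrite mulr_sumr.
have [p [q [a3 [b3 [a3' [b3' [[sa3 sb3] [da3 db3] [z3P z3P'] eq2]]]]]]] :=
  order2 om0 om2 no_resonance_3 no_resonance_4 hyp Mf2.
have tr := NS_transversality hS.
(* With primes for [lam]-derivatives, the parameters must satisfy [lam2 (alpha_R' a_star + alpha_I'
   a_star_dot) - om2 a_star_dot = p a_star + q a_star_dot]. Transversality allows division by
   [alpha_R'], and the second component then gives [om2]. *)
exists (p / derive1 (alpha_R S) l),
  (p / derive1 (alpha_R S) l * derive1 (alpha_I S) l - q), eta2, a2, b2, a3, b3; split => //.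
apply: asymptotic_equation_modal sa2 sb2 sa3 sb3 da2 db2 da3 db3 _ _ => // i t s.
  rewrite -[RHS](eq1 i t s) EE -/(f1 i t s) /dphi -/(z2 i t s).
  rewrite (eq_bigr _ (fun a _ => mulrC (z2 a t s) _)).
  by rewrite /z2 [in RHS]addrA.
rewrite -[RHS](eq2 i t s) EE /dphi.
rewrite (eq_bigr _ (fun a _ => mulrC (modal [:: 1; 3]%N (a3 a) (b3 a) t s) _)).
have dE x : \sum_a avec a s * (x * 'D_(0, 1) (fun p : R * R => E S p.2 i a) (t, l))
  = x * (derive1 (alpha_R S) l * avec i s + derive1 (alpha_I S) l * avec_dot i s).
  by rewrite -(derive_E_sum hS t) mulr_sumr; apply: eq_bigr => a _; rewrite mulrCA.
rewrite dE /f2 /z2.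
move: (\sum_j _) (\sum_j _) (\sum_j _) (\sum_j _) (modal _ _ _ _ _) (modal _ _ _ _ _) => *.
by field.
Qed.

End Existence.

(** * Amplitude and phase conditions *)

Section Means.
Context (R : realType).
Implicit Types (f g : R -> R).

Definition mean f : R :=
  (2 * pi)^-1 * \int[lebesgue_measure]_(t in `[0, 2 * pi]) f t.

Let pi0 : 2 * pi != 0 :> R.
Proof. by rewrite mulf_neq0 // gt_eqF // pi_gt0. Qed.

Lemma mean_eq f g : (forall t, f t = g t) -> mean f = mean g.
Proof. by move=> fg; congr mean; apply/funext. Qed.

Lemma mean_lincomb (J : Type) (r : seq J) (c : J -> R) (f : J -> R -> R) :
  (forall j, continuous (f j)) ->
  mean (fun t => \sum_(j <- r) c j * f j t) = \sum_(j <- r) c j * mean (f j).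
Proof.
move=> cf.
have csum s : continuous (fun t => \sum_(j <- s) c j * f j t).
  elim: s => [|j s IH] t; first by under eq_fun do rewrite big_nil; exact: cvg_cst.
  under eq_fun do rewrite big_cons.
  by apply: cvgD; [apply: cvgMr; exact: cf|exact: IH].
elim: r => [|j r IH].
  under mean_eq do rewrite big_nil.
  by rewrite /mean Rintegral_cst // mul0r mulr0 big_nil.
under mean_eq do rewrite big_cons.
rewrite big_cons -IH /mean RintegralD //; last 2 first.
- by apply: continuous_integrable_segment => t; apply: cvgMr; exact: cf.
- exact: continuous_integrable_segment.
rewrite mulrDr RintegralZl //; first by rewrite mulrCA.
exact: continuous_integrable_segment.
Qed.

Lemma mean_der f g : der f g -> continuous g -> Defs.periodic f -> mean g = 0.
Proof.
move=> df cg pf; have p2 : 0 < 2 * pi :> R by rewrite mulr_gt0 // pi_gt0.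
have cf : continuous f.
  by move=> t; apply/differentiable_continuous/derivable1_diffP; have dft := df t; exact: ex_derive.
rewrite /mean /Rintegral (@continuous_FTC2 R g f) //.
- by rewrite -EFinB /= -[X in f X]add0r pf subrr mulr0.
- exact: continuous_subspaceT.
- split.
  + by move=> t _; have dft := df t; exact: ex_derive.
  + exact/cvg_at_right_filter/cf.
  + exact/cvg_at_left_filter/cf.
- by move=> t _; rewrite derive1E; have dft := df t; rewrite derive_val.
Qed.

Lemma mean_smper0 f : smper0 f -> mean f = 0.
Proof.
move=> sf; have [H [_ pH] dH] := sf; apply: mean_der dH _ pH => t.
by apply: (sm_cont (smper0_smper sf).1).
Qed.

Lemma mean_cst (a : R) : mean (fun=> a) = a.
Proof.
rewrite /mean Rintegral_cst //= lebesgue_measure_itv.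
rewrite /= lte_fin mulr_gt0 ?pi_gt0 //.
by rewrite oppr0 adde0 /= mulrCA mulVf // mulr1.
Qed.

Lemma mean_cos (n : int) : mean (fun t => cos (n%:~R * t)) = (n == 0)%:R.
Proof.
have [->|n0] := eqVneq n 0.
  by under mean_eq do rewrite mul0r cos0; exact: mean_cst.
have ni : n%:~R != 0 :> R by rewrite intr_eq0.
apply: (@mean_der (fun t => n%:~R^-1 * sin (n%:~R * t))).
- by apply: derE (derZ _ (der_sinM n%:~R)) _ => t; rewrite mulrA mulVf // mul1r.
- by move=> t; apply: (sm_cont (sm_cosM_sinM n%:~R).1).
- move=> t; rewrite mulrDr mulrC [n%:~R * (2 * pi)]mulrC.
  by rewrite (periodic_int n _ (@sin_periodic R)) mulrC.
Qed.

Lemma mean_sin (n : int) : mean (fun t => sin (n%:~R * t)) = 0.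
Proof.
have [->|n0] := eqVneq n 0.
  by under mean_eq do rewrite mul0r sin0; exact: mean_cst.
have ni : n%:~R != 0 :> R by rewrite intr_eq0.
apply: (@mean_der (fun t => - n%:~R^-1 * cos (n%:~R * t))).
- by apply: derE (derZ _ (der_cosM n%:~R)) _ => t; rewrite mulrNN mulrA mulVf // mul1r.
- by move=> t; apply: (sm_cont (sm_cosM_sinM n%:~R).2).
- move=> t; rewrite mulrDr mulrC [n%:~R * (2 * pi)]mulrC.
  by rewrite (periodic_int n _ (@cos_periodic R)) mulrC.
Qed.

Definition trig (x : bool * 'I_4) (s : R) : R :=
  if x.1 then sin (x.2%:R * s) else cos (x.2%:R * s).

Lemma trig_continuous x : continuous (trig x).
Proof.
case: x => -[] k t; rewrite /trig /=.
  by apply: (sm_cont (sm_cosM_sinM k%:R).2).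
by apply: (sm_cont (sm_cosM_sinM k%:R).1).
Qed.

Lemma mean_trig x : mean (trig x) = (x == (false, ord0))%:R.
Proof.
case: x => -[] k; first exact: (mean_sin k).
exact: (mean_cos k).
Qed.

(** Product-to-sum produces the frequencies [k + 1] and [k - 1]. Only the second can be zero,
    precisely for [k = 1], and only a cosine of frequency zero has nonzero mean. *)
Lemma mean_trig1 x b :
  mean (fun s => trig x s * trig (b, inord 1) s) = 2^-1 * (x == (b, inord 1))%:R.
Proof.
case: x => c k.
have kE : ((k == inord 1) = (k%:Z - 1 == 0)).
  by rewrite subr_eq0 -val_eqE /= inordK.
have k1 : (k%:Z + 1 == 0) = false by rewrite -PoszD addn1.
have E s : (inord 1 : 'I_4)%:R * s = s :> R by rewrite inordK // mul1r.
have [p q] : (forall s : R, (k%:Z + 1)%:~R * s = k%:R * s + s) /\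
   (forall s : R, (k%:Z - 1)%:~R * s = k%:R * s - s).
  split => s; first by rewrite intrD mulrDl mul1r.
  by rewrite intrB mulrBl mul1r.
pose tp (a : bool) s : R := if a then sin ((k%:Z + 1)%:~R * s) else cos ((k%:Z + 1)%:~R * s).
pose tm (a : bool) s : R := if a then sin ((k%:Z - 1)%:~R * s) else cos ((k%:Z - 1)%:~R * s).
have lin (d e : bool) (u v : R) : mean (fun s => u * tp d s + v * tm e s)
  = u * (~~ d && (k%:Z + 1 == 0))%:R + v * (~~ e && (k%:Z - 1 == 0))%:R.
  have ct x : continuous (fun s : R => if x.1 then tp x.2 s else tm x.2 s).
    case: x => -[] -[] t; rewrite /tp /tm /=;
      first [apply: (sm_cont (sm_cosM_sinM _).2)|apply: (sm_cont (sm_cosM_sinM _).1)]; exact: I.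
  have := mean_lincomb [:: (true, d); (false, e)] (fun x : bool * bool => if x.1 then u else v) ct.
  under mean_eq do rewrite !big_cons big_nil addr0 /=.
  move=> ->; rewrite !big_cons big_nil addr0 /=.
  congr (_ * _ + _ * _).
    by case: d; [exact: mean_sin|exact: mean_cos].
  by case: e; [exact: mean_sin|exact: mean_cos].
have xE : ((c, k) == (b, inord 1)) = (c == b) && (k%:Z - 1 == 0) by rewrite -kE.
rewrite xE; transitivity (mean (fun s => (if c && b then - 2^-1 else 2^-1) * tp (c != b) s
    + (if ~~ c && b then - 2^-1 else 2^-1) * tm (c != b) s)).
  apply: mean_eq => s; rewrite /trig /tp /tm /= E p q.
  by case: (c); case: (b); rewrite /= ?cosD ?sinD ?cosN ?sinN; field.
by rewrite lin k1 andbF mulr0 add0r; case: (c); case: (b) => /=; rewrite ?mulr0.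
Qed.

End Means.

(** * Inner products of trigonometric polynomials *)

Section Inner.
Context (R : realType) (n : nat).
Implicit Types (f g : R -> 'cV[R]_n) (a b : nat -> R -> 'cV[R]_n).

Definition entries_continuous f := forall i, continuous (fun t => f t i 0).

Lemma smooth_circle_entries f : smooth_circle f -> entries_continuous f.
Proof.
case=> _ /(smooth_on_entriesP _ (@openT R)) sf i t; exact: (sm_cont (sf i 0)).
Qed.

Lemma inner1E f u : entries_continuous f ->
  inner1 f (fun=> u) = \sum_i u i 0 * mean (fun t => f t i 0).
Proof.
move=> cf; rewrite -(@mean_lincomb R _ _ (fun i => u i 0) (fun i t => f t i 0)) //.
by apply: mean_eq => t; apply: eq_bigr => i _; rewrite mulrC.
Qed.

Lemma entries_continuous_dot f u : entries_continuous f -> continuous (fun t => dot (f t) u).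
Proof.
move=> cf t; rewrite /dot.
apply: (@cvg_sum R) => i; apply: cvgMl; exact: cf.
Qed.

Definition fourier a b (t s : R) : 'cV[R]_n :=
  \sum_(k < 4) (cos (k%:R * s) *: a k t + sin (k%:R * s) *: b k t).

Let A a b (x : bool * 'I_4) := if x.1 then b (x.2 : nat) else a (x.2 : nat).

Lemma fourierE a b t s : fourier a b t s = \sum_x trig x s *: A a b x t.
Proof.
rewrite -(pair_bigA _ (fun c k => trig (c, k) s *: A a b (c, k) t)) /=.
rewrite big_bool /= /fourier big_split /= addrC; congr (_ + _).
Qed.

Lemma sumZ_entry (I : finType) (c : I -> R) (f : I -> 'cV[R]_n) k :
  (\sum_i c i *: f i) k 0 = \sum_i c i * f i k 0.
Proof. by elim/big_rec2: _ => [|i x u _ IH]; rewrite !mxE // IH. Qed.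

Lemma dot_sums (I J : finType) (c : I -> R) (f : I -> 'cV[R]_n) (d : J -> R) (u : J -> 'cV[R]_n) :
  dot (\sum_i c i *: f i) (\sum_j d j *: u j) = \sum_(p : I * J) (c p.1 * d p.2) * dot (f p.1) (u p.2).
Proof.
rewrite -(pair_bigA _ (fun i j => (c i * d j) * dot (f i) (u j))) /= /dot.
rewrite (eq_bigr _ (fun i _ => congr2 *%R (sumZ_entry c f i) (sumZ_entry d u i))).
under eq_bigr do rewrite big_distrlr /=.
rewrite exchange_big; apply: eq_bigr => i _; rewrite exchange_big; apply: eq_bigr => j _.
rewrite mulr_sumr; apply: eq_bigr => k _; ring.
Qed.

(** For fixed [phi] the integral in [theta] is a combination of the functions [trig x * V y] with
    constant coefficients, so the iterated integral is evaluated as it stands, with no exchange of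
    the order of integration. *)
Lemma inner2_fourier a b (J : finType) (V : J -> R -> R) (U : J -> 'cV[R]_n) z w :
  (forall k, entries_continuous (a k)) -> (forall k, entries_continuous (b k)) ->
  (forall y, continuous (V y)) ->
  (forall t s, z t s = fourier a b t s) -> (forall t s, w t s = \sum_y V y s *: U y) ->
  inner2 z w = \sum_x \sum_y mean (fun s => trig x s * V y s) * inner1 (A a b x) (fun=> U y).
Proof.
move=> ca cb cV zE wE; have pi0 : 2 * pi != 0 :> R by rewrite mulf_neq0 // gt_eqF // pi_gt0.
have cA x : entries_continuous (A a b x) by case: x => -[] k; rewrite /A /=.
pose f (p : (bool * 'I_4) * J) s := trig p.1 s * V p.2 s.
have cf p : continuous (f p).
  by move=> s; apply: cvgM; [exact: trig_continuous|exact: cV].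
have unmean (h : R -> R) : \int[lebesgue_measure]_(t in `[0, 2 * pi]) h t = 2 * pi * mean h.
  by rewrite /mean mulrA divff // mul1r.
have inE s : \int[lebesgue_measure]_(t in `[0, 2 * pi]) dot (z t s) (w t s)
  = \sum_p (2 * pi * inner1 (A a b p.1) (fun=> U p.2)) * f p s.
  rewrite unmean.
  have -> : mean (fun t => dot (z t s) (w t s)) = \sum_p f p s * inner1 (A a b p.1) (fun=> U p.2).
    rewrite -(@mean_lincomb R _ _ (fun p => f p s) (fun p t => dot (A a b p.1 t) (U p.2))).
      by apply: mean_eq => t; rewrite zE wE fourierE dot_sums.
    by move=> p; apply: entries_continuous_dot.
  by rewrite mulr_sumr; apply: eq_bigr => p _; rewrite [f p s * _]mulrC mulrA.
rewrite /inner2.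
under eq_Rintegral do rewrite inE.
rewrite unmean mean_lincomb //.
rewrite (pair_bigA _ (fun x y => mean (fun s => trig x s * V y s) * inner1 (A a b x) (fun=> U y))) /=.
rewrite !mulr_sumr; apply: eq_bigr => p _; rewrite /f.
move: (2 * pi) pi0 (inner1 _ _) (mean _) => c c0 x y; by field.
Qed.

Lemma inner1_lin c f g e u : entries_continuous f -> entries_continuous g ->
  inner1 (fun t => c + e *: f t + e ^+ 2 *: g t) (fun=> u)
  = inner1 (fun=> c) (fun=> u) + e * inner1 f (fun=> u) + e ^+ 2 * inner1 g (fun=> u).
Proof.
move=> cf cg.
pose h (k : nat) t := match k with 0%N => dot c u | 1%N => dot (f t) u | _ => dot (g t) u end.
pose x (k : nat) := match k with 0%N => 1 | 1%N => e | _ => e ^+ 2 end.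
have ch k : continuous (h k).
  by case: k => [|[|k]]; rewrite /h; [move=> t; exact: cvg_cst|exact: entries_continuous_dot..].
have := mean_lincomb [:: 0%N; 1%N; 2%N] x ch.
rewrite !big_cons big_nil /= addr0 mul1r addrA => <-.
apply: mean_eq => t; rewrite !big_cons big_nil /= /dot addr0 mul1r !mulr_sumr -!big_split.
by apply: eq_bigr => i _; rewrite !mxE /=; ring.
Qed.

Lemma fourier_lin a b a' b' a'' b'' e t s :
  fourier a b t s + e *: fourier a' b' t s + e ^+ 2 *: fourier a'' b'' t s
  = fourier (fun k t => a k t + e *: a' k t + e ^+ 2 *: a'' k t)
      (fun k t => b k t + e *: b' k t + e ^+ 2 *: b'' k t) t s.
Proof.
rewrite /fourier !scaler_sumr -!big_split; apply: eq_bigr => k _ /=.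
by apply/matrixP => i j; rewrite !mxE; ring.
Qed.

End Inner.

(** * Amplitude and phase conditions for the ansatz *)

Section Conditions.
Context (R : realType) (m : nat).
Local Notation N := (ns_dim m).
Implicit Types (a b : nat -> R -> 'cV[R]_N) (z w : R -> R -> 'cV[R]_N) (u : 'cV[R]_N).

Lemma inner2_mode1 a b u u' z w :
  (forall k, entries_continuous (a k)) -> (forall k, entries_continuous (b k)) ->
  (forall t s, z t s = fourier a b t s) -> (forall t s, w t s = cos s *: u + sin s *: u') ->
  inner2 z w = 2^-1 * (inner1 (a 1%N) (fun=> u) + inner1 (b 1%N) (fun=> u')).
Proof.
move=> ca cb zE wE.
pose V (y : bool) := trig (R := R) (y, inord 1); pose U (y : bool) := if y then u' else u.
have V1 s : (inord 1 : 'I_4)%:R * s = s :> R by rewrite inordK // mul1r.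
rewrite (inner2_fourier (V := V) (U := U) ca cb _ zE); last 2 first.
- by move=> y; exact: trig_continuous.
- by move=> t s; rewrite big_bool wE /V /U /trig /= V1 addrC.
rewrite exchange_big big_bool mulrDr addrC /=; congr (_ + _).
  rewrite (bigD1 (true, inord 1)) //= big1 => [|x /negPf xE]; last first.
    by rewrite mean_trig1 xE mulr0 mul0r.
  by rewrite mean_trig1 eqxx mulr1 addr0 inordK.
rewrite (bigD1 (false, inord 1)) //= big1 => [|x /negPf xE]; last first.
  by rewrite mean_trig1 xE mulr0 mul0r.
by rewrite mean_trig1 eqxx mulr1 addr0 inordK.
Qed.

Lemma inner2_mode0 a b u z w :
  (forall k, entries_continuous (a k)) -> (forall k, entries_continuous (b k)) ->
  (forall t s, z t s = fourier a b t s) -> (forall t s, w t s = u) ->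
  inner2 z w = inner1 (a 0%N) (fun=> u).
Proof.
move=> ca cb zE wE.
rewrite (inner2_fourier (V := fun (_ : unit) (_ : R) => 1) (U := fun=> u) ca cb _ zE); last 2 first.
- by move=> y s; exact: cvg_cst.
- by move=> t s; rewrite big_const card_unit /= scale1r addr0.
have tE x : \sum_(y : unit) mean (fun s : R => trig x s * 1) *
    inner1 (if x.1 then b x.2 else a x.2) (fun=> u)
  = (x == (false, ord0))%:R * inner1 (if x.1 then b x.2 else a x.2) (fun=> u).
  rewrite big_const card_unit /= addr0 -mean_trig.
  by congr (_ * _); apply: mean_eq => s; rewrite mulr1.
rewrite (eq_bigr _ (fun x _ => tE x)) (bigD1 (false, ord0)) //= big1 => [|x /negPf xE].
  by rewrite mul1r addr0.
by rewrite xE mul0r.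
Qed.

Lemma inner1_cst (c u : 'cV[R]_N) : inner1 (fun=> c) (fun=> u) = dot c u.
Proof. exact: mean_cst. Qed.

Lemma inner1_0 u : inner1 (fun=> 0) (fun=> u) = 0 :> R.
Proof. by rewrite inner1_cst /dot big1 // => i _; rewrite mxE mul0r. Qed.

Lemma dot_delta (c : 'cV[R]_N) i : dot c (delta_mx i 0) = c i 0.
Proof.
rewrite /dot (bigD1 i) //= big1 => [|j /negPf ji]; first by rewrite mxE !eqxx mulr1 addr0.
by rewrite mxE ji mulr0.
Qed.

Lemma dotN (c u : 'cV[R]_N) : dot c (- u) = - dot c u.
Proof. by rewrite /dot -sumrN; apply: eq_bigr => i _; rewrite !mxE mulrN. Qed.

Lemma inner1N (f : R -> 'cV[R]_N) u : entries_continuous f ->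
  inner1 f (fun=> - u) = - inner1 f (fun=> u).
Proof.
by move=> cf; rewrite !inner1E // -sumrN; apply: eq_bigr => i _; rewrite mxE mulNr.
Qed.

Lemma inner1Z (f : R -> 'cV[R]_N) u (c : R) : entries_continuous f ->
  inner1 (fun t => c *: f t) (fun=> u) = c * inner1 f (fun=> u).
Proof.
move=> cf; have c0 : entries_continuous (fun _ : R => 0 : 'cV[R]_N) by move=> i t; exact: cvg_cst.
have := inner1_lin 0 c u cf c0; rewrite !inner1_0 add0r mulr0 addr0 => <-.
by apply: mean_eq => t; rewrite add0r scaler0 addr0.
Qed.

Lemma smooth_circle_cst (c : 'cV[R]_N) : smooth_circle (fun=> c).
Proof.
by split => //; apply/(smooth_on_entriesP _ (@openT R)) => i j; exact: sm_cst.
Qed.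

Lemma sum_modes_fourier ms a b t s : uniq ms -> all (fun k => k < 4)%N ms ->
  \sum_(k <- ms) (cos (k%:R * s) *: a k t + sin (k%:R * s) *: b k t)
  = fourier (fun k => if k \in ms then a k else fun=> 0)
      (fun k => if k \in ms then b k else fun=> 0) t s.
Proof.
move=> ums ltms.
rewrite /fourier -(big_mkord xpredT (fun k => cos (k%:R * s) *: (if k \in ms then a k else fun=> 0) t
  + sin (k%:R * s) *: (if k \in ms then b k else fun=> 0) t)).
transitivity (\sum_(0 <= k < 4 | k \in ms) (cos (k%:R * s) *: a k t + sin (k%:R * s) *: b k t)).
  rewrite -[RHS]big_filter; apply: perm_big; apply: uniq_perm => //.
    by rewrite filter_uniq // iota_uniq.
  move=> k; rewrite mem_filter mem_index_iota /=.
  by case kms : (k \in ms) => //=; rewrite (allP ltms).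
rewrite [LHS]big_mkcond; apply: eq_bigr => k _.
by case: ifP => //; rewrite !scaler0 addr0.
Qed.

Lemma only_modes_fourier ms z : uniq ms -> all (fun k => k < 4)%N ms -> only_modes ms z ->
  exists a b, [/\ forall k, smooth_circle (a k), forall k, smooth_circle (b k),
    forall k, k \notin ms -> a k = (fun=> 0) /\ b k = (fun=> 0) &
    forall t s, z t s = fourier a b t s].
Proof.
move=> ums ltms [a [b [sab zE]]].
exists (fun k => if k \in ms then a k else fun=> 0), (fun k => if k \in ms then b k else fun=> 0).
split => [k|k|k /negPf -> //|t s].
- by case: ifP => _; [exact: (sab k).1|exact: smooth_circle_cst].
- by case: ifP => _; [exact: (sab k).2|exact: smooth_circle_cst].
by rewrite zE sum_modes_fourier.
Qed.

Let a0 (c : 'cV[R]_N) (k : nat) : R -> 'cV[R]_N := fun=> (k == 1)%N%:R *: c.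

Lemma a_star_fourier t s : a_star s = fourier (a0 e_1) (a0 e_2) t s.
Proof.
rewrite /fourier !big_ord_recl big_ord0 /a0 /= !scale0r !scale1r !scaler0 !add0r !addr0 mul1r.
by [].
Qed.

Section Ansatz.
Variables (z2 z3 : R -> R -> 'cV[R]_N).
Hypothesis hz : ansatz_form z2 z3.

Lemma ansatz_fourier : exists a2 b2 a3 b3, [/\
  [/\ forall k, smooth_circle (a2 k), forall k, smooth_circle (b2 k),
      forall k, smooth_circle (a3 k) & forall k, smooth_circle (b3 k)],
  [/\ a2 1%N = (fun=> 0), b2 1%N = (fun=> 0) & a3 0%N = (fun=> 0)],
  forall t s, z2 t s = fourier a2 b2 t s & forall t s, z3 t s = fourier a3 b3 t s].
Proof.
have [_ _ m2 m3] := hz.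
have [a2 [b2 [sa2 sb2 n2 z2E]]] := only_modes_fourier (ms := [:: 0; 2]%N) isT isT m2.
have [a3 [b3 [sa3 sb3 n3 z3E]]] := only_modes_fourier (ms := [:: 1; 3]%N) isT isT m3.
have [a21 b21] := n2 1%N isT; have [a30 _] := n3 0%N isT.
by exists a2, b2, a3, b3; split.
Qed.

Let X := inner2 z3 (fun _ phi => a_star phi).
Let Y := inner2 z3 (fun _ phi => a_star_dot phi).
Let Z := inner2 z2 (fun _ _ => e_n).

(** [z2] has no mode 1 and [z3] no mode 0, while [a_star] contributes [hat_e_1] to [gamma_1] and
    nothing to [gamma_2]. Each condition therefore retains a single power of [eps]. *)
Lemma gamma_z_E e :
  [/\ gamma_1 (z_E z2 z3 e) ord0 0 = 1 + e ^+ 2 * X,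
      gamma_1 (z_E z2 z3 e) ord_max 0 = e ^+ 2 * Y &
      gamma_2 (z_E z2 z3 e) = e * Z].
Proof.
have [a2 [b2 [a3 [b3 [[sa2 sb2 sa3 sb3] [a21 b21 a30] z2E z3E]]]]] := ansatz_fourier.
have ca2 k := smooth_circle_entries (sa2 k); have cb2 k := smooth_circle_entries (sb2 k).
have ca3 k := smooth_circle_entries (sa3 k); have cb3 k := smooth_circle_entries (sb3 k).
have clin a a' c e' : (forall k, entries_continuous (a k)) -> (forall k, entries_continuous (a' k)) ->
  forall k, entries_continuous (fun t => a0 c k t + e' *: a k t + e' ^+ 2 *: a' k t).
  move=> ca ca' k i t; under eq_fun do rewrite 2!mxE [X in _ + X]mxE [X in _ + X + _]mxE.
  by apply: cvgD; [apply: cvgD; [exact: cvg_cst|apply: cvgMr; exact: ca]|apply: cvgMr; exact: ca'].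
have zE t s : z_E z2 z3 e t s = _ :=
  etrans (congr2 (fun x y => x + _ *: y) (congr2 (fun x y => x + _ *: y) (a_star_fourier t s) (z2E t s)) (z3E t s))
    (fourier_lin _ _ _ _ _ _ e t s).
have w1 (t s : R) : a_star s = cos s *: e_1 + sin s *: e_2 :> 'cV[R]_N by [].
have w2 (t s : R) : a_star_dot s = cos s *: e_2 + sin s *: - e_1 :> 'cV[R]_N.
  by rewrite /a_star_dot addrC scaleNr scalerN.
have cA := clin _ _ e_1 e ca2 ca3; have cB := clin _ _ e_2 e cb2 cb3.
rewrite /gamma_1 /gamma_2 !mxE /=.
split.
- rewrite (inner2_mode1 cA cB zE w1) /X (inner2_mode1 ca3 cb3 z3E w1).
  rewrite !inner1_lin // a21 b21 !inner1_0 /a0 /= !scale1r !inner1_cst !dot_delta !mxE !eqxx /=.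
  by field.
- rewrite (inner2_mode1 cA cB zE w2) /Y (inner2_mode1 ca3 cb3 z3E w2).
  rewrite !inner1_lin // a21 b21 !inner1_0 /a0 /= !scale1r !inner1_cst.
  by rewrite dotN !dot_delta !mxE !(inj_eq (@lshift_inj _ _)) /=; field.
- rewrite (inner2_mode0 cA cB zE (u := e_n)) // /Z (inner2_mode0 ca2 cb2 z2E (u := e_n)) //.
  rewrite !inner1_lin // a30 inner1_0 /a0 /= scale0r inner1_0; ring.
Qed.

(** Division by [|e|^k] leaves [|x| <= |C| |e|], which for nonzero [x] fails as soon as [|e|] is
    below [|x| / (1 + |C|)]. *)
Lemma small_coefficient (k : nat) (x : R) : (k < 3)%N ->
  (exists C : R, \forall e \near 0^', `|e ^+ k * x| <= C * `|e| ^+ 3) -> x = 0.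
Proof.
move=> k3 [C hC]; apply/eqP/contraT => x0.
have d0 : 0 < `|x| / (1 + `|C|) by rewrite divr_gt0 ?normr_gt0 // ltr_wpDr.
have : \forall e \near (0 : R)^', False.
  near=> e.
  have e0 : e != 0 by near: e; exact: nbhs_dnbhs_neq.
  have e1 : `|e| < 1 by near: e; exact: dnbhs0_lt.
  have ed : `|e| < `|x| / (1 + `|C|) by near: e; exact: dnbhs0_lt.
  have : `|e ^+ k * x| <= C * `|e| ^+ 3 by near: e.
  rewrite normrM normrX -(subnKC (ltnW k3)) exprD mulrCA ler_pM2l ?exprn_gt0 ?normr_gt0 //.
  have k1 : (1 <= 3 - k)%N by rewrite subn_gt0.
  move=> xC; have := le_trans xC (ler_wpM2r _ (ler_norm C)); rewrite exprn_ge0 // => /(_ isT) {}xC.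
  have h1 := le_trans xC (ler_wpM2l (normr_ge0 C) (ler_wiXn2l (normr_ge0 e) (ltW e1) k1)).
  move: ed; rewrite ltr_pdivlMr ?ltr_wpDr // mulrDr mulr1 ltNge; apply/negP; rewrite negbK.
  apply: le_trans h1 _; by rewrite expr1 mulrC lerDr.
by move=> /filter_ex [].
Unshelve. all: by end_near. Qed.

(** The defects are the monomials [eps^2 X], [eps^2 Y] and [eps Z]. An error [O(eps^3)] cannot hide
    a monomial of lower degree, so conditions imposed to that order hold exactly. *)
Lemma amplitude_phaseP :
  amplitude_phase_conditions z2 z3 <-> [/\ X = 0, Y = 0 & Z = 0].
Proof.
split => [[C hC]|[X0 Y0 Z0]].
  have ent i e : `|gamma_1 (z_E z2 z3 e) - hat_e_1| <= C * `|e| ^+ 3 ->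
      `|gamma_1 (z_E z2 z3 e) i 0 - hat_e_1 i 0| <= C * `|e| ^+ 3.
    apply: le_trans.
    have -> : gamma_1 (z_E z2 z3 e) i 0 - hat_e_1 i 0 = (gamma_1 (z_E z2 z3 e) - hat_e_1) i 0.
      by rewrite [RHS]mxE [X in _ = _ + X]mxE.
    exact: mx_entry_le.
  split; [apply: (@small_coefficient 2)|apply: (@small_coefficient 2)|apply: (@small_coefficient 1)] => //;
    exists C; apply: filterS hC => e [h1 h2]; have [gX gY gZ] := gamma_z_E e.
  - by have := ent ord0 e h1; rewrite gX mxE eqxx addrAC subrr add0r.
  - by have := ent ord_max e h1; rewrite gY mxE /= subr0.
  - by rewrite expr1 -gZ.
exists 0; near=> e; have [gX gY gZ] := gamma_z_E e.
rewrite gZ Z0 mulr0 normr0 mul0r; split => //.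
suff -> : gamma_1 (z_E z2 z3 e) - hat_e_1 = 0 by rewrite normr0.
apply/matrixP => i j; rewrite (ord1 j) [LHS]mxE [X in _ + X]mxE.
have [->|->] : i = ord0 \/ i = ord_max.
  by case: i => -[|[|//]] ?; [left|right]; exact/val_inj.
- by rewrite gX X0 !mxE eqxx mulr0 addr0 subrr.
- by rewrite gY Y0 !mxE mulr0 /= subr0.
Unshelve. all: by end_near. Qed.

Lemma sum_1_3 (f : nat -> 'cV[R]_N) : \sum_(1 <= k < 4) f k = f 1%N + f 2%N + f 3%N.
Proof. by rewrite big_ltn // big_ltn // big_nat1 addrA. Qed.

Lemma fourier_unroll a b t s :
  fourier a b t s = a 0%N t + \sum_(1 <= k < 4) (cos (k%:R * s) *: a k t + sin (k%:R * s) *: b k t).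
Proof.
rewrite /fourier -(big_mkord xpredT (fun k => cos (k%:R * s) *: a k t + sin (k%:R * s) *: b k t)).
by rewrite big_ltn // mul0r cos0 sin0 scale1r scale0r addr0.
Qed.

(** Here [aE] and [bE] are any families of the prescribed form, so their coefficients are first
    identified with a Fourier expansion of [z2] and [z3]; [X], [Y] and [Z] are then evaluated in
    terms of them. *)
Lemma fourier_form_orthogonality (aE bE : nat -> R -> R -> 'cV[R]_N) e :
  X = 0 -> Y = 0 -> Z = 0 -> fourier_form z2 z3 aE bE ->
  [/\ inner1 (aE 1%N ^~ e) (fun=> e_1) + inner1 (bE 1%N ^~ e) (fun=> e_2) = 0,
      inner1 (aE 1%N ^~ e) (fun=> e_2) - inner1 (bE 1%N ^~ e) (fun=> e_1) = 0 &
      inner1 (aE 0%N ^~ e) (fun=> e_n) = 0].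
Proof.
move=> X0 Y0 Z0 [zE [[c0 [s0 E0]] [c2 [s2 E2]] [d2 [t2 F2]]]
  [[c1 [s1 E1]] [d1 [t1 F1]] [c3 [s3 E3]] [d3 [t3 F3]]]].
pose a2 (k : nat) : R -> 'cV[R]_N := match k with 0%N => c0 | 2%N => c2 | _ => fun=> 0 end.
pose b2 (k : nat) : R -> 'cV[R]_N := match k with 2%N => d2 | _ => fun=> 0 end.
pose a3 (k : nat) : R -> 'cV[R]_N := match k with 1%N => c1 | 3%N => c3 | _ => fun=> 0 end.
pose b3 (k : nat) : R -> 'cV[R]_N := match k with 1%N => d1 | 3%N => d3 | _ => fun=> 0 end.
have c00 : entries_continuous (fun _ : R => 0 : 'cV[R]_N) by move=> i t; exact: cvg_cst.
have ca2 k : entries_continuous (a2 k) by case: k => [|[|[|k]]] //=; exact: smooth_circle_entries.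
have cb2 k : entries_continuous (b2 k) by case: k => [|[|[|k]]] //=; exact: smooth_circle_entries.
have ca3 k : entries_continuous (a3 k) by case: k => [|[|[|[|k]]]] //=; exact: smooth_circle_entries.
have cb3 k : entries_continuous (b3 k) by case: k => [|[|[|[|k]]]] //=; exact: smooth_circle_entries.
have key x t s : x *: z2 t s + x ^+ 2 *: z3 t s = x *: fourier a2 b2 t s + x ^+ 2 *: fourier a3 b3 t s.
  apply: (@addrI _ (a_star s)); rewrite addrA -[LHS]/(z_E z2 z3 x t s) zE.
  rewrite !fourier_unroll !sum_1_3 /a2 /b2 /a3 /b3 E0 E1 E2 E3 F1 F2 F3 -addrA; congr (a_star s + _).
  move: (cos _) (sin _) (cos _) (sin _) (cos _) (sin _) => ? ? ? ? ? ?.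
  by apply/matrixP => i j; rewrite !mxE; ring.
(* The identity at [x = 1] and [x = -1] separates the two orders, [z2] being the odd part in [x] and
   [z3] the even part. *)
have z2E t s : z2 t s = fourier a2 b2 t s.
  have h1 := key 1 t s; have h2 := key (-1) t s.
  apply/matrixP => i j; move/(congr1 (fun M : 'cV[R]_N => M i j)) : h1; move/(congr1 (fun M : 'cV[R]_N => M i j)) : h2.
  rewrite 2!mxE [X in _ + X = _]mxE [X in _ = X]mxE [X in _ = X + _]mxE [X in _ = _ + X]mxE => h2.
  rewrite 2!mxE [X in _ + X = _]mxE [X in _ = X]mxE [X in _ = X + _]mxE [X in _ = _ + X]mxE => h1.
  lra.
have z3E t s : z3 t s = fourier a3 b3 t s.
  by have := key 1 t s; rewrite expr1n !scale1r z2E => /addrI.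
have w1 (t s : R) : a_star s = cos s *: e_1 + sin s *: e_2 :> 'cV[R]_N by [].
have w2 (t s : R) : a_star_dot s = cos s *: e_2 + sin s *: - e_1 :> 'cV[R]_N.
  by rewrite /a_star_dot addrC scaleNr scalerN.
move: X0 Y0 Z0; rewrite /X (inner2_mode1 ca3 cb3 z3E w1) /Y (inner2_mode1 ca3 cb3 z3E w2).
rewrite /Z (inner2_mode0 ca2 cb2 z2E (u := e_n)) // [a2 0%N]/= [a3 1%N]/= [b3 1%N]/=.
rewrite inner1N; last exact: smooth_circle_entries.
move=> /eqP; rewrite mulf_eq0 invr_eq0 pnatr_eq0 /= => /eqP X0.
move=> /eqP; rewrite mulf_eq0 invr_eq0 pnatr_eq0 /= => /eqP Y0 Z0.
have -> : aE 1%N ^~ e = fun t => e ^+ 2 *: c1 t by apply/funext => t.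
have -> : bE 1%N ^~ e = fun t => e ^+ 2 *: d1 t by apply/funext => t.
have -> : aE 0%N ^~ e = fun t => e ^+ 1 *: c0 t by apply/funext => t.
rewrite !inner1Z; try exact: smooth_circle_entries.
by rewrite -mulrDr -mulrBr X0 Y0 Z0 !mulr0.
Qed.

End Ansatz.
End Conditions.

(** * The constructed solution in the form of the statement *)

Section ModalVectors.
Context (R : realType) (m : nat).
Local Notation N := (ns_dim m).
Implicit Types (a b : 'I_N -> nat -> R -> R).

Definition column a (k : nat) (t : R) : 'cV[R]_N := \col_i a i k t.

Lemma smooth_circle_column a k : smooth_family a -> smooth_circle (column a k).
Proof.
move=> sa; split.
  by move=> t; apply/matrixP => i j; rewrite !mxE (sa i k).2.
apply/(smooth_on_entriesP _ (@openT R)) => i j.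
by apply: (sm_ext (@openT R) _ (sa i k).1) => t _; rewrite mxE.
Qed.

Lemma modal_vecE ms a b t s : modal_vec ms a b t s
  = \sum_(k <- ms) (cos (k%:R * s) *: column a k t + sin (k%:R * s) *: column b k t).
Proof.
apply/matrixP => i j; rewrite mxE summxE; apply: eq_bigr => k _.
by rewrite !mxE.
Qed.

Lemma smooth_torus_modal_vec ms a b : smooth_family a -> smooth_family b ->
  smooth_torus (modal_vec ms a b).
Proof.
move=> sa sb; split.
- move=> s t; rewrite !modal_vecE; apply: eq_bigr => k _.
  by rewrite (smooth_circle_column k sa).1 (smooth_circle_column k sb).1.
- move=> t s; rewrite !modal_vecE; apply: eq_bigr => k _.
  rewrite mulrDr [k%:R * (2 * pi)]mulrC.
  by rewrite (periodic_nat k _ (@cos_periodic R)) (periodic_nat k _ (@sin_periodic R)).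
have oT := @openT (R * R)%type.
apply/(smooth_on_entriesP _ oT) => i j.
apply: (sm_ext oT (f := fun p : R * R => modal ms (a i) (b i) p.1 p.2)) => [p _|]; first by rewrite mxE.
apply: sm_sum => [|k]; first exact: oT.
have [sc ss] := sm_cosM_sinM (R := R) k%:R.
apply: smD; [exact: oT|apply: smM; first exact: oT|apply: smM; first exact: oT].
- exact: (sm_snd sc).
- exact: (sm_fst (sa i k).1).
- exact: (sm_snd ss).
- exact: (sm_fst (sb i k).1).
Qed.

Lemma only_modes_modal_vec ms a b : smooth_family a -> smooth_family b ->
  only_modes ms (modal_vec ms a b).
Proof.
move=> sa sb; exists (column a), (column b); split; last exact: modal_vecE.
by move=> k; split; exact: smooth_circle_column.
Qed.

Lemma inner1_delta (f : R -> 'cV[R]_N) i :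
  inner1 f (fun=> delta_mx i 0) = mean (fun t => f t i 0).
Proof. by apply: mean_eq => t; rewrite dot_delta. Qed.

Lemma mean_addZ (f g : R -> R) (c : R) : continuous f -> continuous g ->
  mean (fun t => f t + c * g t) = mean f + c * mean g.
Proof.
move=> cf cg; have ch (x : bool) : continuous (if x then f else g) by case: x.
have := mean_lincomb [:: true; false] (fun x : bool => if x then 1 else c) ch.
rewrite !big_cons big_nil addr0 mul1r => <-.
by apply: mean_eq => t; rewrite !big_cons big_nil addr0 mul1r.
Qed.

Section Solution.
Variables (a2 b2 a3 b3 : 'I_N -> nat -> R -> R).
Hypotheses (sa2 : smooth_family a2) (sb2 : smooth_family b2).
Hypotheses (sa3 : smooth_family a3) (sb3 : smooth_family b3).
Hypothesis mean_n : smper0 (a2 il 0%N).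
Hypothesis mean_1 : smper0 (fun t => a3 (ih m 0) 1%N t + b3 (ih m 1) 1%N t).
Hypothesis mean_2 : smper0 (fun t => a3 (ih m 1) 1%N t - b3 (ih m 0) 1%N t).
Let z2 := modal_vec [:: 0; 2]%N a2 b2.
Let z3 := modal_vec [:: 1; 3]%N a3 b3.

Lemma modal_ansatz_form : ansatz_form z2 z3.
Proof.
by split; [exact: smooth_torus_modal_vec|exact: smooth_torus_modal_vec
  |exact: only_modes_modal_vec|exact: only_modes_modal_vec].
Qed.

(** The conditions reduce to the vanishing of the means of the three combinations that were arranged
    to have periodic primitives. *)
Lemma modal_amplitude_phase : amplitude_phase_conditions z2 z3.
Proof.
have cc a k : smooth_family a -> entries_continuous (column a k).
  by move=> sa; apply: smooth_circle_entries; exact: smooth_circle_column.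
have c0 : entries_continuous (fun _ : R => 0 : 'cV[R]_N) by move=> i t; exact: cvg_cst.
have cm (ms : seq nat) a k : smooth_family a -> entries_continuous (if k \in ms then column a k else fun=> 0).
  by move=> sa; case: ifP => _ //; exact: cc.
have ca i k a : smooth_family a -> continuous (a i k).
  by move=> sa t; exact: (sm_cont (sa i k).1).
have z2E t s := etrans (modal_vecE [:: 0; 2]%N a2 b2 t s)
  (sum_modes_fourier (ms := [:: 0; 2]%N) (column a2) (column b2) t s isT isT).
have z3E t s := etrans (modal_vecE [:: 1; 3]%N a3 b3 t s)
  (sum_modes_fourier (ms := [:: 1; 3]%N) (column a3) (column b3) t s isT isT).
have w1 (t s : R) : a_star s = cos s *: e_1 + sin s *: e_2 :> 'cV[R]_N by [].
have w2 (t s : R) : a_star_dot s = cos s *: e_2 + sin s *: - e_1 :> 'cV[R]_N.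
  by rewrite /a_star_dot addrC scaleNr scalerN.
have h1 : ih m 1 = lshift (m + 1) ord_max by congr (lshift _ _); exact/val_inj.
have colE a i k : mean (fun t => column a k t i 0) = mean (a i k).
  by apply: mean_eq => t; rewrite mxE.
apply/(amplitude_phaseP modal_ansatz_form); split.
- rewrite (inner2_mode1 _ _ z3E w1) /=; try by move=> k; exact: cm.
  rewrite /e_1 /e_2 !inner1_delta !colE -h1.
  have /= := mean_smper0 mean_1; under mean_eq do rewrite -[b3 _ _ _]mul1r.
  by rewrite mean_addZ ?mul1r => [->|//|]; [rewrite mulr0|exact: ca|exact: ca].
- rewrite (inner2_mode1 _ _ z3E w2) /=; try by move=> k; exact: cm.
  rewrite inner1N; last exact: cc.
  rewrite /e_1 /e_2 !inner1_delta !colE -h1.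
  have /= := mean_smper0 mean_2; under mean_eq do rewrite -[- b3 _ _ _]mulN1r.
  by rewrite mean_addZ ?mulN1r => [->|//|]; [rewrite mulr0|exact: ca|exact: ca].
- rewrite (inner2_mode0 (u := e_n) _ _ z2E) //=; try by move=> k; exact: cm.
  by rewrite /e_n inner1_delta colE mean_smper0.
Qed.

Lemma modal_fourier_form : exists aE bE, fourier_form z2 z3 aE bE.
Proof.
pose A k t e : 'cV[R]_N := match k with
  | 0%N | 2%N => e ^+ 1 *: column a2 k t | _ => e ^+ 2 *: column a3 k t end.
pose B k t e : 'cV[R]_N := match k with
  | 2%N => e ^+ 1 *: column b2 k t | _ => e ^+ 2 *: column b3 k t end.
exists A, B; split.
- move=> e t s; rewrite /z_E /z2 /z3 !modal_vecE sum_1_3 !big_cons !big_nil /A /B mul0r cos0 sin0.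
  move: (a_star s) (cos _) (sin _) (cos _) (sin _) (cos _) (sin _) => ? ? ? ? ? ? ?.
  by apply/matrixP => i j; rewrite !mxE; ring.
- by split; [exists (column a2 0%N)|exists (column a2 2%N)|exists (column b2 2%N)];
    split => //; exact: smooth_circle_column.
- by split; [exists (column a3 1%N)|exists (column b3 1%N)|exists (column a3 3%N)|exists (column b3 3%N)];
    split => //; exact: smooth_circle_column.
Qed.

End Solution.
End ModalVectors.

Theorem theorem5p1 (R : realType) (m : nat) (S : ns_data R m)
  (hS : neimark_sacker S)
  (no_resonance_3 : om_star S != 3^-1)
  (no_resonance_4 : om_star S != 4^-1) :
  [/\ G_expansion S,
      exists (lam2 om2 eta2 : R) (z2 z3 : R -> R -> 'cV[R]_(ns_dim m)),
        [/\ ansatz_form z2 z3,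
            asymptotic_equation S lam2 om2 eta2 z2 z3,
            amplitude_phase_conditions z2 z3 &
            exists aE bE : nat -> R -> R -> 'cV[R]_(ns_dim m),
              fourier_form z2 z3 aE bE] &
      forall z2 z3 : R -> R -> 'cV[R]_(ns_dim m),
        ansatz_form z2 z3 -> amplitude_phase_conditions z2 z3 ->
        [/\ inner2 z3 (fun _ phi => a_star phi) = 0,
            inner2 z3 (fun _ phi => a_star_dot phi) = 0,
            inner2 z2 (fun _ _ => e_n) = 0 &
            forall aE bE : nat -> R -> R -> 'cV[R]_(ns_dim m),
              fourier_form z2 z3 aE bE -> forall eps : R,
              [/\ inner1 (aE 1%N ^~ eps) (fun=> e_1)
                    + inner1 (bE 1%N ^~ eps) (fun=> e_2) = 0,
                  inner1 (aE 1%N ^~ eps) (fun=> e_2)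
                    - inner1 (bE 1%N ^~ eps) (fun=> e_1) = 0 &
                  inner1 (aE 0%N ^~ eps) (fun=> e_n) = 0]]].
Proof.
split; first exact: G_expansion_holds hS.
  have [lam2 [om2 [eta2 [a2 [b2 [a3 [b3 [[sa2 sb2 sa3 sb3] eqS mn m1 m2]]]]]]]] :=
    modal_solution hS no_resonance_3 no_resonance_4.
  exists lam2, om2, eta2, (modal_vec [:: 0; 2]%N a2 b2), (modal_vec [:: 1; 3]%N a3 b3).
  by split; [exact: modal_ansatz_form|exact: eqS|exact: modal_amplitude_phase|exact: modal_fourier_form].
(* This clause concerns every pair of the prescribed form that meets the conditions, not only the
   constructed one. *)
move=> z2 z3 hz hC; have [X0 Y0 Z0] := (amplitude_phaseP hz).1 hC.
by split=> // aE bE ff e; exact: fourier_form_orthogonality ff.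
Qed.
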